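(* Let $f\in C^\infty(\mathbb{R}^d)$ be a tempered distribution such that $\operatorname{supp}\mathcal{F}f$ is compact. Let $K$ be a non-empty compact subset of $\mathbb{R}^d$. Then: (a) For any set $\mathcal{P}_K$ of polynomials determining $K$, one has $\operatorname{supp}\mathcal{F}f\subset K$ if, and only if, $$\widetilde R(P,f)\le\max_{\lambda\in K}|P(i\lambda)|$$ for all $P\in\mathcal{P}_K$. (b) If $f\neq 0$, then for any set $\mathcal{P}_{\operatorname{supp}\mathcal{F}f}$ of polynomials determining $\operatorname{supp}\mathcal{F}f$, a point $\lambda\in\mathbb{R}^d$ is in $\operatorname{supp}\mathcal{F}f$ if, and only if, $$|P(i\lambda)|\le\widetilde R(P,f)$$ for all $P\in\mathcal{P}_{\operatorname{supp}\mathcal{F}f}$. (c) One can reconstruct $\operatorname{supp}\mathcal{F}f$ as $$\operatorname{supp}\mathcal{F}f=\{\lambda\in\mathbb{R}^d:|P(i\lambda)|\le\widetilde R(P,f)\text{ for all polynomials }P\}.$$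
   Context: $\mathbb{N}=\{1,2,3,\ldots\}$, $\mathbb{N}_0=\{0,1,2,\ldots\}$. Polynomials are on $\mathbb{R}^d$ with complex coefficients. For a polynomial $P$, $P(\partial)$ is the corresponding constant coefficient differential operator, so that $P(\partial)e^{i\lambda\cdot x}=P(i\lambda)e^{i\lambda\cdot x}$. The Fourier transform is $\mathcal{F}f(\lambda)=(2\pi)^{-d/2}\int_{\mathbb{R}^d}f(x)e^{-i\lambda\cdot x}\,dx$ on $L^1(\mathbb{R}^d)$, extended to tempered distributions by $\langle\mathcal{F}T,\phi\rangle=\langle T,\mathcal{F}\phi\rangle$ for Schwartz functions $\phi$. For $f\in C^\infty(\mathbb{R}^d)$ a tempered distribution with $\operatorname{supp}\mathcal{F}f$ compact, $\widetilde R(P,f)$ is the infimum of all $R\ge 0$ for which there exist constants $N\in\mathbb{N}_0$ and $C_{N,R}\ge 0$ such that, for all $n\in\mathbb{N}$ and $x\in\mathbb{R}^d$, $|P(\partial)^n f(x)|\le C_{N,R}\,n^N R^n(1+|x|)^N$. For a non-empty compact $K\subset\mathbb{R}^d$, a set $\mathcal{P}_K$ of polynomials determines $K$ if $$K=\bigcap_{P\in\mathcal{P}_K}\Bigl\{\lambda\in\mathbb{R}^d:|P(i\lambda)|\le\max_{\mu\in K}|P(i\mu)|\Bigr\}.$$ *)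

(* Defs.v *)
From HB Require Import structures.
From mathcomp Require Import all_boot all_order all_algebra complex.
From mathcomp Require Import all_classical all_reals all_analysis.
From mathcomp Require mpoly.

Set Implicit Arguments.
Unset Strict Implicit.
Unset Printing Implicit Defensive.

Import Order.TTheory GRing.Theory Num.Theory.
Import numFieldNormedType.Exports.

Local Open Scope classical_set_scope.
Local Open Scope complex_scope.
Local Open Scope ring_scope.

(* The measurable structure of the library is on n.-tuples, whereas the
   topology and the norm are on row vectors: Lebesgue measure is built on tuples
   by iterating the product with the line, and integrals are transported. *)
Section lebesgue_tuple.
Context (R : realType).
Local Notation mR := (measurableTypeR R).

Section cons.
Context (n : nat) (mu : {sigma_finite_measure set (n.-tuple mR) -> \bar R}).

Definition tuple_cons (p : mR * n.-tuple mR) : n.+1.-tuple mR :=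
  [the n.+1.-tuple mR of p.1 :: p.2].

Lemma measurable_tuple_cons : measurable_fun [set: mR * n.-tuple mR] tuple_cons.
Proof. exact: measurable_cons. Qed.

Definition lebesgue_cons : set (n.+1.-tuple mR) -> \bar R :=
  pushforward (lebesgue_measure \x mu)%E tuple_cons.

Let lebesgue_cons0 : lebesgue_cons set0 = 0%E.
Proof. by rewrite /lebesgue_cons /pushforward preimage_set0 measure0. Qed.

Let lebesgue_cons_ge0 A : (0 <= lebesgue_cons A)%E.
Proof. by rewrite /lebesgue_cons /pushforward; exact: measure_ge0. Qed.

Let lebesgue_cons_sigma_additive : semi_sigma_additive lebesgue_cons.
Proof.
move=> F mF tF mUF.
have mcons A : measurable A -> measurable (tuple_cons @^-1` A).
  by move=> mA; rewrite -[X in measurable X]setTI; exact: measurable_tuple_cons.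
rewrite /lebesgue_cons /pushforward preimage_bigcup.
apply: measure_semi_sigma_additive.
- by move=> k; exact: mcons.
- apply/trivIsetP => /= i j _ _ ij; rewrite -preimage_setI.
  by move/trivIsetP : tF => /(_ _ _ _ _ ij) ->//; rewrite preimage_set0.
- by rewrite -preimage_bigcup; exact: mcons.
Qed.

HB.instance Definition _ := isMeasure.Build _ _ _ lebesgue_cons
  lebesgue_cons0 lebesgue_cons_ge0 lebesgue_cons_sigma_additive.

Let lebesgue_cons_sigma_finite : sigma_finite setT lebesgue_cons.
Proof.
pose leb : {sigma_finite_measure set mR -> \bar R} := @lebesgue_measure R.
have /sigma_finiteP[F [TF ndF Foo]] := sigma_finiteT leb.
have /sigma_finiteP[G [TG ndG Goo]] := sigma_finiteT mu.
pose g (t : n.+1.-tuple mR) : mR * n.-tuple mR := (thead t, [tuple of behead t]).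
have gK t : tuple_cons (g t) = t by apply: val_inj; rewrite [in RHS](tuple_eta t).
have Kg p : g (tuple_cons p) = p.
  by case: p => x t; congr pair; exact: val_inj.
have mg : measurable_fun [set: n.+1.-tuple mR] g.
  apply/measurable_fun_pairP; split; first exact: measurable_tnth.
  exact: measurable_behead.
exists (fun k => g @^-1` (F k `*` G k)).
  rewrite -preimage_bigcup (_ : \bigcup_k _ = setT) ?preimage_setT//.
  apply/seteqP; split => // -[x t] _.
  have [i _ Fix] : (\bigcup_k F k) x by rewrite -TF.
  have [j _ Gjt] : (\bigcup_k G k) t by rewrite -TG.
  exists (maxn i j) => //; split => /=.
  - by move: x Fix; exact/subsetPset/ndF/leq_maxl.
  - by move: t Gjt; exact/subsetPset/ndG/leq_maxr.
move=> k; have [mFk Fkoo] := Foo k; have [mGk Gkoo] := Goo k; split.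
  by rewrite -[X in measurable X]setTI; apply: mg => //; exact: measurableX.
rewrite /lebesgue_cons /pushforward -comp_preimage.
rewrite (_ : g \o tuple_cons = id); last exact/funext.
by rewrite preimage_id product_measure1E// lte_mul_pinfty// ge0_fin_numE.
Qed.

HB.instance Definition _ := Measure_isSigmaFinite.Build _ _ _ lebesgue_cons
  lebesgue_cons_sigma_finite.

End cons.

Fixpoint lebesgue_tuple (n : nat) :
    {sigma_finite_measure set (n.-tuple mR) -> \bar R} :=
  if n is n'.+1 then lebesgue_cons (lebesgue_tuple n')
  else dirac [tuple].

End lebesgue_tuple.

Section distributions.
Context (R : realType) (d : nat).
Implicit Types (f g phi psi : 'rV[R]_d -> R[i]) (x lambda : 'rV[R]_d).
Implicit Types (P : mpoly.mpoly d R[i]) (m : mpoly.multinom d).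
Implicit Types T : ('rV[R]_d -> R[i]) -> R[i].

(* [normc] is the [R]-valued modulus; the norm of the library on ['rV[R]_d] is
   the sup norm, hence an explicit Euclidean norm. *)
Local Notation normc := ComplexField.Normc.normc.

Definition dotv x lambda : R := \sum_(j < d) x 0 j * lambda 0 j.

Definition enorm x : R := Num.sqrt (\sum_(j < d) x 0 j ^+ 2).

Definition ref f x : R := complex.Re (f x).
Definition imf f x : R := complex.Im (f x).

Definition pderiv (j : 'I_d) f x : R[i] :=
  'D_(delta_mx 0 j) (ref f) x +i* 'D_(delta_mx 0 j) (imf f) x.

Definition smooth f := forall s : seq 'I_d,
  let g := foldr pderiv f s in
  [/\ continuous (ref g), continuous (imf g) &
      forall j x, derivable (ref g) x (delta_mx 0 j) /\
                  derivable (imf g) x (delta_mx 0 j)].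

Definition mpderiv m f : 'rV[R]_d -> R[i] :=
  foldr (fun j => iter (mpoly.fun_of_multinom m j) (pderiv j)) f (enum 'I_d).

Definition pdiffop P f x : R[i] :=
  \sum_(m <- mpoly.msupp P) mpoly.mcoeff m P * mpderiv m f x.

Definition pevali P lambda : R[i] := mpoly.meval (fun j => 0 +i* lambda 0 j) P.

Definition cintegral f : R[i] :=
  (\int[lebesgue_tuple R d]_t ref f (\row_j tnth t j)) +i*
  (\int[lebesgue_tuple R d]_t imf f (\row_j tnth t j)).

Definition expi (t : R) : R[i] := cos t +i* sin t.

Definition fourier f lambda : R[i] :=
  ((2 * pi) `^ (- (d%:R / 2)))%:C *
  cintegral (fun x => f x * expi (- dotv lambda x)).

Definition schwartz_norm (N : nat) phi : \bar R :=
  ereal_sup [set ((1 + enorm q.2) ^+ N * normc (mpderiv q.1 phi q.2))%:E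
            | q in [set q : mpoly.multinom d * 'rV[R]_d | (mpoly.mdeg q.1 <= N)%N]].

Definition schwartz phi :=
  smooth phi /\ forall N, (schwartz_norm N phi < +oo)%E.

(* A distribution is a total function of which only the values on Schwartz
   functions are meaningful. *)
Definition tempered T :=
  (forall (a : R[i]) phi psi, schwartz phi -> schwartz psi ->
     T (fun x => a * phi x + psi x) = a * T phi + T psi) /\
  (exists (N : nat) (C : R), forall phi, schwartz phi ->
     ((normc (T phi))%:E <= C%:E * schwartz_norm N phi)%E).

Definition tsupp phi : set 'rV[R]_d := closure [set x | phi x != 0].

Definition test_fun phi := smooth phi /\ compact (tsupp phi).

(* [T] is the (necessarily unique) tempered distribution extending the
   distribution defined by the function [f]; [f] itself need not be of
   polynomial growth. *)
Definition extends_fun T f :=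
  forall phi, test_fun phi -> T phi = cintegral (fun x => f x * phi x).

Definition fourier_dist T : ('rV[R]_d -> R[i]) -> R[i] :=
  fun phi => T (fourier phi).

Definition dist_supp T : set 'rV[R]_d :=
  ~` \bigcup_(U in [set U | open U /\ forall phi, test_fun phi ->
                              tsupp phi `<=` U -> T phi = 0]) U.

(* [+oo] when no [r] is admissible. *)
Definition Rtilde P f : \bar R :=
  ereal_inf [set r%:E | r in [set r : R | 0 <= r /\
    exists (N : nat) (C : R), 0 <= C /\
      forall (n : nat) x, (0 < n)%N ->
        normc (iter n (pdiffop P) f x) <=
          C * n%:R ^+ N * r ^+ n * (1 + enorm x) ^+ N]].

(* Attained, i.e. a maximum, when [K] is compact and non-empty. *)
Definition maxmod P (K : set 'rV[R]_d) : R :=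
  sup [set normc (pevali P mu) | mu in K].

Definition determines (PK : set (mpoly.mpoly d R[i])) (K : set 'rV[R]_d) :=
  K = \bigcap_(P in PK) [set lambda | normc (pevali P lambda) <= maxmod P K].

End distributions.

(* Main.v *)
(* Write S for the support of F f and P(i.) for the symbol of P. Everything
   follows from |P(ix)| <= R~(P,f) <= max_S |P(i.)| for x in S, and from the fact
   that a compact set K is determined by the set of all polynomials: if x is not
   in K and c >= |y - x|^2 on K, the polynomial with symbol c - |y - x|^2 is
   larger at x than on K.

   Upper bound. With E_q(y) = exp(i a.y - q|y|^2 / 2), whose transform is an
   approximate identity at a, P(D)^n f(a) is up to a constant the limit of
   T(F(P(i.)^n E_q)). Inserting a cutoff chi equal to 1 near S and supported where
   |P(i.)| < r does not change T(F(.)), and the Schwartz seminorms of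
   chi P(i.)^n E_q are O(n^M r^n (1 + |a|)^M) uniformly in 0 < q <= 1.

   Lower bound. If r is admissible and r < r1 < |P(i.)| near x, a test function
   phi supported near x is P(i.)^n (P(i.)^(-n) phi), so T(F phi) is the pairing of
   P(D)^n f with F(P(i.)^(-n) phi). It is O(n^k r^n r1^(-n)), hence zero, and x is
   not in S. *)
Require Import Defs.
From mathcomp Require Import all_boot all_order all_algebra complex.
From mathcomp Require Import all_classical all_reals all_analysis.
From mathcomp Require mpoly.
From mathcomp Require Import measurable_realfun ring lra.
Import Order.TTheory GRing.Theory Num.Theory.
Import numFieldNormedType.Exports.

Set Implicit Arguments.
Unset Strict Implicit.
Unset Printing Implicit Defensive.

Local Open Scope classical_set_scope.
Local Open Scope complex_scope.
Local Open Scope ring_scope.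

Local Notation normc := ComplexField.Normc.normc.
Local Notation normcM := ComplexField.Normc.normcM.
Local Notation normc0 := ComplexField.Normc.normc0.
Local Notation normc1 := ComplexField.Normc.normc1.
Local Notation CRe := complex.Re.
Local Notation CIm := complex.Im.

(** * Complex-valued smooth functions *)

Section complex_facts.
Context (R : realType).
Implicit Types x y z : R[i].

(** Since [f] need not grow polynomially, [T phi] is known to be the integral of [f * phi] for test
    functions only. Gaussians and Fourier transforms of test functions are not test functions, so
    every pairing with them goes through compactly supported cutoffs, and temperedness controls the
    remainders. Growth becomes available only in the lower bound, where an admissible [r] bounds
    [P(D)^n f] by a power of [1 + |x|] for each [n >= 1]. Fourier inversion is replaced by one
    explicit transform, that of [gexp q a], found from its differential equations. Limits are taken
    quantitatively, as inequalities with an error [C / (k + 1)], and derivatives of integrals come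
    from quadratic remainders, so that limits and integrals are never exchanged. Constants are
    tracked in [n] only where the spectral radius needs it: in the seminorms of an [n]-th power
    times a fixed function with compact support. Everywhere else [n] is fixed and mere continuity is
    enough. *)

Lemma complex_ext x y : CRe x = CRe y -> CIm x = CIm y -> x = y.
Proof. by case: x => a b; case: y => c d /= -> ->. Qed.

Lemma CReD x y : CRe (x + y) = CRe x + CRe y. Proof. by case: x; case: y. Qed.
Lemma CImD x y : CIm (x + y) = CIm x + CIm y. Proof. by case: x; case: y. Qed.
Lemma CReM x y : CRe (x * y) = CRe x * CRe y - CIm x * CIm y.
Proof. by case: x; case: y. Qed.
Lemma CImM x y : CIm (x * y) = CRe x * CIm y + CIm x * CRe y.
Proof. by case: x; case: y. Qed.
Lemma CReN x : CRe (- x) = - CRe x. Proof. by case: x. Qed.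
Lemma CImN x : CIm (- x) = - CIm x. Proof. by case: x. Qed.

Lemma normc_ReImE z : normc z = Num.sqrt (CRe z ^+ 2 + CIm z ^+ 2).
Proof. by case: z. Qed.

Lemma normc_ge0 z : 0 <= normc z.
Proof. by rewrite normc_ReImE sqrtr_ge0. Qed.

Lemma normcR (r : R) : normc r%:C = `|r|.
Proof. by rewrite normc_ReImE /= expr0n addr0 sqrtr_sqr. Qed.

Lemma normcN z : normc (- z) = normc z.
Proof. by rewrite !normc_ReImE CReN CImN !sqrrN. Qed.

Lemma normcD x y : normc (x + y) <= normc x + normc y.
Proof. exact: le_normcD. Qed.

Lemma normcB x y : normc (x - y) <= normc x + normc y.
Proof. by rewrite -(normcN y); exact: normcD. Qed.

Lemma normcX z n : normc (z ^+ n) = normc z ^+ n.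
Proof.
elim: n => [|n IH]; first by rewrite !expr0 normc1.
by rewrite !exprS normcM IH.
Qed.

Lemma normRe_le z : `|CRe z| <= normc z.
Proof.
rewrite normc_ReImE -[leLHS]sqrtr_sqr ler_sqrt ?addr_ge0 ?sqr_ge0//.
by rewrite lerDl sqr_ge0.
Qed.

Lemma normIm_le z : `|CIm z| <= normc z.
Proof.
rewrite normc_ReImE -[leLHS]sqrtr_sqr ler_sqrt ?addr_ge0 ?sqr_ge0//.
by rewrite lerDr sqr_ge0.
Qed.

Lemma normc_le_ReIm z : normc z <= `|CRe z| + `|CIm z|.
Proof.
rewrite normc_ReImE -[leRHS]ger0_norm ?addr_ge0// -[leRHS]sqrtr_sqr.
rewrite ler_sqrt ?sqr_ge0// sqrrD -!(real_normK (num_real (CRe z))).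
rewrite -!(real_normK (num_real (CIm z))) [leRHS]addrAC lerDl.
by rewrite mulrn_wge0// mulr_ge0.
Qed.

Lemma normc_eq0P z : normc z = 0 -> z = 0.
Proof. exact: ComplexField.Normc.eq0_normc. Qed.

Lemma realcM (a b : R) : (a * b)%:C = a%:C * b%:C.
Proof. by apply: complex_ext => /=; ring. Qed.
Lemma realcD (a b : R) : (a + b)%:C = a%:C + b%:C.
Proof. by apply: complex_ext => /=; ring. Qed.

End complex_facts.

Section derivatives.
Context (R : realType) (d : nat).
Implicit Types (f g h : 'rV[R]_d -> R[i]) (x : 'rV[R]_d) (j : 'I_d).

Definition ccont f := continuous (ref f) /\ continuous (imf f).

(** The value is an argument of the relation, so that existence and computation of a derivative are
    proved together. *)
Definition isd j f x (a : R[i]) :=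
  is_derive x (delta_mx 0 j : 'rV[R]_d) (ref f) (CRe a) /\
  is_derive x (delta_mx 0 j : 'rV[R]_d) (imf f) (CIm a).

Definition pdble j f x := derivable (ref f) x (delta_mx 0 j) /\
  derivable (imf f) x (delta_mx 0 j).

Lemma isd_val j f x a : isd j f x a -> pderiv j f x = a.
Proof. by case=> [[? h1] [? h2]]; apply: complex_ext. Qed.

Lemma isd_pdble j f x a : isd j f x a -> pdble j f x.
Proof. by case=> fa fb; split; [exact: (@ex_derive _ _ _ _ _ _ _ fa)|exact: (@ex_derive _ _ _ _ _ _ _ fb)]. Qed.

Lemma pdble_isd j f x : pdble j f x -> isd j f x (pderiv j f x).
Proof. by case=> fa fb; split; [exact: (DeriveDef fa erefl)|exact: (DeriveDef fb erefl)]. Qed.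

Lemma isd_eq j f x a b : isd j f x a -> a = b -> isd j f x b.
Proof. by move=> ? <-. Qed.

Lemma isdD j f g x a b : isd j f x a -> isd j g x b ->
  isd j (fun y => f y + g y) x (a + b).
Proof.
case=> [fa fb] [ga gb]; split.
- have -> : ref (fun y => f y + g y) = ref f + ref g.
    by apply/funext => y; rewrite /ref /= CReD.
  by rewrite CReD; exact: is_deriveD.
- have -> : imf (fun y => f y + g y) = imf f + imf g.
    by apply/funext => y; rewrite /imf /= CImD.
  by rewrite CImD; exact: is_deriveD.
Qed.

Lemma isdM j f g x a b : isd j f x a -> isd j g x b ->
  isd j (fun y => f y * g y) x (a * g x + f x * b).
Proof.
case=> [fa fb] [ga gb]; split.
- have -> : ref (fun y => f y * g y) = ref f * ref g - imf f * imf g.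
    by apply/funext => y; rewrite /ref /imf /= CReM.
  apply: (is_derive_eq (is_deriveB (is_deriveM fa ga) (is_deriveM fb gb))).
  by rewrite CReD !CReM /ref /imf /GRing.scale /=; ring.
- have -> : imf (fun y => f y * g y) = ref f * imf g + imf f * ref g.
    by apply/funext => y; rewrite /ref /imf /= CImM.
  apply: (is_derive_eq (is_deriveD (is_deriveM fa gb) (is_deriveM fb ga))).
  by rewrite CImD !CImM /ref /imf /GRing.scale /=; ring.
Qed.

Lemma isd_cst j (c : R[i]) x : isd j (fun=> c) x 0.
Proof. by split; exact: is_derive_cst. Qed.

Lemma isdZ j f (c : R[i]) x a : isd j f x a -> isd j (fun y => c * f y) x (c * a).
Proof.
move=> fa; apply: (isd_eq (isdM (isd_cst j c x) fa)); by rewrite mul0r add0r.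
Qed.

Lemma isd_real j (q : 'rV[R]_d -> R) x (a : R) :
  is_derive x (delta_mx 0 j : 'rV[R]_d) q a -> isd j (fun y => (q y)%:C) x a%:C.
Proof. by move=> qa; split => //; exact: is_derive_cst. Qed.

Lemma isd_near j f g x a : (\forall y \near x, f y = g y) ->
  isd j f x a -> isd j g x a.
Proof.
move=> fg [fa fb]; split.
- apply: (near_eq_is_derive _ fa).
  by apply: filterS fg => y fgy; rewrite /ref fgy.
- apply: (near_eq_is_derive _ fb).
  by apply: filterS fg => y fgy; rewrite /imf fgy.
Qed.

Lemma ccontD f g : ccont f -> ccont g -> ccont (fun y => f y + g y).
Proof.
case=> [fa fb] [ga gb]; split => x.
- have -> : ref (fun y => f y + g y) = fun y => ref f y + ref g y.
    by apply/funext => y; rewrite /ref /= CReD.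
  exact: (cvgD (fa x) (ga x)).
- have -> : imf (fun y => f y + g y) = fun y => imf f y + imf g y.
    by apply/funext => y; rewrite /imf /= CImD.
  exact: (cvgD (fb x) (gb x)).
Qed.

Lemma ccontM f g : ccont f -> ccont g -> ccont (fun y => f y * g y).
Proof.
case=> [fa fb] [ga gb]; split => x.
- have -> : ref (fun y => f y * g y) = fun y => ref f y * ref g y - imf f y * imf g y.
    by apply/funext => y; rewrite /ref /imf /= CReM.
  exact: (cvgB (cvgM (fa x) (ga x)) (cvgM (fb x) (gb x))).
- have -> : imf (fun y => f y * g y) = fun y => ref f y * imf g y + imf f y * ref g y.
    by apply/funext => y; rewrite /ref /imf /= CImM.
  exact: (cvgD (cvgM (fa x) (gb x)) (cvgM (fb x) (ga x))).
Qed.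

Lemma ccont_cst (c : R[i]) : ccont (fun=> c).
Proof. by split; exact: cst_continuous. Qed.

Lemma ccont_real (q : 'rV[R]_d -> R) : continuous q -> ccont (fun y => (q y)%:C).
Proof. by move=> cq; split=> //; exact: cst_continuous. Qed.

Lemma ccont_normc f : ccont f -> continuous (fun x => normc (f x)).
Proof.
move=> [fa fb] x.
have -> : (fun y => normc (f y)) = Num.sqrt \o (fun y => ref f y ^+ 2 + imf f y ^+ 2).
  by apply/funext => y /=; rewrite normc_ReImE.
have cX (u : 'rV[R]_d -> R) : continuous u -> continuous (fun y => u y ^+ 2).
  by move=> cu y; under eq_fun do rewrite expr2; exact: (cvgM (cu y) (cu y)).
apply: (@continuous_comp _ _ _ (fun y => ref f y ^+ 2 + imf f y ^+ 2) Num.sqrt).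
  exact: (cvgD (cX _ fa x) (cX _ fb x)).
exact: sqrt_continuous.
Qed.

(** Smoothness of finite order, by recursion on the order: the product rule then gives closure under
    products by induction on [k], which the quantification over whole words in [smooth] does not
    allow directly. *)
Fixpoint sm (k : nat) f : Prop :=
  if k is k'.+1 then ccont f /\ forall j, (forall x, pdble j f x) /\ sm k' (pderiv j f)
  else ccont f.

Lemma sm_ccont k f : sm k f -> ccont f.
Proof. by case: k => // k []. Qed.

(** Candidates for the partial derivatives suffice; [pderiv] need not be computed beforehand. *)
Lemma sm_step k f (df : 'I_d -> 'rV[R]_d -> R[i]) : ccont f ->
  (forall j x, isd j f x (df j x)) -> (forall j, sm k (df j)) -> sm k.+1 f.
Proof.
move=> cf fd kd; split => // j; split=> [x|].
  exact: isd_pdble (fd j x).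
by have -> : pderiv j f = df j by apply/funext => x; exact: isd_val (fd j x).
Qed.

Lemma smS k f : sm k.+1 f -> sm k f.
Proof.
elim: k f => [f []//|k IH f [cf fj]]; split => // j; split; first exact: (fj j).1.
by apply: IH; exact: (fj j).2.
Qed.

Lemma sm_isd k f j x : sm k.+1 f -> isd j f x (pderiv j f x).
Proof. by move=> [_ /(_ j)[fj _]]; exact: pdble_isd. Qed.

Lemma smD k f g : sm k f -> sm k g -> sm k (fun y => f y + g y).
Proof.
elim: k f g => [f g|k IH f g kf kg]; first exact: ccontD.
apply: (@sm_step _ _ (fun j y => pderiv j f y + pderiv j g y)).
- by apply: ccontD; [exact: sm_ccont kf|exact: sm_ccont kg].
- by move=> j x; apply: isdD; [exact: sm_isd kf|exact: sm_isd kg].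
- by move=> j; apply: IH; [exact: (kf.2 j).2|exact: (kg.2 j).2].
Qed.

Lemma smM k f g : sm k f -> sm k g -> sm k (fun y => f y * g y).
Proof.
elim: k f g => [f g|k IH f g kf kg]; first exact: ccontM.
apply: (@sm_step _ _ (fun j y => pderiv j f y * g y + f y * pderiv j g y)).
- by apply: ccontM; [exact: sm_ccont kf|exact: sm_ccont kg].
- by move=> j x; apply: isdM; [exact: sm_isd kf|exact: sm_isd kg].
- move=> j; apply: smD; apply: IH.
  + exact: (kf.2 j).2.
  + exact: smS.
  + exact: smS.
  + exact: (kg.2 j).2.
Qed.

Lemma sm_cst k (c : R[i]) : sm k (fun=> c).
Proof.
elim: k c => [|k IH] c; first exact: ccont_cst.
apply: (@sm_step _ _ (fun _ _ => 0)) => //; first exact: ccont_cst.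
by move=> j x; exact: isd_cst.
Qed.

Lemma smoothS f : smooth f <->
  ccont f /\ forall j, (forall x, pdble j f x) /\ smooth (pderiv j f).
Proof.
split=> [sf|[cf fj] s].
  have [c1 c2 d0] := sf [::]; split; first by split; [exact: c1|exact: c2].
  move=> j; split=> [x|s]; first exact: (d0 j x).
  by have := sf (rcons s j); rewrite /= foldr_rcons.
elim/last_ind: s => [|s j _] /=.
  by split; [exact: cf.1|exact: cf.2|move=> j x; exact: (fj j).1].
by rewrite foldr_rcons; exact: (fj j).2 s.
Qed.

(** Words are taken apart at their last letter, which is the derivative that [foldr] applies
    first. *)
Lemma smoothP f : smooth f <-> forall k, sm k f.
Proof.
split=> [+ k|kf].
  elim: k f => [f /smoothS[]//|k IH f /smoothS[cf fj]].
  by split=> // j; split; [exact: (fj j).1|apply: IH; exact: (fj j).2].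
move=> s; elim/last_ind: s f kf => [f kf|s j IH f kf] /=.
  have [[c1 c2] fj] := kf 1%N.
  by split=> // j x; exact: (fj j).1.
by rewrite foldr_rcons; apply: IH => k; exact: ((kf k.+1).2 j).2.
Qed.

#[local] Opaque smooth pderiv.

Lemma smooth_ccont f : smooth f -> ccont f.
Proof. by case/smoothS. Qed.

Lemma smooth_isd f j x : smooth f -> isd j f x (pderiv j f x).
Proof. by case/smoothS => _ /(_ j)[fj _]; exact: pdble_isd. Qed.

Lemma smooth_pderiv f j : smooth f -> smooth (pderiv j f).
Proof. by case/smoothS => _ /(_ j)[]. Qed.

Lemma smoothD f g : smooth f -> smooth g -> smooth (fun y => f y + g y).
Proof. by move=> /smoothP sf /smoothP sg; apply/smoothP => k; exact: smD. Qed.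

Lemma smoothM f g : smooth f -> smooth g -> smooth (fun y => f y * g y).
Proof. by move=> /smoothP sf /smoothP sg; apply/smoothP => k; exact: smM. Qed.

Lemma smooth_cst (c : R[i]) : smooth (fun _ : 'rV[R]_d => c).
Proof. by apply/smoothP => k; exact: sm_cst. Qed.

Lemma smoothZ f (c : R[i]) : smooth f -> smooth (fun y => c * f y).
Proof. by move=> sf; exact: (smoothM (smooth_cst c) sf). Qed.

Lemma smooth_sum (I : Type) (s : seq I) (F : I -> 'rV[R]_d -> R[i]) :
  (forall i, smooth (F i)) -> smooth (fun y => \sum_(i <- s) F i y).
Proof.
move=> sF; elim: s => [|i s IH].
  have -> : (fun y => \sum_(i <- [::]) F i y) = fun=> 0.
    by apply/funext => y; rewrite big_nil.
  exact: smooth_cst.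
have -> : (fun y => \sum_(k <- i :: s) F k y) = fun y => F i y + \sum_(k <- s) F k y.
  by apply/funext => y; rewrite big_cons.
exact: (smoothD (sF i) IH).
Qed.

Lemma smooth_prod (I : Type) (s : seq I) (F : I -> 'rV[R]_d -> R[i]) :
  (forall i, smooth (F i)) -> smooth (fun y => \prod_(i <- s) F i y).
Proof.
move=> sF; elim: s => [|i s IH].
  have -> : (fun y => \prod_(i <- [::]) F i y) = fun=> 1.
    by apply/funext => y; rewrite big_nil.
  exact: smooth_cst.
have -> : (fun y => \prod_(k <- i :: s) F k y) = fun y => F i y * \prod_(k <- s) F k y.
  by apply/funext => y; rewrite big_cons.
exact: (smoothM (sF i) IH).
Qed.

Lemma smoothX f n : smooth f -> smooth (fun y => f y ^+ n).
Proof.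
move=> sf; elim: n => [|n IH]; first exact: (smooth_cst 1).
have -> : (fun y => f y ^+ n.+1) = fun y => f y * f y ^+ n.
  by apply/funext => y; rewrite exprS.
exact: (smoothM sf IH).
Qed.

Lemma pderivD j f g : smooth f -> smooth g ->
  pderiv j (fun y => f y + g y) = fun y => pderiv j f y + pderiv j g y.
Proof.
by move=> sf sg; apply/funext => x; apply/isd_val/isdD; exact: smooth_isd.
Qed.

Lemma pderivM j f g : smooth f -> smooth g ->
  pderiv j (fun y => f y * g y) = fun y => pderiv j f y * g y + f y * pderiv j g y.
Proof.
by move=> sf sg; apply/funext => x; apply/isd_val/isdM; exact: smooth_isd.
Qed.

Lemma pderivZ j f (c : R[i]) : smooth f ->
  pderiv j (fun y => c * f y) = fun y => c * pderiv j f y.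
Proof.
by move=> sf; apply/funext => x; apply/isd_val/isdZ; exact: smooth_isd.
Qed.

Lemma pderivX j f n : smooth f ->
  pderiv j (fun y => f y ^+ n.+1) = fun y => n.+1%:R * f y ^+ n * pderiv j f y.
Proof.
move=> sf; elim: n => [|n IH].
  by apply/funext => x; rewrite mul1r expr0 mul1r; congr pderiv.
have -> : (fun y => f y ^+ n.+2) = fun y => f y * f y ^+ n.+1.
  by apply/funext => y; rewrite exprS.
rewrite (pderivM _ sf (smoothX n.+1 sf)).
apply/funext => x; rewrite IH -[n.+2]addn1 natrD !exprS; ring.
Qed.

Lemma pderiv_cst j (c : R[i]) : pderiv j (fun=> c) = fun=> 0.
Proof. by apply/funext => x; apply: isd_val; exact: isd_cst. Qed.

Definition Ds (s : seq 'I_d) f := foldr (@pderiv R d) f s.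

Lemma Ds_rcons s j f : Ds (rcons s j) f = Ds s (pderiv j f).
Proof. by rewrite /Ds foldr_rcons. Qed.

Lemma Ds_cat s t f : Ds (s ++ t) f = Ds s (Ds t f).
Proof. by rewrite /Ds foldr_cat. Qed.

Lemma smooth_Ds s f : smooth f -> smooth (Ds s f).
Proof. by move=> sf; elim: s => [|j s IH]; [exact: sf|exact: (smooth_pderiv j IH)]. Qed.

Lemma DsD s f g : smooth f -> smooth g ->
  Ds s (fun y => f y + g y) = fun y => Ds s f y + Ds s g y.
Proof.
move=> sf sg; elim: s => [|j s IH]; first by [].
by rewrite [LHS]/= -!/(Ds _ _) IH (pderivD j (smooth_Ds s sf) (smooth_Ds s sg)).
Qed.

Lemma DsZ s f (c : R[i]) : smooth f ->
  Ds s (fun y => c * f y) = fun y => c * Ds s f y.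
Proof.
move=> sf; elim: s => [|j s IH]; first by [].
by rewrite [LHS]/= -!/(Ds _ _) IH (pderivZ j c (smooth_Ds s sf)).
Qed.

End derivatives.

(** * Derivatives along lines *)

Section calculus.
Context (R : realType).

Lemma slice_quotient (V : normedModType R) (f : V -> R) (x v : V) (t : R) :
  (fun h : R => h^-1 *: (((fun s => f (s *: v + x)) \o shift t) (h *: 1) - f (t *: v + x)))
  = (fun h => h^-1 *: ((f \o shift (t *: v + x)) (h *: v) - f (t *: v + x))).
Proof.
apply/funext => h /=; congr (_ *: (f _ - _)).
by rewrite [h *: 1]mulr1 scalerDl addrA.
Qed.

(** The two difference quotients are the same function. This gives directional derivatives access to
    the chain rule and the mean value theorem of one real variable. *)
Lemma is_derive_slice (V : normedModType R) (f : V -> R) (x v : V) (t a : R) :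
  is_derive (t *: v + x) v f a <-> is_derive t 1 (fun h : R => f (h *: v + x)) a.
Proof.
have e := slice_quotient f x v t.
by split=> -[dv va]; split; move: dv va; rewrite /derivable /derive e.
Qed.

Lemma is_derive_slice0 (V : normedModType R) (f : V -> R) (x v : V) (a : R) :
  is_derive x v f a <-> is_derive (0 : R) 1 (fun h : R => f (h *: v + x)) a.
Proof. by rewrite -is_derive_slice scale0r add0r. Qed.

Lemma is_derive_chain (V : normedModType R) (g : R -> R) (q : V -> R) (x v : V) (a b : R) :
  is_derive (q x) 1 g b -> is_derive x v q a -> is_derive x v (fun y => g (q y)) (b * a).
Proof.
move=> gb /is_derive_slice0 qa; apply/is_derive_slice0.
apply: (@is_derive1_comp _ g (fun h : R => q (h *: v + x))) => //.
by rewrite scale0r add0r.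
Qed.

Fixpoint sm1 (k : nat) (g : R -> R) : Prop :=
  if k is k'.+1 then continuous g /\
    exists g', (forall t : R, is_derive t 1 g (g' t)) /\ sm1 k' g'
  else continuous g.

End calculus.

(** * Smoothness of compositions, inverses and coordinates *)

Section real_smooth.
Context (R : realType) (d : nat).
Implicit Types (f g h : 'rV[R]_d -> R[i]) (x : 'rV[R]_d) (j : 'I_d).

Lemma sm_comp k (g : R -> R) (q : 'rV[R]_d -> R) :
  sm1 k g -> sm k (fun y => (q y)%:C) -> sm k (fun y => (g (q y))%:C).
Proof.
have cc (u : R -> R) : continuous u -> ccont (fun y => (q y)%:C) ->
    ccont (fun y => (u (q y))%:C).
  by move=> cu [cq _]; apply: ccont_real => x; exact: (continuous_comp (cq x) (cu (q x))).
elim: k g => [g cg cq|k IH g sg sq]; first exact: cc.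
have [cg [g' [gg' sg']]] := sg.
apply: (@sm_step _ _ _ _ (fun j y => (g' (q y))%:C * pderiv j (fun y => (q y)%:C) y)).
- exact: cc cg (sm_ccont sq).
- move=> j x; have [qa qb] := sm_isd j x sq.
  have im0 : CIm (pderiv j (fun y => (q y)%:C) x) = 0.
    by rewrite /= (_ : imf _ = cst 0)// derive_cst.
  split.
    by rewrite CReM /= mul0r subr0; exact: (is_derive_chain (gg' (q x)) qa).
  by rewrite CImM im0 /= mulr0 mul0r addr0; exact: is_derive_cst.
- by move=> j; exact: (smM (IH _ sg' (smS sq)) (sq.2 j).2).
Qed.

Lemma smooth_comp (g : R -> R) (q : 'rV[R]_d -> R) :
  (forall k, sm1 k g) -> smooth (fun y => (q y)%:C) -> smooth (fun y => (g (q y))%:C).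
Proof. by move=> sg /smoothP sq; apply/smoothP => k; exact: sm_comp (sg k) (sq k). Qed.

(** The derivative of [q^-1] is a polynomial in [q^-1] times a derivative of [q], so the induction
    on the order closes on [q^-1] itself. *)
Lemma smooth_inv (q : 'rV[R]_d -> R) : (forall x, q x != 0) ->
  smooth (fun y => (q y)%:C) -> smooth (fun y => (q y)^-1%:C).
Proof.
move=> q0 /smoothP sq; apply/smoothP; elim=> [|k IH].
  apply: ccont_real => x; have [cq _] := sm_ccont (sq 0%N).
  exact: (@cvgV _ _ (nbhs x) _ q (q x) (q0 x) (cq x)).
apply: (@sm_step _ _ _ _ (fun j y => (- 1)%:C * ((q y)^-1%:C * (q y)^-1%:C) *
   pderiv j (fun y => (q y)%:C) y)).
- exact: sm_ccont IH.
- move=> j x; have [qa qb] := sm_isd j x (sq 1%N).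
  have im0 : CIm (pderiv j (fun y => (q y)%:C) x) = 0.
    by rewrite /= (_ : imf _ = cst 0)// derive_cst.
  have [qd qv] := qa.
  split; last first.
    rewrite !(CImM, CReM) im0 /= !(mulr0, mul0r, addr0); exact: is_derive_cst.
  split; first exact: derivableV (q0 x) qd.
  rewrite -[ref _]/(fun y => (q y)^-1) deriveV//; rewrite -/(ref _) qv.
  rewrite !(CImM, CReM) /= /GRing.scale /= expr2 invfM; ring.
- move=> j; exact: (smM (smM (sm_cst d k (- 1)%:C) (smM IH IH)) ((sq k.+1).2 j).2).
Qed.

Lemma is_derive_coord j k x :
  is_derive x (delta_mx 0 k : 'rV[R]_d) (fun y : 'rV[R]_d => y 0 j) (j == k)%:R.
Proof.
apply/is_derive_slice0.
have -> : (fun h : R => (h *: (delta_mx 0 k : 'rV[R]_d) + x) 0 j) =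
   (fun h : R => (j == k)%:R * h) + cst (x 0 j).
  by apply/funext => h; rewrite /cst /= !mxE eqxx mulrC fctE.
have := is_deriveD (is_deriveZ ((j == k)%:R : R) (is_derive_id (0 : R) 1)) (is_derive_cst (x 0 j) (0 : R) 1).
by rewrite addr0 [X in is_derive _ _ _ X](mulr1).
Qed.

Lemma smooth_coord j : smooth (fun y : 'rV[R]_d => (y 0 j)%:C).
Proof.
apply/smoothP; case=> [|k].
  by apply: ccont_real; exact: coord_continuous.
apply: (@sm_step _ _ _ _ (fun k _ => (j == k)%:R%:C)).
- by apply: ccont_real; exact: coord_continuous.
- by move=> l x; apply: isd_real; exact: is_derive_coord.
- by move=> l; exact: sm_cst.
Qed.

Lemma pderiv_coord j k :
  pderiv k (fun y : 'rV[R]_d => (y 0 j)%:C) = fun=> (j == k)%:R%:C.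
Proof.
by apply/funext => x; apply: isd_val; apply: isd_real; exact: is_derive_coord.
Qed.

End real_smooth.

(** * Schwartz functions and multipliers *)

Section seminorms.
Context (R : realType) (d : nat).
Implicit Types (f g h eta psi : 'rV[R]_d -> R[i]) (x : 'rV[R]_d) (j : 'I_d).

Lemma normr_coord_le x j : `|x 0 j| <= `|x|.
Proof. by rewrite [leRHS]mx_normrE; apply: (le_bigmax _ (fun ij => `|x ij.1 ij.2|) (0, j)). Qed.

(* Words of partial derivatives stand in for multi-indices, so that derivatives
   never have to be commuted. *)
Definition snorm_le M N f (c : R) := forall s : seq 'I_d, (size s <= M)%N ->
  forall x, (1 + `|x|) ^+ N * normc (Ds s f x) <= c.

Lemma one_add_norm_ge1 x : 1 <= 1 + `|x|.
Proof. by rewrite lerDl. Qed.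

Lemma snorm_ge0 M N f c : snorm_le M N f c -> 0 <= c.
Proof.
move=> /(_ [::] isT 0); apply: le_trans.
by rewrite mulr_ge0 ?normc_ge0// exprn_ge0// addr_ge0.
Qed.

Lemma snormW M N M' N' f c c' : (M' <= M)%N -> (N' <= N)%N -> c <= c' ->
  snorm_le M N f c -> snorm_le M' N' f c'.
Proof.
move=> MM NN cc fc s sM x; apply: le_trans (le_trans (fc s (leq_trans sM MM) x) cc).
by rewrite ler_wpM2r ?normc_ge0// ler_weXn2l// one_add_norm_ge1.
Qed.

Lemma snorm0 N f c : (forall x, (1 + `|x|) ^+ N * normc (f x) <= c) ->
  snorm_le 0 N f c.
Proof. by move=> fc [|j s]//. Qed.

Lemma snormS M N f c : (forall x, (1 + `|x|) ^+ N * normc (f x) <= c) ->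
  (forall j, snorm_le M N (pderiv j f) c) -> snorm_le M.+1 N f c.
Proof.
move=> f0 fj s; case/lastP: s => [|s j]; first by move=> _ x; exact: (f0 x).
by rewrite size_rcons ltnS => sM x; rewrite Ds_rcons; exact: (fj j s sM x).
Qed.

Lemma snorm_pderiv M N f c j : snorm_le M.+1 N f c -> snorm_le M N (pderiv j f) c.
Proof.
move=> fc s sM x; rewrite -Ds_rcons; apply: fc.
by rewrite size_rcons ltnS.
Qed.

Lemma snorm_fun M N f c x : snorm_le M N f c -> (1 + `|x|) ^+ N * normc (f x) <= c.
Proof. by move=> /(_ [::] isT x). Qed.

Lemma snormD M N f g a b : smooth f -> smooth g ->
  snorm_le M N f a -> snorm_le M N g b -> snorm_le M N (fun y => f y + g y) (a + b).
Proof.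
move=> sf sg fa gb s sM x; rewrite (DsD s sf sg).
apply: le_trans (lerD (fa s sM x) (gb s sM x)); rewrite -mulrDr.
by rewrite ler_wpM2l ?exprn_ge0 ?addr_ge0//; exact: normcD.
Qed.

Lemma snormZ M N f c (k : R[i]) : smooth f ->
  snorm_le M N f c -> snorm_le M N (fun y => k * f y) (normc k * c).
Proof.
move=> sf fc s sM x; rewrite (DsZ s k sf) normcM mulrCA.
by apply: ler_wpM2l; [exact: normc_ge0|exact: fc].
Qed.

(** One power of decay pays for the coordinate. At most one of the derivatives can fall on it; each
    choice of that one adds a [c], hence [M.+1]. *)
Lemma snorm_coord M N f c j : smooth f -> snorm_le M N.+1 f c ->
  snorm_le M N (fun y => (y 0 j)%:C * f y) (M.+1%:R * c).
Proof.
elim: M f => [|M IH] f sf fc.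
  apply: snorm0 => x; rewrite mul1r; apply: le_trans (snorm_fun x fc).
  rewrite normcM normcR mulrA exprSr.
  rewrite ler_wpM2r ?normc_ge0// ler_wpM2l ?exprn_ge0 ?addr_ge0//.
  apply: (@le_trans _ _ `|x|); last by rewrite lerDr.
  exact: normr_coord_le.
have c0 := snorm_ge0 fc.
apply: snormS => [x|k].
  apply: (le_trans _ (_ : 1%:R * c <= _)); last by rewrite ler_wpM2r// ler_nat.
  rewrite mul1r; apply: le_trans (snorm_fun x fc).
  rewrite normcM normcR mulrA exprSr.
  rewrite ler_wpM2r ?normc_ge0// ler_wpM2l ?exprn_ge0 ?addr_ge0//.
  apply: (@le_trans _ _ `|x|); last by rewrite lerDr.
  exact: normr_coord_le.
rewrite (pderivM k (smooth_coord R j) sf) pderiv_coord.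
apply: (@snormW M N M N _ (normc ((j == k)%:R%:C : R[i]) * c + M.+1%:R * c)) => //.
  rewrite normcR -[M.+2]addn1 natrD addrC mulrDl lerD2l ler_wpM2r//.
  by rewrite ger0_norm ?ler0n// ler_nat leq_b1.
apply: snormD.
- exact: (smoothZ _ sf).
- exact: (smoothM (smooth_coord R j) (smooth_pderiv k sf)).
- by apply: (snormZ _ sf); apply: snormW fc.
- by apply: (IH _ (smooth_pderiv k sf)); exact: snorm_pderiv fc.
Qed.

Definition growth_le M K f (C : R) := forall s : seq 'I_d, (size s <= M)%N ->
  forall x, normc (Ds s f x) <= C * (1 + `|x|) ^+ K.

Lemma growth_ge0 M K f C : growth_le M K f C -> 0 <= C.
Proof.
move=> /(_ [::] isT 0); rewrite normr0 addr0 expr1n mulr1; apply: le_trans.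
exact: normc_ge0.
Qed.

Lemma growth_pderiv M K f C j : growth_le M.+1 K f C -> growth_le M K (pderiv j f) C.
Proof.
move=> fc s sM x; rewrite -Ds_rcons; apply: fc.
by rewrite size_rcons ltnS.
Qed.

Lemma growthS M K f C : (forall x, normc (f x) <= C * (1 + `|x|) ^+ K) ->
  (forall j, growth_le M K (pderiv j f) C) -> growth_le M.+1 K f C.
Proof.
move=> f0 fj s; case/lastP: s => [|s j]; first by move=> _ x; exact: (f0 x).
by rewrite size_rcons ltnS => sM x; rewrite Ds_rcons; exact: (fj j s sM x).
Qed.

Lemma growthW M K M' K' f C C' : (M' <= M)%N -> (K <= K')%N -> C <= C' ->
  growth_le M K f C -> growth_le M' K' f C'.
Proof.
move=> MM KK CC fC s sM x; apply: (le_trans (fC s (leq_trans sM MM) x)).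
have C0 := growth_ge0 fC.
apply: ler_pM; [exact: C0|by rewrite exprn_ge0// addr_ge0|exact: CC|].
by rewrite ler_weXn2l// one_add_norm_ge1.
Qed.

(** The [K] extra powers of decay absorb the growth of [eta], and [2 ^+ M] counts the terms of the
    Leibniz rule. *)
Lemma snormM M N K eta psi C c : smooth eta -> smooth psi ->
  growth_le M K eta C -> snorm_le M (N + K) psi c ->
  snorm_le M N (fun y => eta y * psi y) (2 ^+ M * (C * c)).
Proof.
have base e p a b x : 0 <= a -> normc (e x) <= a * (1 + `|x|) ^+ K ->
    (1 + `|x|) ^+ (N + K) * normc (p x) <= b ->
    (1 + `|x|) ^+ N * normc (e x * p x) <= a * b.
  move=> a0 ea pb; rewrite normcM.
  have x0 : 0 <= 1 + `|x| by rewrite addr_ge0.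
  apply: (le_trans _ (ler_wpM2l a0 pb)); rewrite exprD.
  rewrite [leRHS](_ : _ = (1 + `|x|) ^+ N * (a * (1 + `|x|) ^+ K * normc (p x))); last by ring.
  by rewrite ler_wpM2l ?exprn_ge0// ler_wpM2r ?normc_ge0.
elim: M eta psi => [|M IH] eta psi se sp eC pc.
  by apply: snorm0 => x; rewrite mul1r; apply: (base _ _ _ _ _ (growth_ge0 eC) (eC [::] isT x)); exact: (snorm_fun x pc).
have C0 := growth_ge0 eC; have c0 := snorm_ge0 pc.
apply: snormS => [x|j].
  apply: (@le_trans _ _ (C * c)).
    by apply: (base _ _ _ _ _ (growth_ge0 eC) (eC [::] isT x)); exact: (snorm_fun x pc).
  by rewrite ler_peMl ?mulr_ge0// exprn_ege1// ler1n.
rewrite (pderivM j se sp) exprS mulrDl mul1r mulrDl.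
apply: snormD.
- exact: (smoothM (smooth_pderiv j se) sp).
- exact: (smoothM se (smooth_pderiv j sp)).
- apply: (IH _ _ (smooth_pderiv j se) sp (growth_pderiv j eC)).
  exact: snormW pc.
- apply: (IH _ _ se (smooth_pderiv j sp)); last exact: snorm_pderiv pc.
  exact: growthW eC.
Qed.

Definition sschwartz f := smooth f /\ forall M N, exists c, snorm_le M N f c.
Definition moderate f := smooth f /\ forall M, exists K, exists C, growth_le M K f C.

(** There are finitely many words of length at most [M]; their constants are collected by peeling
    off the last letter and summing over the directions. *)
Lemma snorm_exists0 M N f :
  (forall (s : seq 'I_d), (size s <= M)%N -> exists c, forall x, (1 + `|x|) ^+ N * normc (Ds s f x) <= c) ->
  exists c, snorm_le M N f c.
Proof.
elim: M f => [|M IH] f fs.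
  by have [c fc] := fs [::] isT; exists c; apply: snorm0.
have [c0 fc0] := fs [::] isT.
have /choice[c fc] : forall j, exists c, snorm_le M N (pderiv j f) c.
  move=> j; apply: IH => s sM; have [|c fc] := fs (rcons s j).
    by rewrite size_rcons.
  by exists c => x; rewrite -Ds_rcons.
have c_ge0 j : 0 <= c j by exact: snorm_ge0 (fc j).
have c0_ge0 : 0 <= c0.
  by apply: le_trans (fc0 0); rewrite mulr_ge0 ?normc_ge0// exprn_ge0// addr_ge0.
exists (c0 + \sum_j c j); apply: snormS => [x|j].
  by apply: (le_trans (fc0 x)); rewrite lerDl sumr_ge0.
apply: snormW (fc j) => //; rewrite (bigD1 j)//= addrCA lerDl addr_ge0//.
by rewrite sumr_ge0.
Qed.

Lemma sschwartz_pderiv f j : sschwartz f -> sschwartz (pderiv j f).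
Proof.
move=> [sf fc]; split=> [|M N]; first exact: smooth_pderiv.
by have [c fcc] := fc M.+1 N; exists c; exact: snorm_pderiv.
Qed.

Lemma sschwartzD f g : sschwartz f -> sschwartz g -> sschwartz (fun y => f y + g y).
Proof.
move=> [sf fc] [sg gc]; split=> [|M N]; first exact: smoothD.
have [a fa] := fc M N; have [b gb] := gc M N; exists (a + b).
exact: (snormD sf sg fa gb).
Qed.

Lemma sschwartzM f g : moderate f -> sschwartz g -> sschwartz (fun y => f y * g y).
Proof.
move=> [sf fc] [sg gc]; split=> [|M N]; first exact: smoothM.
have [K [C fC]] := fc M; have [c gcc] := gc M (N + K)%N.
exists (2 ^+ M * (C * c)); exact: (snormM sf sg fC gcc).
Qed.

Lemma moderateD f g : moderate f -> moderate g -> moderate (fun y => f y + g y).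
Proof.
move=> [sf fc] [sg gc]; split=> [|M]; first exact: smoothD.
have [K1 [C1 fC]] := fc M; have [K2 [C2 gC]] := gc M.
exists (maxn K1 K2); exists (C1 + C2) => s sM x; rewrite (DsD s sf sg).
apply: (le_trans (normcD _ _)); rewrite mulrDl; apply: lerD.
  exact: (growthW (leqnn M) (leq_maxl K1 K2) (lexx C1) fC sM).
exact: (growthW (leqnn M) (leq_maxr K1 K2) (lexx C2) gC sM).
Qed.

Lemma growthM M K1 K2 f g C1 C2 : smooth f -> smooth g ->
  growth_le M K1 f C1 -> growth_le M K2 g C2 ->
  growth_le M (K1 + K2) (fun y => f y * g y) (2 ^+ M * (C1 * C2)).
Proof.
elim: M f g => [|M IH] f g sf sg fC gC.
  move=> [|//] _ x; rewrite mul1r normcM exprD mulrACA.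
  by apply: ler_pM; rewrite ?normc_ge0//; [exact: (fC [::])|exact: (gC [::])].
have C10 := growth_ge0 fC; have C20 := growth_ge0 gC.
apply: growthS => [x|j].
  rewrite normcM exprD.
  apply: (@le_trans _ _ (C1 * C2 * ((1 + `|x|) ^+ K1 * (1 + `|x|) ^+ K2))).
    rewrite mulrACA.
    by apply: ler_pM; rewrite ?normc_ge0//; [exact: (fC [::])|exact: (gC [::])].
  rewrite ler_wpM2r ?mulr_ge0 ?exprn_ge0 ?addr_ge0//.
  by rewrite ler_peMl ?mulr_ge0// exprn_ege1// ler1n.
rewrite (pderivM j sf sg) => s sM x.
rewrite (DsD s (smoothM (smooth_pderiv j sf) sg) (smoothM sf (smooth_pderiv j sg))).
apply: (le_trans (normcD _ _)); rewrite exprS mulrDl mul1r mulrDl mulrDl; apply: lerD.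
  apply: (IH _ _ (smooth_pderiv j sf) sg (growth_pderiv j fC) _ s sM x).
  exact: growthW gC.
apply: (IH _ _ sf (smooth_pderiv j sg) _ (growth_pderiv j gC) s sM x).
exact: growthW fC.
Qed.

Lemma moderateM f g : moderate f -> moderate g -> moderate (fun y => f y * g y).
Proof.
move=> [sf fc] [sg gc]; split=> [|M]; first exact: smoothM.
have [K1 [C1 fC]] := fc M; have [K2 [C2 gC]] := gc M.
exists (K1 + K2)%N; exists (2 ^+ M * (C1 * C2)); exact: growthM.
Qed.

Lemma moderate_pderiv f j : moderate f -> moderate (pderiv j f).
Proof.
move=> [sf fc]; split=> [|M]; first exact: smooth_pderiv.
by have [K [C fC]] := fc M.+1; exists K, C; exact: growth_pderiv.
Qed.

Lemma Ds_cst s (c : R[i]) : Ds s (fun _ : 'rV[R]_d => c) = if s is [::] then fun=> c else fun=> 0.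
Proof.
elim: s => // k s IH; rewrite /= -/(Ds s _) IH.
by case: s {IH} => [|? ?]; rewrite pderiv_cst.
Qed.

Lemma moderate_cst (c : R[i]) : moderate (fun=> c).
Proof.
split=> [|M]; first exact: smooth_cst.
exists 0%N, (normc c) => s _ x; rewrite Ds_cst expr0 mulr1.
by case: s => [|? ?]; rewrite ?normc0 ?normc_ge0.
Qed.

Lemma moderateZ f (c : R[i]) : moderate f -> moderate (fun y => c * f y).
Proof. by move=> mf; exact: (moderateM (moderate_cst c) mf). Qed.

Lemma sschwartzZ f (c : R[i]) : sschwartz f -> sschwartz (fun y => c * f y).
Proof. by move=> mf; exact: (sschwartzM (moderate_cst c) mf). Qed.

Lemma moderate_coord j : moderate (fun y : 'rV[R]_d => (y 0 j)%:C).
Proof.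
split=> [|M]; first exact: smooth_coord.
exists 1%N, 1 => s _ x; rewrite mul1r expr1.
case/lastP: s => [|s k].
  by rewrite -[Ds _ _ x]/((x 0 j)%:C) normcR (le_trans (normr_coord_le x j))// lerDr.
rewrite Ds_rcons pderiv_coord Ds_cst; case: s => [|? ?].
  by rewrite normcR ger0_norm ?ler0n// (@le_trans _ _ 1) ?one_add_norm_ge1// lern1 leq_b1.
by rewrite normc0 addr_ge0.
Qed.

Lemma moderate_sum (I : Type) (s : seq I) (F : I -> 'rV[R]_d -> R[i]) :
  (forall i, moderate (F i)) -> moderate (fun y => \sum_(i <- s) F i y).
Proof.
move=> sF; elim: s => [|i s IH].
  have -> : (fun y => \sum_(i <- [::]) F i y) = fun=> 0.
    by apply/funext => y; rewrite big_nil.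
  exact: moderate_cst.
have -> : (fun y => \sum_(k <- i :: s) F k y) = fun y => F i y + \sum_(k <- s) F k y.
  by apply/funext => y; rewrite big_cons.
exact: (moderateD (sF i) IH).
Qed.

Lemma moderate_prod (I : Type) (s : seq I) (F : I -> 'rV[R]_d -> R[i]) :
  (forall i, moderate (F i)) -> moderate (fun y => \prod_(i <- s) F i y).
Proof.
move=> sF; elim: s => [|i s IH].
  have -> : (fun y => \prod_(i <- [::]) F i y) = fun=> 1.
    by apply/funext => y; rewrite big_nil.
  exact: moderate_cst.
have -> : (fun y => \prod_(k <- i :: s) F k y) = fun y => F i y * \prod_(k <- s) F k y.
  by apply/funext => y; rewrite big_cons.
exact: (moderateM (sF i) IH).
Qed.

Lemma moderateX f n : moderate f -> moderate (fun y => f y ^+ n).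
Proof.
move=> sf; elim: n => [|n IH]; first exact: (moderate_cst 1).
have -> : (fun y => f y ^+ n.+1) = fun y => f y * f y ^+ n.
  by apply/funext => y; rewrite exprS.
exact: (moderateM sf IH).
Qed.

End seminorms.

(** * Cutoff functions *)

Section one_variable.
Context (R : realType).

(** A quadratic remainder is what direct estimates produce, for the flat function at 0 as well as
    for Fourier integrals, where it avoids differentiating under the integral sign by a limit
    theorem. *)
Lemma is_derive_quad (V : normedModType R) (f : V -> R) (x v : V) (a C : R) :
  (forall h : R, `|h| <= 1 -> `|f (h *: v + x) - f x - h * a| <= C * h ^+ 2) ->
  is_derive x v f a.
Proof.
move=> fC.
have cv : (fun h : R => h^-1 *: ((f \o shift x) (h *: v) - f x)) @ (0 : R)^' --> a.
  apply/cvgrPdist_le => e e0.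
  have C0 : 0 <= C.
    have := fC 1; rewrite normr1 lexx => /(_ isT); rewrite expr1n mulr1.
    exact: le_trans.
  have d0 : 0 < Num.min 1 (e / (C + 1)) by rewrite lt_min ltr01 divr_gt0// ltr_wpDl.
  near=> h.
  have h0 : h != 0 by near: h; exact: nbhs_dnbhs_neq.
  have : `|h| <= Num.min 1 (e / (C + 1)).
    near: h; apply: dnbhs0_le => //.
  rewrite le_min => /andP[h1 he].
  have -> : a - h^-1 *: ((f \o shift x) (h *: v) - f x) =
      - (h^-1 * (f (h *: v + x) - f x - h * a)).
    by rewrite /= /GRing.scale /=; field.
  rewrite normrN normrM normfV.
  apply: (@le_trans _ _ (`|h|^-1 * (C * h ^+ 2))).
    by rewrite ler_wpM2l ?invr_ge0//; exact: fC.
  rewrite -real_normK ?num_real// expr2 mulrCA mulKf ?normr_eq0//.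
  have : C * `|h| <= (C + 1) * (e / (C + 1)).
    by apply: ler_pM => //; rewrite lerDl.
  by rewrite [leRHS]mulrC divfK// gt_eqF// ltr_wpDl.
by split; [apply/cvg_ex; exists a|exact: cvg_lim].
Unshelve. all: by end_near. Qed.

Lemma expr_le_fact_expR (k : nat) (y : R) : 0 <= y -> y ^+ k <= k`!%:R * expR y.
Proof.
move=> y0; case: k => [|k].
  by rewrite expr0 fact0 mul1r -expR0 ler_expR.
have := expR_ge1Dxn k y0.
have k0 : (0 : R) < (k.+1)`!%:R by rewrite ltr0n fact_gt0.
rewrite -(ler_pM2l k0) mulrDr => /(le_trans _) -> //.
by rewrite [X in _ + X]mulrC divfK ?gt_eqF// lerDr mulr1 ltW.
Qed.

(* The family [p(1/t) exp(-1/t)] is stable under differentiation. *)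
Definition flat_exp (p : {poly R}) (t : R) : R :=
  if 0 < t then p.[t^-1] * expR (- t^-1) else 0.

(** With [y = 1 / t], the bound [y ^+ i.+2 <= (i.+2)! * exp y] leaves two powers of [t] to spare; a
    quadratic bound is what differentiability at 0 asks for. *)
Lemma flat_exp_le (p : {poly R}) : exists C, forall t : R, `|flat_exp p t| <= C * t ^+ 2.
Proof.
exists (\sum_(i < size p) `|p`_i| * (i.+2)`!%:R) => t; rewrite /flat_exp.
case: ifPn => [t0|_]; last first.
  by rewrite normr0 mulr_ge0 ?sqr_ge0// sumr_ge0// => i _; rewrite mulr_ge0.
rewrite normrM [`|expR _|]ger0_norm ?expR_ge0// horner_coef mulr_suml.
apply: (@le_trans _ _ ((\sum_(i < size p) `|p`_i| * t^-1 ^+ i) * expR (- t^-1))).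
  rewrite ler_wpM2r ?expR_ge0//; apply: (le_trans (ler_norm_sum _ _ _)).
  by apply: ler_sum => i _; rewrite normrM normrX normfV (gtr0_norm t0).
rewrite mulr_suml; apply: ler_sum => i _; rewrite -!mulrA.
apply: ler_wpM2l => //.
have y0 : 0 < t^-1 by rewrite invr_gt0.
have -> : t^-1 ^+ i * expR (- t^-1) = t^-1 ^+ i.+2 * expR (- t^-1) * t ^+ 2.
  by rewrite -[i.+2]addn2 exprD; field; rewrite gt_eqF.
rewrite ler_wpM2r ?sqr_ge0// expRN ler_pdivrMr ?expR_gt0//.
exact: expr_le_fact_expR (ltW y0).
Qed.

Lemma is_derive_inv (t : R) : t != 0 -> is_derive t 1 (fun u : R => u^-1) (- t^-1 ^+ 2).
Proof.
move=> t0.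
have id1 : derivable (id : R -> R) t 1 by [].
split; first exact: (@derivableV _ _ (id : R -> R) t 1 t0 id1).
by rewrite (@deriveV _ _ (id : R -> R) t 1 t0 id1) derive_id [LHS]mulr1 exprVn.
Qed.

(** For [t > 0], differentiating [p(1/t) exp(-1/t)] gives [t^-2 (p - p')(1/t) exp(-1/t)], the
    function attached to [X^2 (p - p')]. *)
Lemma is_derive_flat_exp (p : {poly R}) (t : R) :
  is_derive t 1 (flat_exp p) (flat_exp ('X^2 * (p - p^`())) t).
Proof.
have [t0|t0|->] := ltgtP t 0.
- rewrite /flat_exp ltNge (ltW t0) /=.
  apply: (near_eq_is_derive _ (is_derive_cst 0 t 1)).
  near=> u; rewrite /cst/= ifF//; apply/negbTE; rewrite -leNgt ltW//.
  by near: u; exact: lt_nbhsl.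
- rewrite [X in is_derive _ _ _ X]/flat_exp t0.
  have tn0 : t != 0 by rewrite gt_eqF.
  have iv := is_derive_inv tn0.
  have dE := is_deriveM (is_derive_chain (q := fun u : R => u^-1) (is_derive_poly p t^-1) iv)
    (is_derive_chain (q := fun u : R => - u^-1) (is_derive_expR (- t^-1)) (is_deriveN iv)).
  apply: (is_derive_eq (near_eq_is_derive _ dE)).
    near=> u; rewrite /flat_exp ifT//.
    by near: u; exact: lt_nbhsr.
  rewrite hornerM hornerXn hornerD hornerN -![_ *: _]/(_ * _).
  set a := expR _; set b := p.[_]; set c := p^`().[_]; set e := t^-1.
  change (b * (a * - - (e ^+ 2)) + a * (c * - (e ^+ 2)) = e ^+ 2 * (b - c) * a :> R).
  ring.
- rewrite [X in is_derive _ _ _ X]/flat_exp ltxx.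
  have [C pC] := flat_exp_le p.
  apply: (@is_derive_quad _ _ _ _ _ C) => h _.
  rewrite mulr0 subr0 addr0 [h *: 1]mulr1 {2}/flat_exp ltxx subr0; exact: pC.
Unshelve. all: by end_near. Qed.

Lemma sm1_flat_exp k (p : {poly R}) : sm1 k (flat_exp p).
Proof.
have cf q : continuous (flat_exp q).
  move=> t; apply: differentiable_continuous; apply/derivable1_diffP.
  by have [] := is_derive_flat_exp q t.
elim: k p => [|k IH] p; first exact: cf.
split; first exact: cf.
by exists (flat_exp ('X^2 * (p - p^`()))); split=> // t; exact: is_derive_flat_exp.
Qed.

Let E := flat_exp 1.

Lemma flat_exp1_gt0 t : 0 < t -> E t = expR (- t^-1).
Proof. by move=> t0; rewrite /E /flat_exp t0 hornerC mul1r. Qed.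

Lemma flat_exp1_le0 t : t <= 0 -> E t = 0.
Proof. by move=> t0; rewrite /E /flat_exp ltNge t0. Qed.

Lemma flat_exp1_ge0 t : 0 <= E t.
Proof.
by have [t0|t0] := leP t 0; [rewrite flat_exp1_le0|rewrite flat_exp1_gt0// expR_ge0].
Qed.

(* [expR 1 * flat_exp 1 t] increases from 0 at [t <= 0] to 1 at [t = 1], so the
   outer factor vanishes for [t >= 1]. *)
Definition smooth_step t := expR 1 * flat_exp 1 (1 - expR 1 * flat_exp 1 t).

Lemma smooth_step_le0 t : t <= 0 -> smooth_step t = 1.
Proof.
move=> t0; rewrite /smooth_step -/E (flat_exp1_le0 t0) mulr0 subr0 flat_exp1_gt0//.
by rewrite invr1 expRxMexpNx_1.
Qed.

Lemma smooth_step_ge1 t : 1 <= t -> smooth_step t = 0.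
Proof.
move=> t1; rewrite /smooth_step -/E [X in _ * X]flat_exp1_le0 ?mulr0//.
rewrite subr_le0 (@flat_exp1_gt0 t) ?(lt_le_trans _ t1)// -expRD -[leLHS]expR0 ler_expR.
by rewrite subr_ge0 invf_le1// (lt_le_trans _ t1).
Qed.

Lemma smooth_step_ge0 t : 0 <= smooth_step t.
Proof. by rewrite mulr_ge0 ?expR_ge0// flat_exp1_ge0. Qed.

Lemma smooth_step_le1 t : smooth_step t <= 1.
Proof.
rewrite /smooth_step -/E; set u := 1 - _.
have u1 : u <= 1 by rewrite lerBlDr lerDl mulr_ge0 ?expR_ge0// flat_exp1_ge0.
have [u0|u0] := leP u 0; first by rewrite flat_exp1_le0 ?mulr0.
rewrite flat_exp1_gt0// -expRD -[leRHS]expR0 ler_expR subr_le0.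
by rewrite -[leLHS]invr1 lef_pV2// ?posrE.
Qed.

End one_variable.

(** * Bumps on boxes, partitions of unity and cutoffs *)

Section bumps.
Context (R : realType) (d : nat).
Implicit Types (f g phi eta : 'rV[R]_d -> R[i]) (x a : 'rV[R]_d) (j : 'I_d) (A : set 'rV[R]_d).

Lemma smooth_step_comp (q : 'rV[R]_d -> R) :
  smooth (fun y => (q y)%:C) -> smooth (fun y => (smooth_step (q y))%:C).
Proof.
have sE (u : 'rV[R]_d -> R) : smooth (fun y => (u y)%:C) ->
    smooth (fun y => (flat_exp 1 (u y))%:C).
  by move=> su; apply: (smooth_comp _ su) => k; exact: sm1_flat_exp.
move=> sq.
have s2 : smooth (fun y => (1 - expR 1 * flat_exp 1 (q y))%:C).
  have -> : (fun y => (1 - expR 1 * flat_exp 1 (q y))%:C) =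
      (fun y => 1%:C + (- expR 1)%:C * (flat_exp 1 (q y))%:C).
    by apply/funext => y; rewrite -realcM -realcD mulNr.
  exact: (smoothD (smooth_cst _) (smoothZ _ (sE _ sq))).
have -> : (fun y => (smooth_step (q y))%:C) =
    (fun y => (expR 1)%:C * (flat_exp 1 (1 - expR 1 * flat_exp 1 (q y)))%:C).
  by apply/funext => y; rewrite -realcM.
exact: (smoothZ _ (sE _ s2)).
Qed.

(** Each factor is 1 for [|x_j - a_j| <= r] and 0 once [(x_j - a_j)^2 >= 2 r^2]. The norm being the
    sup norm, a product of one-variable steps is adapted to its balls. *)
Definition box_bump a (r : R) (x : 'rV[R]_d) : R :=
  \prod_j smooth_step ((x 0 j - a 0 j) ^+ 2 * r^-1 ^+ 2 - 1).

Lemma realc_prod (I : Type) (s : seq I) (F : I -> R) :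
  (\prod_(i <- s) F i)%:C = \prod_(i <- s) (F i)%:C.
Proof.
elim: s => [|i s IH]; first by rewrite !big_nil.
by rewrite !big_cons realcM IH.
Qed.

Lemma smooth_bump a r : smooth (fun y => (box_bump a r y)%:C).
Proof.
have -> : (fun y => (box_bump a r y)%:C) = (fun y =>
    \prod_j (smooth_step ((y 0 j - a 0 j) ^+ 2 * r^-1 ^+ 2 - 1))%:C).
  by apply/funext => y; rewrite /box_bump realc_prod.
apply: smooth_prod => j; apply: smooth_step_comp.
have -> : (fun y : 'rV[R]_d => ((y 0 j - a 0 j) ^+ 2 * r^-1 ^+ 2 - 1)%:C) =
   (fun y => (r^-1 ^+ 2)%:C * ((y 0 j)%:C + (- a 0 j)%:C) ^+ 2 + (- 1)%:C).
  apply/funext => y; rewrite -realcD -[_%:C ^+ 2]/(_%:C * _%:C) -!realcM -realcD.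
  by congr (_%:C); ring.
apply: smoothD (smooth_cst _); apply: smoothZ.
exact: (smoothX 2 (smoothD (smooth_coord R j) (smooth_cst _))).
Qed.

Lemma bump_ge0 a r x : 0 <= box_bump a r x.
Proof. by apply: prodr_ge0 => j _; exact: smooth_step_ge0. Qed.

Lemma bump_le1 a r x : box_bump a r x <= 1.
Proof.
by apply: prodr_ile1 => j _; rewrite smooth_step_ge0 smooth_step_le1.
Qed.

Lemma normr_rV_leP x (r : R) : 0 <= r -> (`|x| <= r) <-> forall j, `|x 0 j| <= r.
Proof.
move=> r0; split=> [xr j|xr]; first exact: le_trans (normr_coord_le x j) xr.
rewrite [leLHS]mx_normrE; apply: bigmax_le => // -[i j] _ /=.
by rewrite (ord1 i); exact: xr.
Qed.

Lemma bump_eq1 a r x : 0 < r -> `|x - a| <= r -> box_bump a r x = 1.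
Proof.
move=> r0 /(normr_rV_leP _ (ltW r0)) xr; apply: big1 => j _.
apply: smooth_step_le0; rewrite subr_le0 -exprMn -[leRHS](expr1n _ 2).
rewrite -[leLHS]real_normK ?num_real// ler_pXn2r ?nnegrE//.
have := xr j; rewrite !mxE normrM normfV (gtr0_norm r0) => xj.
by rewrite ler_pdivrMr// mul1r.
Qed.

Lemma bump_eq0 a r x : 0 < r -> 2 * r < `|x - a| -> box_bump a r x = 0.
Proof.
move=> r0; rewrite ltNge => /negP xr.
have [j xj] : exists j, 2 * r < `|(x - a) 0 j|.
  apply: contrapT => nj; apply: xr; apply/(normr_rV_leP _ _).
    by rewrite mulr_ge0// ltW.
  by move=> j; rewrite leNgt; apply/negP => xj; apply: nj; exists j.
rewrite /box_bump (bigD1 j)//= smooth_step_ge1 ?mul0r//.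
rewrite lerBrDl -exprMn -real_normK ?num_real//.
move: xj; rewrite !mxE => xj.
have h2 : 2 <= `|(x 0 j - a 0 j) / r|.
  by rewrite normrM normfV (gtr0_norm r0) ler_pdivlMr// ltW.
apply: (@le_trans _ _ (2 ^+ 2)); first by rewrite expr2; lra.
by rewrite ler_pXn2r ?nnegrE.
Qed.

Lemma continuous_one_add_norm (V : normedModType R) : continuous (fun y : V => 1 + `|y|).
Proof.
move=> y; have h1 : {for y, continuous (fun _ : V => (1 : R))} by exact: cst_continuous.
have h2 : {for y, continuous (fun y : V => `|y|)} by exact: norm_continuous.
exact: (cvgD h1 h2).
Qed.

Lemma continuous_mul (X : topologicalType) (u v : X -> R) : continuous u -> continuous v ->
  continuous (fun y => u y * v y).
Proof. by move=> cu cv y; exact: (cvgM (cu y) (cv y)). Qed.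

(** Vanishing outside a fixed set replaces [tsupp]: for closed [A] it passes to derivatives and
    products with no closure to compute. *)
Definition csupp A phi := smooth phi /\ forall x, ~ A x -> phi x = 0.

Lemma csuppW A B phi : A `<=` B -> csupp A phi -> csupp B phi.
Proof. by move=> AB [sp pA]; split=> // x nB; apply: pA => /AB. Qed.

Lemma csupp_pderiv A phi j : closed A -> csupp A phi -> csupp A (pderiv j phi).
Proof.
move=> cA [sp pA]; split=> [|x nA]; first exact: smooth_pderiv.
apply: isd_val; apply: (isd_near _ (isd_cst j 0 x)).
have : nbhs x (~` A) by apply: open_nbhs_nbhs; split=> //; exact: closed_openC.
by apply: filterS => y nAy; rewrite pA.
Qed.

Lemma csupp_Ds A phi s : closed A -> csupp A phi -> csupp A (Ds s phi).
Proof. by move=> cA cp; elim: s => // j s IH; exact: csupp_pderiv. Qed.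

Lemma csuppM A eta phi : smooth eta -> csupp A phi -> csupp A (fun y => eta y * phi y).
Proof.
by move=> se [sp pA]; split=> [|x nA]; [exact: smoothM|rewrite pA ?mulr0].
Qed.

Lemma csuppMr A eta phi : smooth eta -> csupp A phi -> csupp A (fun y => phi y * eta y).
Proof.
by move=> se [sp pA]; split=> [|x nA]; [exact: smoothM|rewrite pA ?mul0r].
Qed.

Lemma compact_bound A (u : 'rV[R]_d -> R) : compact A -> continuous u ->
  exists c, 0 <= c /\ forall x, A x -> u x <= c.
Proof.
move=> cA cu; have [A0|A0] := pselect (A !=set0); last first.
  by exists 0; split=> // x Ax; exfalso; apply: A0; exists x.
have [|c _ uc] := EVT_max_rV A0 cA (f := u).
  by apply: continuous_subspaceT.
exists (Num.max 0 (u c)); split; first by rewrite le_max lexx.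
by move=> x Ax; rewrite le_max uc ?orbT// inE.
Qed.

Lemma rV_compact_closed A : compact A -> closed A.
Proof. by apply: compact_closed; exact: norm_hausdorff. Qed.

Lemma csupp_sschwartz A phi : compact A -> csupp A phi -> sschwartz phi.
Proof.
move=> cA cp; have clA := rV_compact_closed cA; split=> [|M N]; first exact: cp.1.
apply: snorm_exists0 => s _; have [sD zD] := csupp_Ds s clA cp.
have [|c [c0 uc]] := @compact_bound A (fun x => (1 + `|x|) ^+ N * normc (Ds s phi x)) cA.
  move=> x.
  have cN : continuous (fun y : 'rV[R]_d => (1 + `|y|) ^+ N).
    move=> y; apply: (@continuous_comp _ _ _ (fun y : 'rV[R]_d => 1 + `|y|) (fun t => t ^+ N)).
      exact: continuous_one_add_norm.
    exact: exprn_continuous.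
  have cB := ccont_normc (smooth_ccont sD).
  by have := continuous_mul cN cB; apply.
exists c => x; have [Ax|nA] := pselect (A x); first exact: uc.
by rewrite zD// normc0 mulr0.
Qed.

Lemma csupp_test_fun A phi : compact A -> csupp A phi -> test_fun phi.
Proof.
move=> cA [sp pA]; split=> //; apply: (subclosed_compact _ cA).
  exact: closed_closure.
rewrite /tsupp [X in _ `<=` X]((closure_id A).1 (rV_compact_closed cA)).
apply: closure_subset => x /eqP px; apply: contrapT => nA; exact: px (pA x nA).
Qed.

Lemma csupp_tsupp A phi : closed A -> csupp A phi -> tsupp phi `<=` A.
Proof.
move=> cA [sp pA]; rewrite /tsupp [X in _ `<=` X]((closure_id A).1 cA).
apply: closure_subset => x /eqP px; apply: contrapT => nA; exact: px (pA x nA).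
Qed.

Lemma test_fun_csupp phi : test_fun phi -> csupp (tsupp phi) phi.
Proof.
move=> [sp _]; split=> // x nt; apply: contrapT => /eqP px; apply: nt.
exact: subset_closure.
Qed.

Definition box a (r : R) : set 'rV[R]_d := [set x | `|x - a| <= r].

Lemma continuous_dist a : continuous (fun x => `|x - a|).
Proof.
move=> x.
have h1 : {for x, continuous (id : 'rV[R]_d -> 'rV[R]_d)} by exact: cvg_id.
have h2 : {for x, continuous (fun _ : 'rV[R]_d => a)} by exact: cst_continuous.
have h3 : {for x, continuous (fun x => x - a)} by exact: (cvgB h1 h2).
exact: (continuous_comp h3 (@norm_continuous R 'rV[R]_d (x - a))).
Qed.

Lemma closed_box a r : closed (box a r).
Proof.
exact: ((continuous_closedP _).1 (@continuous_dist a) _ (@closed_le _ r)).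
Qed.

Lemma open_obox a (r : R) : open [set x | `|x - a| < r].
Proof.
have /continuousP oP := @continuous_dist a.
exact: (oP [set t | t < r] (@open_lt _ r)).
Qed.

Lemma compact_box a r : compact (box a r).
Proof.
apply: (@bounded_closed_compact R d (box a r)); last exact: closed_box.
exists (`|a| + r); split; first exact: num_real.
move=> M rM x xa; apply: le_trans (ltW rM); rewrite -[x](subrK a) addrC.
by apply: (le_trans (ler_normD _ _)); rewrite lerD2l.
Qed.

Lemma csupp_bump a r : 0 < r -> csupp (box a (2 * r)) (fun y => (box_bump a r y)%:C).
Proof.
move=> r0; split; first exact: smooth_bump.
by move=> x /negP; rewrite -ltNge => xr; rewrite bump_eq0.
Qed.

(** A partition of unity without denominators: the bump [b] at a centre splits [phi] into [b phi],
    supported in one box, and [(1 - b) phi], which vanishes where [b] is 1 and so needs one centre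
    fewer. *)
Lemma csupp_cover (Z : ('rV[R]_d -> R[i]) -> Prop)
  (s : seq 'rV[R]_d) (r : 'rV[R]_d -> R) A phi :
  Z (fun=> 0) -> (forall f g, csupp A f -> csupp A g -> Z f -> Z g -> Z (fun y => f y + g y)) ->
  (forall a, a \in s -> 0 < r a) ->
  (forall a psi, a \in s -> csupp (A `&` box a (2 * r a)) psi -> Z psi) ->
  csupp A phi -> (forall x, phi x != 0 -> exists2 a, a \in s & box a (r a) x) -> Z phi.
Proof.
move=> Z0 ZD; elim: s phi => [|a s IH] phi r0 Zb cp cov.
  have -> : phi = fun=> 0; last exact: Z0.
  by apply/funext => x; apply: contrapT => /eqP /cov[].
have ra : 0 < r a by apply: r0; rewrite mem_head.
have sb := smooth_bump a (r a).
have sb1 : smooth (fun y => 1 + (- 1) * (box_bump a (r a) y)%:C).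
  exact: (smoothD (smooth_cst _) (smoothZ _ sb)).
have -> : phi = fun y => (box_bump a (r a) y)%:C * phi y +
    (1 + (- 1) * (box_bump a (r a) y)%:C) * phi y by apply/funext => y; ring.
have c1 := csuppM sb cp; have c2 := csuppM sb1 cp.
apply: ZD => //.
  apply: (Zb a); first by rewrite mem_head.
  split; first exact: c1.1.
  move=> x /not_andP[/cp.2 ->|nb]; first by rewrite mulr0.
  by rewrite (csupp_bump a ra).2 ?mul0r.
apply: IH => //.
- by move=> b bs; apply: r0; rewrite inE bs orbT.
- by move=> b psi bs; apply: Zb; rewrite inE bs orbT.
- move=> x; rewrite mulf_eq0 => /norP[nb /cov[b]].
  rewrite inE => /orP[/eqP ->|bs] xb; last by exists b.
  by move: nb; rewrite bump_eq1// mulN1r subrr eqxx.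
Qed.

Lemma open_box (U : set 'rV[R]_d) a : open U -> U a -> exists r : R, 0 < r /\ box a (2 * r) `<=` U.
Proof.
move=> oU Ua; have /nbhs_ballP[e /= e0 aU] : nbhs a U by apply: open_nbhs_nbhs; split.
exists (e / 4); split; first by rewrite divr_gt0.
move=> x xa; apply: aU; rewrite -ball_normE /ball_ /= distrC.
by apply: (le_lt_trans xa); lra.
Qed.

(** The boxes of radius [r a] cover, but [Q] concerns the doubled ones, because a bump equal to 1 on
    the former is supported in the latter. *)
Lemma compact_box_cover (S : set 'rV[R]_d) (Q : set 'rV[R]_d -> Prop) : compact S ->
  (forall a, S a -> exists r : R, 0 < r /\ Q (box a (2 * r))) ->
  exists (s : seq 'rV[R]_d) (r : 'rV[R]_d -> R),
    [/\ forall a, a \in s -> 0 < r a, forall a, a \in s -> Q (box a (2 * r a)) &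
        exists2 V : set 'rV[R]_d, open V & S `<=` V /\ V `<=` [set x | exists2 a, a \in s & box a (r a) x]].
Proof.
move=> cS SQ.
have /choice[r rP] : forall a, exists r : R, S a -> 0 < r /\ Q (box a (2 * r)).
  move=> a; have [Sa|nS] := pselect (S a); last by exists 0.
  by have [r rQ] := SQ a Sa; exists r.
move: cS; rewrite compact_cover => /(_ _ S (fun a => [set x | `|x - a| < r a])).
case=> [a Sa|a Sa|D DS cov]; first exact: open_obox.
  by exists a => //=; rewrite subrr normr0; exact: (rP a Sa).1.
have DSP a : a \in finmap.enum_fset D -> S a by move=> /DS; rewrite inE.
exists (finmap.enum_fset D), r; split.
- by move=> a /DSP /rP[].
- by move=> a /DSP /rP[].
- exists (cover [set` finmap.enum_fset D] (fun a => [set x | `|x - a| < r a])).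
    by apply: bigcup_open => a aD; exact: open_obox.
  split=> // x [a aD] /= xa.
  by exists a => //; exact: ltW.
Qed.

Lemma cutoff_exists (S U : set 'rV[R]_d) : compact S -> open U -> S `<=` U ->
  exists chi : 'rV[R]_d -> R[i], exists A, exists V,
  [/\ compact A, A `<=` U, csupp A chi, open V & S `<=` V /\ forall x, V x -> chi x = 1].
Proof.
move=> cS oU SU.
have SQ a : S a -> exists r : R, 0 < r /\ box a (2 * r) `<=` U.
  by move=> Sa; exact: open_box oU (SU a Sa).
have [s [r [r0 rU [V oV [SV Vs]]]]] := @compact_box_cover S (fun B => B `<=` U) cS SQ.
(* This is 1 as soon as one bump is 1, and 0 where all of them vanish. *)
exists (fun y => 1 + (- 1) * \prod_(a <- s) (1 + (- 1) * (box_bump a (r a) y)%:C)).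
exists (\big[setU/set0]_(a <- s) box a (2 * r a)), V.
have sP (t : seq 'rV[R]_d) : smooth (fun y => \prod_(a <- t) (1 + (- 1) * (box_bump a (r a) y)%:C)).
  by apply: smooth_prod => a; exact: (smoothD (smooth_cst _) (smoothZ _ (smooth_bump a (r a)))).
split => //.
- by apply: bigsetU_compact => a _; exact: compact_box.
- by rewrite -bigcup_seq => x [a /= /rU]; exact.
- split; first exact: (smoothD (smooth_cst _) (smoothZ _ (sP s))).
  rewrite -bigcup_seq => x nx; rewrite big1_seq ?mulr1 ?subrr//.
  move=> a /andP[_ sa]; rewrite bump_eq0 ?mulr0 ?addr0//; first exact: r0.
  by rewrite ltNge; apply/negP => xa; apply: nx; exists a.
- split=> // x /Vs[a sa xa]; rewrite (big_rem a)//= bump_eq1//; last exact: r0.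
  have -> : 1 + (- 1) * 1%:C = 0 :> R[i] by rewrite mulN1r subrr.
  by rewrite mul0r mulr0 addr0.
Qed.

End bumps.

(** * Integration over row vectors *)

Section tuple_integral.
Context (R : realType).
Local Notation mR := (measurableTypeR R).

Definition row_of (n : nat) (t : n.-tuple mR) : 'rV[R]_n := \row_j tnth t j.

Definition rowcons n (x : R) (y : 'rV[R]_n) : 'rV[R]_n.+1 :=
  \row_j if unlift ord0 j is Some k then y 0 k else x.

Lemma rowcons0 n x (y : 'rV[R]_n) : rowcons x y 0 ord0 = x.
Proof. by rewrite mxE unlift_none. Qed.

Lemma rowconsS n x (y : 'rV[R]_n) k : rowcons x y 0 (lift ord0 k) = y 0 k.
Proof. by rewrite mxE liftK. Qed.

Lemma row_of_cons n (x : mR) (t : n.-tuple mR) :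
  row_of (tuple_cons (x, t)) = rowcons x (row_of t).
Proof.
apply/rowP => j; rewrite !mxE; case: unliftP => [k ->|->].
  by rewrite mxE tnthS.
by rewrite tnth0.
Qed.

(** The measurable structure on tuples knows only the coordinates, so the preimage of an open
    interval is written as a countable union of cubes with rational centres and radii [1 / (m + 1)];
    cubes not contained in it are replaced by the empty set. *)
Lemma measurable_row_of n (g : 'rV[R]_n -> R) : continuous g ->
  measurable_fun [set: n.-tuple mR] (fun t => g (row_of t)).
Proof.
move=> cg; apply: (measurability _ (measurable_realfun.RGenOpens.measurableE R)).
move=> /= _ [_ [a [b ->]] <-]; rewrite setTI; set U := `]a, b[%classic.
have oU : open U by exact: interval_open.
have oV : open (g @^-1` U) by move/continuousP : cg; exact.
pose F (p : n.-tuple rat * nat) : set (n.-tuple mR) :=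
  if `[< forall y : 'rV[R]_n, (forall j, `|y 0 j - ratr (tnth p.1 j)| < p.2.+1%:R^-1) -> U (g y) >]
  then \bigcap_(j in [set: 'I_n]) ((@tnth n mR ^~ j) @^-1` [set t : R | `|t - ratr (tnth p.1 j)| < p.2.+1%:R^-1])
  else set0.
have -> : (fun t : n.-tuple mR => g (row_of t)) @^-1` U = \bigcup_p F p.
  apply/seteqP; split => [t /= Ut|t [[q m] _]]; last first.
    rewrite /F; case: asboolP => // h tF /=; apply: h => j; rewrite mxE; exact: (tF j).
  have /nbhs_ballP[e /= e0 eU] : nbhs (row_of t) (g @^-1` U).
    by apply: open_nbhs_nbhs; split.
  have [m me] : exists m : nat, m.+1%:R^-1 < e / 4.
    have e4 : 0 < e / 4 by rewrite divr_gt0.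
    have [m _ /(_ m (leqnn m))] := near_infty_natSinv_lt (PosNum e4).
    by exists m.
  have m0 : (0 : R) < m.+1%:R^-1 by rewrite invr_gt0.
  have /choice[q qP] : forall j : 'I_n, exists q : rat, `|tnth t j - ratr q| < m.+1%:R^-1.
    move=> j.
    have [|q] := @rat_in_itvoo R (tnth t j - m.+1%:R^-1) (tnth t j + m.+1%:R^-1).
      by rewrite ltrBlDr -addrA ltrDl addr_gt0.
    rewrite in_itv /= => /andP[q1 q2]; exists q.
    by rewrite distrC ltr_distl q1.
  exists (mktuple q, m) => //; rewrite /F /=; case: asboolP => [_|[]].
    by move=> j _ /=; rewrite tnth_mktuple.
  move=> y yq; apply: eU; rewrite -ball_normE /ball_ /=.
  apply: (@le_lt_trans _ _ (e / 2 + 0)).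
    apply/(@normr_rV_leP R n); first by rewrite addr0 divr_ge0// ltW.
    move=> j; rewrite !mxE addr0.
    have := yq j; have := qP j; rewrite tnth_mktuple => h1 h2.
    have -> : tnth t j - y 0 j = (tnth t j - ratr (q j)) - (y 0 j - ratr (q j)) by ring.
    apply: (le_trans (ler_normB _ _)).
    by move: h1 h2 me; set u := `|_|; set v := `|_|; set w := _^-1 => h1 h2 me; lra.
  lra.
apply: countable_bigcupT_measurable; first exact: countableP.
move=> p; rewrite /F; case: ifP => // _.
apply: fin_bigcap_measurable => // j _.
rewrite -[X in measurable X]setTI; apply: measurable_tnth => //.
have -> : [set t0 : R | `|t0 - ratr (tnth p.1 j)| < p.2.+1%:R^-1] =
    `]ratr (tnth p.1 j) - p.2.+1%:R^-1, ratr (tnth p.1 j) + p.2.+1%:R^-1[%classic.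
  by apply/seteqP; split => u /=; rewrite in_itv /= ltr_distl.
exact: measurable_itv.
Qed.

(** Extended values allow Tonelli's theorem for nonnegative functions before anything is known to be
    integrable. *)
Definition eint n (g : 'rV[R]_n -> R) : \bar R :=
  (\int[lebesgue_tuple R n]_t (g (row_of t))%:E)%E.

Lemma contraction_continuous (V W : normedModType R) (f : V -> W) :
  (forall x y, `|f x - f y| <= `|x - y|) -> continuous f.
Proof.
move=> fl x; apply/cvgrPdist_le => e e0; near=> z.
by apply: (le_trans (fl x z)); near: z; apply: cvgr_dist_le.
Unshelve. all: by end_near. Qed.

Lemma continuous_rowcons n (x : R) : continuous (@rowcons n x).
Proof.
apply: (@contraction_continuous 'rV[R]_n 'rV[R]_n.+1) => y z.
apply/normr_rV_leP => // j; rewrite !mxE; case: unliftP => [k _|_].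
  by apply: le_trans (normr_coord_le (y - z) k); rewrite !mxE.
by rewrite subrr normr0.
Qed.

Lemma continuous_rowcons_l n (y : 'rV[R]_n) : continuous (fun x => rowcons x y).
Proof.
apply: (@contraction_continuous R 'rV[R]_n.+1) => x z.
apply/normr_rV_leP => // j; rewrite !mxE; case: unliftP => [k _|//].
by rewrite subrr normr0.
Qed.

Lemma continuous_comp_rowcons n x (g : 'rV[R]_n.+1 -> R) : continuous g ->
  continuous (fun y => g (rowcons x y)).
Proof. by move=> cg y; exact: (continuous_comp (@continuous_rowcons n x y) (cg _)). Qed.

Lemma continuous_comp_rowcons_l n y (g : 'rV[R]_n.+1 -> R) : continuous g ->
  continuous (fun x => g (rowcons x y)).
Proof. by move=> cg x; exact: (continuous_comp (@continuous_rowcons_l n y x) (cg _)). Qed.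

Lemma eintS_prod n (g : 'rV[R]_n.+1 -> R) : continuous g -> (forall x, 0 <= g x) ->
  eint g = (\int[(@lebesgue_measure R : {sigma_finite_measure set mR -> \bar R})
     \x lebesgue_tuple R n]_p (g (rowcons p.1 (row_of p.2)))%:E)%E.
Proof.
move=> cg g0; rewrite /eint /= /lebesgue_cons.
rewrite ge0_integral_pushforward//.
- rewrite preimage_setT; apply: eq_integral => -[x t] _ /=.
  by rewrite -row_of_cons.
- exact: measurable_tuple_cons.
- by apply/measurable_EFinP; exact: measurable_row_of.
- by move=> t _; rewrite lee_fin.
Qed.

Lemma measurable_rowcons_prod n (g : 'rV[R]_n.+1 -> R) : continuous g ->
  measurable_fun [set: mR * n.-tuple mR] (fun p => (g (rowcons p.1 (row_of p.2)))%:E).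
Proof.
move=> cg; apply/measurable_EFinP.
have -> : (fun p : mR * n.-tuple mR => g (rowcons p.1 (row_of p.2))) =
    (fun t => g (row_of t)) \o (@tuple_cons R n).
  by apply/funext => -[x t] /=; rewrite -row_of_cons.
apply: measurableT_comp; first exact: measurable_row_of.
exact: measurable_tuple_cons.
Qed.

Lemma eintS n (g : 'rV[R]_n.+1 -> R) : continuous g -> (forall x, 0 <= g x) ->
  eint g = (\int[lebesgue_measure]_x eint (fun y => g (rowcons x y)))%E.
Proof.
move=> cg g0; rewrite eintS_prod// fubini_tonelli1//.
  exact: measurable_rowcons_prod.
by move=> x; rewrite lee_fin.
Qed.

(** With the first coordinate innermost, a translation of that coordinate is a change of variable on
    the line. The other coordinates are reached by induction through [eintS]. *)
Lemma eintS_swap n (g : 'rV[R]_n.+1 -> R) : continuous g -> (forall x, 0 <= g x) ->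
  eint g = (\int[lebesgue_tuple R n]_t
    \int[lebesgue_measure]_x (g (rowcons x (row_of t)))%:E)%E.
Proof.
move=> cg g0; have mg := measurable_rowcons_prod cg.
have g0' (p : mR * n.-tuple mR) : (0 <= (g (rowcons p.1 (row_of p.2)))%:E)%E.
  by rewrite lee_fin.
by rewrite eintS_prod// (fubini_tonelli1 _ mg g0') (fubini_tonelli _ mg g0').
Qed.

Lemma eint0 (g : 'rV[R]_0 -> R) : eint g = (g 0)%:E.
Proof.
have -> : g = cst (g 0) by apply/funext => y; congr g; apply/rowP => -[].
rewrite /eint /= integral_dirac//.
by rewrite /dirac indicE in_setT mul1e.
Qed.

Lemma continuous_prod_coord n (u : 'I_n -> R -> R) : (forall j, continuous (u j)) ->
  continuous (fun y : 'rV[R]_n => \prod_j u j (y 0 j)).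
Proof.
move=> cu; move: (index_enum _) => s; elim: s => [|i s IH].
  by rewrite (_ : (fun _ => _) = cst 1); [exact: cst_continuous|apply/funext => y; rewrite big_nil].
rewrite (_ : (fun _ => _) = fun y : 'rV[R]_n => u i (y 0 i) * \prod_(j <- s) u j (y 0 j)).
  apply: continuous_mul IH => y.
  exact: (continuous_comp (@coord_continuous _ _ _ 0 i y) (cu i _)).
by apply/funext => y; rewrite big_cons.
Qed.

Lemma eint_prod n (u : 'I_n -> R -> R) (c : 'I_n -> R) : (forall j, continuous (u j)) ->
  (forall j x, 0 <= u j x) ->
  (forall j, (\int[lebesgue_measure]_x (u j x)%:E)%E = (c j)%:E) ->
  eint (fun y : 'rV[R]_n => \prod_j u j (y 0 j)) = (\prod_j c j)%:E.
Proof.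
elim: n u c => [|n IH] u c cu u0 uc; first by rewrite eint0 !big_ord0.
have prod0 (y : 'rV[R]_n.+1) : 0 <= \prod_j u j (y 0 j) by apply: prodr_ge0.
have prod0' (y : 'rV[R]_n) : 0 <= \prod_j u (lift ord0 j) (y 0 j) by apply: prodr_ge0.
have c0 j : 0 <= c j.
  by rewrite -lee_fin -uc integral_ge0// => x _; rewrite lee_fin.
rewrite eintS//; last exact: continuous_prod_coord.
set C := \prod_j c (lift ord0 j).
transitivity (\int[lebesgue_measure]_x ((u ord0 x)%:E * C%:E))%E.
  apply: eq_integral => x _; rewrite -(IH (fun j => u (lift ord0 j)))// /eint -ge0_integralZl//.
  - apply: eq_integral => t _; rewrite -EFinM big_ord_recl rowcons0; congr (_ * _)%:E.
    by apply: eq_bigr => k _; rewrite rowconsS.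
  - apply/measurable_EFinP.
    exact: (measurable_row_of (@continuous_prod_coord n (fun j => u (lift ord0 j)) (fun j => cu _))).
  - by move=> t _; rewrite lee_fin.
  - by rewrite lee_fin.
rewrite ge0_integralZr//.
- by rewrite uc -EFinM big_ord_recl.
- by apply/measurable_EFinP; exact: continuous_measurable_fun.
- by move=> x _; rewrite lee_fin.
- by rewrite lee_fin; apply: prodr_ge0.
Qed.

Lemma integral_shift (G : R -> R) (h : R) : continuous G -> (forall x, 0 <= G x) ->
  (\int[lebesgue_measure]_x (G (x + h))%:E = \int[lebesgue_measure]_x (G x)%:E)%E.
Proof.
move=> cG G0.
have dF (x : R) : is_derive x 1 (fun t : R => t + h) 1.
  by have := is_deriveD (is_derive_id x 1) (is_derive_cst h x 1); rewrite addr0.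
have F1 : (fun t : R => t + h)^`()%classic = fun=> 1.
  by apply/funext => x; rewrite derive1E; have [_ ->] := dF x.
rewrite [RHS](@increasing_ge0_integration_by_substitutionT _ (fun t => t + h))//.
- by apply: eq_integral => x _ /=; rewrite F1 /= fctE mulr1.
- by move=> x y xy; rewrite ltrD2r.
- by rewrite F1; exact: cst_continuous.
- by rewrite F1; apply/cvg_ex; exists 1; exact: cvg_cst.
- by rewrite F1; apply/cvg_ex; exists 1; exact: cvg_cst.
- apply/cvgrNyPle => A; near=> x; rewrite -lerBrDr.
  by near: x; apply: nbhs_ninfty_le; rewrite num_real.
- apply/cvgryPge => A; near=> x; rewrite -lerBlDr.
  by near: x; apply: nbhs_pinfty_ge; rewrite num_real.
Unshelve. all: by end_near. Qed.

Lemma rowcons_shift0 n x (y : 'rV[R]_n) h :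
  h *: delta_mx 0 ord0 + rowcons x y = rowcons (x + h) y.
Proof.
apply/rowP => j; rewrite !mxE eqxx /=; case: unliftP => [k ->|->].
  by rewrite (_ : lift _ _ == _ = false) ?mulr0 ?add0r.
by rewrite eqxx mulr1 addrC.
Qed.

Lemma rowcons_shiftS n x (y : 'rV[R]_n) h k :
  h *: delta_mx 0 (lift ord0 k) + rowcons x y = rowcons x (h *: delta_mx 0 k + y).
Proof.
apply/rowP => j; rewrite !mxE eqxx /=; case: unliftP => [i ->|->].
  by rewrite !mxE eqxx (inj_eq lift_inj).
by rewrite (_ : ord0 == _ = false) ?mulr0 ?add0r.
Qed.

Lemma eint_shift n (g : 'rV[R]_n -> R) (h : R) (j : 'I_n) : continuous g -> (forall x, 0 <= g x) ->
  eint (fun y => g (h *: delta_mx 0 j + y)) = eint g.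
Proof.
have csh m (v : 'rV[R]_m) (u : 'rV[R]_m -> R) : continuous u -> continuous (fun y => u (v + y)).
  move=> cu y.
  have h1 : {for y, continuous (id : 'rV[R]_m -> 'rV[R]_m)} by exact: cvg_id.
  have h2 : {for y, continuous (fun _ : 'rV[R]_m => v)} by exact: cst_continuous.
  have h3 : {for y, continuous (fun x => v + x)} by exact: (cvgD h2 h1).
  exact: (continuous_comp h3 (cu _)).
elim: n g j => [g []//|n IH] g j cg g0.
case: (unliftP ord0 j) => [k ->|->].
  rewrite eintS//; last by apply: csh.
  rewrite [RHS]eintS//; apply: eq_integral => x _.
  rewrite -[RHS](IH _ k)//; last exact: continuous_comp_rowcons.
  by congr eint; apply/funext => y; rewrite rowcons_shiftS.
rewrite eintS_swap//; last by apply: csh.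
rewrite [RHS]eintS_swap//; apply: eq_integral => t _.
rewrite -[RHS](@integral_shift (fun x => g (rowcons x (row_of t))) h)//.
  by apply: eq_integral => x _; rewrite rowcons_shift0.
exact: continuous_comp_rowcons_l.
Qed.

End tuple_integral.

(** * Real integrals: domination, translation invariance, derivatives *)

Section row_integral.
Context (R : realType) (d : nat).
Local Notation mR := (measurableTypeR R).
Local Notation mu := (lebesgue_tuple R d).
Implicit Types (u v g : 'rV[R]_d -> R) (x : 'rV[R]_d) (j : 'I_d).

Definition rint g : R := \int[mu]_t g (row_of t).

Definition rintegrable g := continuous g /\
  mu.-integrable setT (fun t => (g (row_of t))%:E).

(* An integrable product comparable from below to [(1 + |x|)^(-2d)]. *)
Definition weight x : R := \prod_j (oneDsqr (x 0 j))^-1.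

Lemma weight_gt0 x : 0 < weight x.
Proof. by apply: prodr_gt0 => j _; rewrite invr_gt0. Qed.

Lemma rintegrable_ge0 g c : continuous g -> (forall x, 0 <= g x) -> eint g = c%:E ->
  rintegrable g /\ rint g = c.
Proof.
move=> cg g0 gc; split; last by rewrite /rint /Rintegral -/(eint g) gc.
split=> //; apply/integrableP; split.
  by apply/measurable_EFinP; exact: measurable_row_of.
have -> : (fun t => `|(g (row_of t))%:E|)%E = (fun t : d.-tuple mR => (g (row_of t))%:E).
  by apply/funext => t; rewrite gee0_abs// lee_fin.
by rewrite -/(eint g) gc ltry.
Qed.

Lemma rintegrable_prod (u : 'I_d -> R -> R) c : (forall j, continuous (u j)) ->
  (forall j t, 0 <= u j t) ->
  (forall j, (\int[lebesgue_measure]_t (u j t)%:E)%E = (c j)%:E) ->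
  rintegrable (fun y => \prod_j u j (y 0 j)) /\ rint (fun y => \prod_j u j (y 0 j)) = \prod_j c j.
Proof.
move=> cu u0 uc; apply: rintegrable_ge0; first exact: continuous_prod_coord.
  by move=> x; exact: prodr_ge0.
exact: eint_prod.
Qed.

Lemma rintegrable_weight : rintegrable weight.
Proof.
have [] := @rintegrable_prod (fun _ t => (oneDsqr t)^-1) (fun=> pi) (fun _ => @continuous_oneDsqrV R).
- by move=> _ x; rewrite invr_ge0.
- move=> _; rewrite ge0_symfun_integralT.
  + rewrite -set_itvcy integral0y_oneDsqr -EFinM mulrC divfK//.
  + by move=> x; rewrite invr_ge0.
  + exact: continuous_oneDsqrV.
  + by move=> x /=; rewrite /oneDsqr sqrrN.
- by [].
Qed.

Lemma le_rintegrable g u : continuous g -> (forall x, `|g x| <= u x) ->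
  rintegrable u -> rintegrable g.
Proof.
move=> cg gu [cu iu]; split=> //; apply: le_integrable iu => //.
  by apply/measurable_EFinP; exact: measurable_row_of.
move=> t _ /=; rewrite lee_fin; apply: (le_trans (gu _)); exact: ler_norm.
Qed.

Lemma rintegrableZ c g : rintegrable g -> rintegrable (fun x => c * g x).
Proof.
move=> [cg ig]; split; first exact: (continuous_mul (@cst_continuous _ _ c) cg).
by under eq_fun do rewrite EFinM; exact: integrableZl.
Qed.

Lemma continuous_add g h : continuous g -> continuous h -> continuous (fun x => g x + h x).
Proof. by move=> cg ch y; exact: (cvgD (cg y) (ch y)). Qed.

Lemma rintegrableD g h : rintegrable g -> rintegrable h -> rintegrable (fun x => g x + h x).
Proof.
move=> [cg ig] [ch ih]; split; first exact: continuous_add.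
by under eq_fun do rewrite EFinD; exact: integrableD.
Qed.

Lemma rintD g h : rintegrable g -> rintegrable h ->
  rint (fun x => g x + h x) = rint g + rint h.
Proof. by move=> [_ ig] [_ ih]; rewrite /rint RintegralD. Qed.

Lemma rintZ c g : rintegrable g -> rint (fun x => c * g x) = c * rint g.
Proof. by move=> [_ ig]; rewrite /rint RintegralZl. Qed.

Lemma rint_le g u : rintegrable g -> rintegrable u -> (forall x, `|g x| <= u x) ->
  `|rint g| <= rint u.
Proof.
move=> [cg ig] [cu iu] gu; rewrite /rint.
apply: (le_trans (le_normr_Rintegral _ ig)) => //.
apply: le_Rintegral => //; exact: (integrable_norm ig).
Qed.

Definition bigW : R := rint weight.

Lemma bigW_ge0 : 0 <= bigW.
Proof. by apply: Rintegral_ge0 => t _; exact: ltW (weight_gt0 _). Qed.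

Lemma continuous_shift g (v : 'rV[R]_d) : continuous g -> continuous (fun y => g (v + y)).
Proof.
move=> cu y.
have h1 : {for y, continuous (id : 'rV[R]_d -> 'rV[R]_d)} by exact: cvg_id.
have h2 : {for y, continuous (fun _ : 'rV[R]_d => v)} by exact: cst_continuous.
have h3 : {for y, continuous (fun x => v + x)} by exact: (cvgD h2 h1).
exact: (continuous_comp h3 (cu _)).
Qed.

Lemma rint_shift_ge0 g h j : rintegrable g -> (forall x, 0 <= g x) ->
  rintegrable (fun y => g (h *: delta_mx 0 j + y)) /\
  rint (fun y => g (h *: delta_mx 0 j + y)) = rint g.
Proof.
move=> [cg ig] g0.
have e1 : eint g = (rint g)%:E.
  by rewrite /rint /Rintegral fineK//; exact: integrable_fin_num ig.
apply: rintegrable_ge0; first exact: continuous_shift.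
  by [].
by rewrite eint_shift.
Qed.

(** Invariance is first known for nonnegative functions: [C * weight] is added to make [g]
    nonnegative and subtracted afterwards. *)
Lemma rint_shift g C h j : continuous g -> (forall x, `|g x| <= C * weight x) ->
  rintegrable (fun y => g (h *: delta_mx 0 j + y)) /\
  rint (fun y => g (h *: delta_mx 0 j + y)) = rint g.
Proof.
move=> cg gC.
have iw := rintegrableZ C rintegrable_weight.
have ig := le_rintegrable cg gC iw.
have w0 x : 0 <= C * weight x by apply: le_trans (gC x).
have p0 x : 0 <= g x + C * weight x.
  by have := gC x; rewrite ler_norml => /andP[]; rewrite -subr_ge0 opprK addrC.
have [is1 e1] := rint_shift_ge0 h j iw w0.
have [is2 e2] := rint_shift_ge0 h j (rintegrableD ig iw) p0.
have -> : (fun y => g (h *: delta_mx 0 j + y)) = (fun y =>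
    (g (h *: delta_mx 0 j + y) + C * weight (h *: delta_mx 0 j + y)) +
     (- 1) * (C * weight (h *: delta_mx 0 j + y))).
  by apply/funext => y; ring.
split; first exact: (rintegrableD is2 (rintegrableZ _ is1)).
rewrite (rintD is2 (rintegrableZ _ is1)) (rintZ _ is1) e1 e2 (rintD ig iw); ring.
Qed.

(** In the shifted coordinate this is [1 + y^2 <= 3 (1 + (y + h)^2)]. It lets a bound by the weight
    survive the translations in a difference quotient. *)
Lemma weight_shift h j x : `|h| <= 1 -> weight (h *: delta_mx 0 j + x) <= 3 * weight x.
Proof.
move=> h1; rewrite /weight (bigD1 j)//= [X in _ <= _ * X](bigD1 j)//= mulrA.
have -> : \prod_(i < d | i != j) (oneDsqr ((h *: delta_mx 0 j + x) 0 i))^-1 =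
    \prod_(i < d | i != j) (oneDsqr (x 0 i))^-1.
  by apply: eq_bigr => i ij; rewrite !mxE eqxx (negbTE ij) /= mulr0 add0r.
rewrite ler_wpM2r//; first by apply: prodr_ge0 => i _; rewrite invr_ge0.
rewrite !mxE !eqxx /= mulr1 ler_pdivlMr// mulrC ler_pdivrMr//.
have : h ^+ 2 <= 1 by rewrite -real_normK ?num_real// expr_le1.
rewrite /oneDsqr; set y := x 0 j => h2.
have : 0 <= (y + 2 * h) ^+ 2 by exact: sqr_ge0.
have : 0 <= y ^+ 2 by exact: sqr_ge0.
nra.
Qed.

Lemma mvt0 (u u' : R -> R) (t : R) : (forall s : R, is_derive s 1 u (u' s)) ->
  exists c : R, `|c| <= `|t| /\ u t - u 0 = t * u' c.
Proof.
move=> uu'.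
have cu (s : R) : {for s, continuous u}.
  by apply: differentiable_continuous; apply/derivable1_diffP; have [] := uu' s.
have [t0|t0|->] := ltgtP t 0.
- have [|c + eu] := @MVT_segment _ u u' t 0 (ltW t0) (fun s _ => uu' s).
    by apply: continuous_in_subspaceT => s _; exact: cu.
  rewrite in_itv /= => /andP[c1 c2]; exists c; split.
    by rewrite !ler0_norm ?lerN2// ltW.
  by rewrite -opprB eu; ring.
- have [|c + eu] := @MVT_segment _ u u' 0 t (ltW t0) (fun s _ => uu' s).
    by apply: continuous_in_subspaceT => s _; exact: cu.
  rewrite in_itv /= => /andP[c1 c2]; exists c; split.
    by rewrite !ger0_norm// ltW.
  by rewrite eu subr0 mulrC.
- by exists 0; split => //; rewrite subrr mul0r.
Qed.

(** The mean value theorem applied twice; the factor 1/2 of Taylor's formula is given up. *)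
Lemma taylor2_line (u u1 u2 : R -> R) (h K : R) :
  (forall s : R, is_derive s 1 u (u1 s)) -> (forall s : R, is_derive s 1 u1 (u2 s)) ->
  (forall t : R, `|t| <= `|h| -> `|u2 t| <= K) ->
  `|u h - u 0 - h * u1 0| <= K * h ^+ 2.
Proof.
move=> uu1 u12 u2K.
have [c [ch ->]] := mvt0 h uu1.
have [b [bc e1]] := mvt0 c u12.
rewrite -mulrBr e1 !normrM -[h ^+ 2]real_normK ?num_real// [leRHS]mulrC expr2 -[leRHS]mulrA.
by rewrite ler_wpM2l// ler_pM//; apply: u2K; exact: le_trans bc ch.
Qed.

Lemma taylor2 (g g1 g2 : 'rV[R]_d -> R) j x (h K : R) :
  (forall y, is_derive y (delta_mx 0 j : 'rV[R]_d) g (g1 y)) ->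
  (forall y, is_derive y (delta_mx 0 j : 'rV[R]_d) g1 (g2 y)) ->
  (forall t : R, `|t| <= `|h| -> `|g2 (t *: delta_mx 0 j + x)| <= K) ->
  `|g (h *: delta_mx 0 j + x) - g x - h * g1 x| <= K * h ^+ 2.
Proof.
move=> gg1 g12 g2K; set e := (delta_mx 0 j : 'rV[R]_d).
have := @taylor2_line (fun t : R => g (t *: e + x)) (fun t : R => g1 (t *: e + x))
  (fun t : R => g2 (t *: e + x)) h K (fun s => (is_derive_slice _ _ _ _ _).1 (gg1 _))
  (fun s => (is_derive_slice _ _ _ _ _).1 (g12 _)) g2K.
by rewrite scale0r add0r.
Qed.

(* The integral of a difference quotient is zero by translation invariance, and
   the second derivative controls its distance to [g1]. *)
Lemma rint_derive0 (g g1 g2 : 'rV[R]_d -> R) j C : continuous g -> continuous g1 ->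
  (forall y, is_derive y (delta_mx 0 j : 'rV[R]_d) g (g1 y)) ->
  (forall y, is_derive y (delta_mx 0 j : 'rV[R]_d) g1 (g2 y)) ->
  (forall x, `|g x| <= C * weight x) -> (forall x, `|g1 x| <= C * weight x) ->
  (forall x, `|g2 x| <= C * weight x) -> rint g1 = 0.
Proof.
move=> cg cg1 gg1 g12 gC g1C g2C.
have iw := rintegrable_weight.
have ig := le_rintegrable cg gC (rintegrableZ C iw).
have ig1 := le_rintegrable cg1 g1C (rintegrableZ C iw).
have C0 : 0 <= C.
  by rewrite -(@pmulr_lge0 _ (weight 0)) ?weight_gt0//; apply: le_trans (gC 0).
have key (h : R) : 0 < h <= 1 -> `|rint g1| <= h * (C * 3 * bigW).
  move=> /andP[h0 h1]; have nh1 : `|h| <= 1 by rewrite gtr0_norm.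
  have [is1 e1] := rint_shift h j cg gC.
  have -> : rint g1 = (- h^-1) * rint (fun y => g (h *: delta_mx 0 j + y) + (- 1) * g y + (- h) * g1 y).
    rewrite (rintD (rintegrableD is1 (rintegrableZ _ ig)) (rintegrableZ _ ig1)).
    rewrite (rintD is1 (rintegrableZ _ ig)) !rintZ// e1.
    by field; rewrite gt_eqF.
  rewrite normrM normrN normfV (gtr0_norm h0) ler_pdivrMl//.
  rewrite [leRHS](_ : _ = rint (fun x => (C * 3 * h ^+ 2) * weight x)); last first.
    by rewrite rintZ// /bigW; ring.
  apply: rint_le.
  - exact: (rintegrableD (rintegrableD is1 (rintegrableZ _ ig)) (rintegrableZ _ ig1)).
  - exact: rintegrableZ.
  - move=> x; rewrite mulN1r mulNr.
    rewrite [leRHS](_ : _ = C * 3 * weight x * h ^+ 2); last by ring.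
    apply: (taylor2 gg1 g12) => t th; apply: (le_trans (g2C _)).
    by rewrite -mulrA ler_wpM2l// weight_shift// (le_trans th).
apply/eqP; rewrite -normr_eq0 eq_le normr_ge0 andbT leNgt; apply/negP => r0.
set D := C * 3 * bigW in key.
have D0 : 0 <= D by rewrite !mulr_ge0// bigW_ge0.
(* Chosen so that [h * D] is at most half of the modulus of the integral, which contradicts [key]
   unless the integral is 0. *)
set h := Num.min 1 (`|rint g1| / (2 * (D + 1))).
have h0 : 0 < h by rewrite lt_min ltr01 divr_gt0// mulr_gt0// ltr_wpDl.
have := key h; rewrite h0 ge_min lexx => /(_ isT).
have hle : h <= `|rint g1| / (2 * (D + 1)) by rewrite ge_min lexx orbT.
have : h * D <= `|rint g1| / (2 * (D + 1)) * (D + 1).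
  by apply: ler_pM => //; [exact: ltW|rewrite lerDl].
have -> : `|rint g1| / (2 * (D + 1)) * (D + 1) = `|rint g1| / 2.
  by field; rewrite gt_eqF// ltr_wpDl.
move=> h1 h2; move: (le_trans h2 h1) r0; set r := `|_|; lra.
Qed.

End row_integral.

(** * Fourier transform of Schwartz functions *)

Section gaussians.
Context (R : realType) (d : nat).
Implicit Types (f g psi : 'rV[R]_d -> R[i]) (x y a l : 'rV[R]_d) (j : 'I_d).

Lemma sm1_trig k (a b : R) : sm1 k (fun t => a * cos t + b * sin t).
Proof.
have dt (p q t : R) : is_derive t 1 (fun t => p * cos t + q * sin t) (q * cos t + (- p) * sin t).
  have := is_deriveD (is_deriveZ p (is_derive_cos t)) (is_deriveZ q (is_derive_sin t)).
  move=> /is_derive_eq; apply; rewrite -![_ *: _]/(_ * _); ring.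
have ct p q : continuous (fun t : R => p * cos t + q * sin t).
  move=> t; apply: differentiable_continuous; apply/derivable1_diffP.
  by have [] := dt p q t.
elim: k a b => [|k IH] a b; first exact: ct.
by split; [exact: ct|exists (fun t => b * cos t + (- a) * sin t); split].
Qed.

Lemma sm1_cos k : sm1 k (@cos R).
Proof.
by have := sm1_trig k 1 0; under eq_fun do rewrite mul1r mul0r addr0.
Qed.

Lemma sm1_sin k : sm1 k (@sin R).
Proof.
by have := sm1_trig k 0 1; under eq_fun do rewrite mul1r mul0r add0r.
Qed.

Lemma sm1_expR k : sm1 k (@expR R).
Proof.
elim: k => [|k IH]; first exact: continuous_expR.
by split; [exact: continuous_expR|exists expR; split=> // t; exact: is_derive_expR].
Qed.

Lemma dotvDl x y a : dotv (x + y) a = dotv x a + dotv y a.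
Proof. by rewrite /dotv -big_split /=; apply: eq_bigr => j _; rewrite mxE mulrDl. Qed.

Lemma dotvZl (h : R) x a : dotv (h *: x) a = h * dotv x a.
Proof. by rewrite /dotv mulr_sumr; apply: eq_bigr => j _; rewrite mxE mulrA. Qed.

Lemma dotvC x a : dotv x a = dotv a x.
Proof. by apply: eq_bigr => j _; rewrite mulrC. Qed.

Lemma dotv_delta j a : dotv (delta_mx 0 j) a = a 0 j.
Proof.
rewrite /dotv (bigD1 j)//= big1 => [|k kj]; first by rewrite mxE !eqxx mul1r addr0.
by rewrite mxE eqxx (negbTE kj) mul0r.
Qed.

Lemma dotv_shift j (h : R) x a : dotv (h *: delta_mx 0 j + x) a = dotv x a + h * a 0 j.
Proof. by rewrite dotvDl dotvZl dotv_delta addrC. Qed.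

Lemma is_derive_dotv j x a :
  is_derive x (delta_mx 0 j : 'rV[R]_d) (fun y => dotv y a) (a 0 j).
Proof.
apply: (@is_derive_quad _ _ _ _ _ _ 0) => h _; rewrite dotv_shift.
by rewrite mul0r [X in `|X|](_ : _ = 0) ?normr0//; ring.
Qed.

Lemma is_derive_sqn j x :
  is_derive x (delta_mx 0 j : 'rV[R]_d) (fun y => dotv y y) (2 * x 0 j).
Proof.
apply: (@is_derive_quad _ _ _ _ _ _ 1) => h _.
rewrite dotv_shift dotvC dotv_shift !mxE !eqxx mulr1.
by rewrite mul1r [X in `|X|](_ : _ = h ^+ 2) ?ger0_norm ?sqr_ge0//; ring.
Qed.

Lemma smooth_dotv a : smooth (fun y => (dotv y a)%:C).
Proof.
have -> : (fun y => (dotv y a)%:C) = fun y => \sum_j (a 0 j)%:C * (y 0 j)%:C.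
  apply/funext => y; rewrite /dotv; elim: (index_enum _) => [|j s IH].
    by rewrite !big_nil.
  by rewrite !big_cons realcD IH -realcM mulrC.
by apply: smooth_sum => j; exact: (smoothZ _ (smooth_coord R j)).
Qed.

Lemma smooth_sqn : smooth (fun y : 'rV[R]_d => (dotv y y)%:C).
Proof.
have -> : (fun y : 'rV[R]_d => (dotv y y)%:C) = fun y => \sum_j (y 0 j)%:C * (y 0 j)%:C.
  apply/funext => y; rewrite /dotv; elim: (index_enum _) => [|j s IH].
    by rewrite !big_nil.
  by rewrite !big_cons realcD IH -realcM mulrC.
by apply: smooth_sum => j; exact: (smoothM (smooth_coord R j) (smooth_coord R j)).
Qed.

(* Character times Gaussian; its Fourier transform is an approximate identity at
   [a] as [q] tends to 0. *)
Definition gexp (q : R) a y : R[i] := expi (dotv y a) * (expR (- q * dotv y y / 2))%:C.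

Lemma smooth_expi (u : 'rV[R]_d -> R) : smooth (fun y => (u y)%:C) ->
  smooth (fun y => expi (u y)).
Proof.
move=> su.
have -> : (fun y => expi (u y)) = fun y => (cos (u y))%:C + (0 +i* 1) * (sin (u y))%:C.
  by apply/funext => y; apply: complex_ext; rewrite ?CReD ?CImD ?CReM ?CImM /=; ring.
exact: (smoothD (smooth_comp sm1_cos su) (smoothZ _ (smooth_comp sm1_sin su))).
Qed.

Lemma smooth_gexp q a : smooth (gexp q a).
Proof.
apply: smoothM; first exact: smooth_expi (smooth_dotv a).
apply: (smooth_comp sm1_expR).
have -> : (fun y : 'rV[R]_d => (- q * dotv y y / 2)%:C) = fun y => (- q / 2)%:C * (dotv y y)%:C.
  by apply/funext => y; rewrite -realcM; congr (_%:C); ring.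
exact: (smoothZ _ smooth_sqn).
Qed.

Lemma isd_expi j (u : 'rV[R]_d -> R) (c : R) x :
  is_derive x (delta_mx 0 j : 'rV[R]_d) u c ->
  isd j (fun y => expi (u y)) x ((0 +i* c) * expi (u x)).
Proof.
move=> uc; split.
  have := is_derive_chain (is_derive_cos (u x)) uc.
  by move=> /is_derive_eq; apply; rewrite /=; ring.
have := is_derive_chain (is_derive_sin (u x)) uc.
by move=> /is_derive_eq; apply; rewrite /=; ring.
Qed.

Lemma pderiv_gexp q a j :
  pderiv j (gexp q a) = fun y => ((0 +i* a 0 j) + (- q)%:C * (y 0 j)%:C) * gexp q a y.
Proof.
apply/funext => x; apply: isd_val.
have e1 := isd_expi (is_derive_dotv j x a).
have e3 : isd j (fun y => (expR (- q * dotv y y / 2))%:C) x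
    ((expR (- q * dotv x x / 2))%:C * (- q * x 0 j)%:C).
  rewrite -realcM; apply: isd_real.
  have e4 y : - q * dotv y y / 2 = ((- q / 2) *: (fun y : 'rV[R]_d => dotv y y)) y.
    by transitivity ((- q / 2) * dotv y y); [ring|].
  have -> : (fun y : 'rV[R]_d => expR (- q * dotv y y / 2)) =
      fun y => expR (((- q / 2) *: (fun y : 'rV[R]_d => dotv y y)) y).
    by apply/funext => y; rewrite e4.
  have dq := is_deriveZ (- q / 2) (is_derive_sqn j x).
  apply: (is_derive_eq (is_derive_chain (is_derive_expR _) dq)).
  rewrite (e4 x); congr (_ * _).
  by transitivity ((- q / 2) * (2 * x 0 j)); [|field].
apply: (isd_eq (isdM e1 e3)); rewrite /gexp realcM; ring.
Qed.

Lemma normc_expi (t : R) : normc (expi t) = 1.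
Proof. by rewrite normc_ReImE /= cos2Dsin2 sqrtr1. Qed.

Lemma normc_gexp q a y : normc (gexp q a y) = expR (- q * dotv y y / 2).
Proof.
by rewrite normcM normc_expi mul1r normcR ger0_norm// expR_ge0.
Qed.

Lemma sqn_ge0 y : 0 <= dotv y y.
Proof. by apply: sumr_ge0 => j _; rewrite -expr2 sqr_ge0. Qed.

Lemma normc_gexp_le1 q a y : 0 <= q -> normc (gexp q a y) <= 1.
Proof.
move=> q0; rewrite normc_gexp -[leRHS]expR0 ler_expR !mulNr oppr_le0.
by rewrite !mulr_ge0// sqn_ge0.
Qed.

(** The case [q = 0] covers the plain characters, which are multipliers but not Schwartz
    functions. *)
Lemma moderate_gexp q a : 0 <= q -> moderate (gexp q a).
Proof.
move=> q0; have sg := smooth_gexp q a; split=> //.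
have mlin j : moderate (fun y : 'rV[R]_d => (0 +i* a 0 j) + (- q)%:C * (y 0 j)%:C).
  exact: (moderateD (@moderate_cst R d (0 +i* a 0 j)) (moderateZ (- q)%:C (@moderate_coord R d j))).
elim=> [|M [K [C gC]]].
  exists 0%N, 1 => -[|//] _ x; rewrite expr0 mulr1; exact: normc_gexp_le1.
have /choice[KC KCP] : forall j, exists p : nat * R,
    growth_le M p.1 (pderiv j (gexp q a)) p.2.
  move=> j; rewrite pderiv_gexp; have [sl /(_ M)[K1 [C1 lC]]] := mlin j.
  exists ((K1 + K)%N, 2 ^+ M * (C1 * C)); exact: growthM.
exists (\sum_j (KC j).1)%N, (1 + \sum_j (KC j).2).
have C0 j : 0 <= (KC j).2 by apply: growth_ge0 (KCP j).
have S0 : 0 <= \sum_j (KC j).2 by apply: sumr_ge0.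
apply: growthS => [x|j].
  apply: (le_trans (normc_gexp_le1 a x q0)).
  rewrite -[leLHS]mulr1 ler_pM//; first by rewrite lerDl.
  by rewrite exprn_ege1// one_add_norm_ge1.
apply: growthW (KCP j) => //.
  by rewrite (bigD1 j)//= leq_addr.
by rewrite (bigD1 j)//= addrCA lerDl addr_ge0// sumr_ge0.
Qed.

Lemma normr_sqr_le_sqn y : `|y| ^+ 2 <= dotv y y.
Proof.
have [n0|[j yj]] : `|y| = 0 \/ exists j, `|y| <= `|y 0 j|.
  have [->|y0] := eqVneq y 0; first by left; rewrite normr0.
  right; apply: contrapT => nj.
  have : `|y| < `|y|; last by rewrite ltxx.
  rewrite [ltLHS]mx_normrE; apply: bigmax_lt; first by rewrite normr_gt0.
  move=> [i j] _ /=; rewrite (ord1 i) ltNge; apply/negP => yj; apply: nj.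
  by exists j.
- by rewrite n0 expr0n /= sqn_ge0.
- rewrite /dotv (bigD1 j)//= -expr2 -[y 0 j ^+ 2]real_normK ?num_real//.
  rewrite -[leLHS]addr0 lerD//; first by rewrite ler_pXn2r ?nnegrE.
  by apply: sumr_ge0 => k _; rewrite -expr2 sqr_ge0.
Qed.

Lemma sschwartz_gexp q a : 0 < q -> sschwartz (gexp q a).
Proof.
move=> q0; have sg := smooth_gexp q a; split=> //.
elim=> [|M IH] N.
  (* [(2 * q)^-1] is the maximum of [t - q t^2 / 2]; the 1 comes from bounding [(1 + |x|)^N] by
     [N! exp (1 + |x|)]. *)
  set c := 1 + (2 * q)^-1.
  exists (N`!%:R * expR c); apply: snorm0 => x; rewrite normc_gexp.
  have x0 : 0 <= 1 + `|x| by rewrite addr_ge0.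
  apply: (@le_trans _ _ (N`!%:R * expR (1 + `|x|) * expR (- q * dotv x x / 2))).
    by rewrite ler_wpM2r ?expR_ge0// expr_le_fact_expR.
  rewrite -mulrA ler_wpM2l ?ler0n// -expRD ler_expR /c -addrA lerD2l.
  apply: (@le_trans _ _ (`|x| - q * `|x| ^+ 2 / 2)).
    rewrite lerD2l !mulNr lerN2 ler_wpM2r// ler_wpM2l ?(ltW q0)//.
    exact: normr_sqr_le_sqn.
  rewrite -subr_ge0.
  have -> : (2 * q)^-1 - (`|x| - q * `|x| ^+ 2 / 2) = (q * `|x| - 1) ^+ 2 / (2 * q).
    by field; rewrite gt_eqF.
  by rewrite divr_ge0 ?sqr_ge0// mulr_ge0// ltW.
have [c gc] := IH N.+1.
have c0 := snorm_ge0 gc.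
exists (c + \sum_j (normc (0 +i* a 0 j) * c + normc ((- q)%:C) * (M.+1%:R * c))).
have t0 j : 0 <= normc (0 +i* a 0 j) * c + normc ((- q)%:C) * (M.+1%:R * c).
  by rewrite addr_ge0// mulr_ge0 ?normc_ge0// mulr_ge0.
apply: snormS => [x|j].
  apply: (le_trans (snorm_fun x (snormW (leqnn M) (leqnSn N) (lexx c) gc))).
  by rewrite lerDl sumr_ge0.
rewrite (bigD1 j)// addrCA.
apply: (@snormW _ _ M N M N _ (normc (0 +i* a 0 j) * c + normc ((- q)%:C) * (M.+1%:R * c))) => //.
  by rewrite lerDl addr_ge0// sumr_ge0.
have -> : pderiv j (gexp q a) = fun y => (0 +i* a 0 j) * gexp q a y +
    (- q)%:C * ((y 0 j)%:C * gexp q a y).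
  by rewrite pderiv_gexp; apply/funext => y; rewrite mulrDl mulrA.
have scg := smoothM (smooth_coord R j) sg.
apply: (snormD (smoothZ _ sg) (smoothZ _ scg)).
  by apply: (snormZ _ sg); apply: snormW gc.
by apply: (snormZ _ scg); apply: (snorm_coord j sg gc).
Qed.

End gaussians.

(** * Complex integrals and the rules for derivatives of Fourier transforms *)

Section complex_integral.
Context (R : realType) (d : nat).
Implicit Types (f g psi : 'rV[R]_d -> R[i]) (x y a l : 'rV[R]_d) (j : 'I_d).
Local Notation W := (bigW R d).

(** Serves as integrability criterion: it is stable under sums and multiples, unaffected by
    characters, and carries the constant that bounds the integral. *)
Definition cdom g (C : R) := ccont g /\ forall x, normc (g x) <= C * weight x.

Lemma cdom_rintegrable g C : cdom g C -> rintegrable (ref g) /\ rintegrable (imf g).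
Proof.
move=> [[cr ci] gC]; have iw := rintegrableZ C (rintegrable_weight R d).
split; [apply: (le_rintegrable cr _ iw)|apply: (le_rintegrable ci _ iw)] => x.
  by apply: le_trans (gC x); exact: normRe_le.
by apply: le_trans (gC x); exact: normIm_le.
Qed.

Lemma cintegralE g : cintegral g = rint (ref g) +i* rint (imf g).
Proof. by []. Qed.

Lemma cintegralD f g C D : cdom f C -> cdom g D ->
  cintegral (fun x => f x + g x) = cintegral f + cintegral g.
Proof.
move=> /cdom_rintegrable[fr fi] /cdom_rintegrable[gr gi]; rewrite !cintegralE.
apply: complex_ext; rewrite ?CReD ?CImD /=.
  by rewrite -rintD//; congr rint; apply/funext => x; rewrite /ref CReD.
by rewrite -rintD//; congr rint; apply/funext => x; rewrite /imf CImD.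
Qed.

Lemma cintegralZ c g C : cdom g C ->
  cintegral (fun x => c * g x) = c * cintegral g.
Proof.
move=> /cdom_rintegrable[gr gi]; rewrite !cintegralE.
apply: complex_ext; rewrite ?CReM ?CImM /=.
  rewrite -(rintZ _ gr) -mulNr -(rintZ _ gi) -(rintD (rintegrableZ _ gr) (rintegrableZ _ gi)).
  by congr rint; apply/funext => x; rewrite /ref /imf CReM mulNr.
rewrite -(rintZ _ gr) -(rintZ _ gi) -(rintD (rintegrableZ _ gi) (rintegrableZ _ gr)).
by congr rint; apply/funext => x; rewrite /ref /imf CImM.
Qed.

Lemma cdomZ c g C : cdom g C -> cdom (fun x => c * g x) (normc c * C).
Proof.
move=> [cg gC]; split; first exact: (ccontM (@ccont_cst R d c) cg).
by move=> x; rewrite normcM -mulrA ler_wpM2l ?normc_ge0.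
Qed.

Lemma cdomD f g C D : cdom f C -> cdom g D -> cdom (fun x => f x + g x) (C + D).
Proof.
move=> [cf fC] [cg gC]; split; first exact: ccontD.
by move=> x; rewrite mulrDl (le_trans (normcD _ _))// lerD.
Qed.

(** Real and imaginary parts are estimated separately, at the price of a factor 2. *)
Lemma normc_cintegral_le g (u : 'rV[R]_d -> R) : ccont g -> rintegrable u ->
  (forall x, normc (g x) <= u x) -> normc (cintegral g) <= 2 * rint u.
Proof.
move=> [cr ci] iu gu; rewrite (le_trans (normc_le_ReIm _))// cintegralE /=.
have ru x : `|ref g x| <= u x by apply: le_trans (gu x); exact: normRe_le.
have iu' x : `|imf g x| <= u x by apply: le_trans (gu x); exact: normIm_le.
have h1 := rint_le (le_rintegrable cr ru iu) iu ru.
have h2 := rint_le (le_rintegrable ci iu' iu) iu iu'.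
by rewrite mulrDl mul1r lerD.
Qed.

Lemma normc_cintegral_dom g C : cdom g C -> normc (cintegral g) <= 2 * (C * W).
Proof.
move=> [cg gC]; rewrite -(rintZ _ (rintegrable_weight R d)).
exact: (normc_cintegral_le cg (rintegrableZ _ (rintegrable_weight R d)) gC).
Qed.

(** Coordinate by coordinate, [1 + x_j^2 <= (1 + |x|)^2]. This is where the exponent [2 * d] in all
    later integrability conditions comes from. *)
Lemma weight_ge x : 1 <= (1 + `|x|) ^+ (2 * d) * weight x.
Proof.
rewrite /weight exprM -[X in _ ^+ X](card_ord d) -prodr_const -big_split /=.
apply: (big_ind (fun z => 1 <= z)) => // [u v|j _]; first exact: mulr_ege1.
rewrite ler_pdivlMr// mul1r /oneDsqr.
have : x 0 j ^+ 2 <= `|x| ^+ 2.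
  by rewrite -[leLHS]real_normK ?num_real// ler_pXn2r ?nnegrE// normr_coord_le.
have : 0 <= `|x| by [].
nra.
Qed.

Lemma cdom_decay g c : ccont g ->
  (forall x, (1 + `|x|) ^+ (2 * d) * normc (g x) <= c) -> cdom g c.
Proof.
move=> cg gc; split=> // x; apply: (@le_trans _ _ ((1 + `|x|) ^+ (2 * d) * normc (g x) * weight x)).
  by rewrite mulrAC ler_peMl ?normc_ge0// weight_ge.
by rewrite ler_wpM2r// ltW// weight_gt0.
Qed.

Lemma sschwartz_cdom psi : sschwartz psi -> exists c, cdom psi c.
Proof.
move=> [sp pc]; have [c pcc] := pc 0%N (2 * d)%N; exists c; apply: cdom_decay.
  exact: smooth_ccont.
by move=> x; exact: snorm_fun pcc.
Qed.

Lemma cintegral_pderiv psi j : sschwartz psi -> cintegral (pderiv j psi) = 0.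
Proof.
move=> [sp pc]; have [c pcc] := pc 2%N (2 * d)%N.
have s1 := smooth_pderiv j sp; have s2 := smooth_pderiv j s1.
have p1 := snorm_pderiv j pcc; have p2 := snorm_pderiv j p1.
have [c0 d0] := cdom_decay (smooth_ccont sp) (fun x => snorm_fun x pcc).
have [c1 d1] := cdom_decay (smooth_ccont s1) (fun x => snorm_fun x p1).
have [c2 d2] := cdom_decay (smooth_ccont s2) (fun x => snorm_fun x p2).
rewrite cintegralE; apply: complex_ext => /=.
- apply: (@rint_derive0 _ _ (ref psi) (ref (pderiv j psi)) (ref (pderiv j (pderiv j psi))) j c c0.1 c1.1).
  + by move=> y; have [] := smooth_isd j y sp.
  + by move=> y; have [] := smooth_isd j y s1.
  + by move=> y; apply: le_trans (d0 y); exact: normRe_le.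
  + by move=> y; apply: le_trans (d1 y); exact: normRe_le.
  + by move=> y; apply: le_trans (d2 y); exact: normRe_le.
- apply: (@rint_derive0 _ _ (imf psi) (imf (pderiv j psi)) (imf (pderiv j (pderiv j psi))) j c c0.2 c1.2).
  + by move=> y; have [] := smooth_isd j y sp.
  + by move=> y; have [] := smooth_isd j y s1.
  + by move=> y; apply: le_trans (d0 y); exact: normIm_le.
  + by move=> y; apply: le_trans (d1 y); exact: normIm_le.
  + by move=> y; apply: le_trans (d2 y); exact: normIm_le.
Qed.

Definition fconst : R := (2 * pi) `^ (- (d%:R / 2)).

Lemma fconst_gt0 : 0 < fconst.
Proof. by rewrite powR_gt0// mulr_gt0// pi_gt0. Qed.

Lemma fourierE psi x : fourier psi x = fconst%:C * cintegral (fun y => psi y * expi (- dotv y x)).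
Proof.
by rewrite /fourier; congr (_ * cintegral _); apply/funext => y; rewrite dotvC.
Qed.

(** Makes the Fourier kernel an instance of [gexp], whose growth and derivatives are known. *)
Lemma expi_gexp x y : expi (- dotv y x) = gexp 0 (- x) y.
Proof.
rewrite /gexp oppr0 mul0r mul0r expR0 mulr1; congr expi.
by rewrite dotvC -mulN1r -dotvZl scaleN1r dotvC.
Qed.

Lemma expiD (s t : R) : expi (s + t) = expi s * expi t.
Proof.
apply: complex_ext; rewrite ?CReM ?CImM /=; first by rewrite cosD.
by rewrite sinD; ring.
Qed.

Lemma expi_taylor (t : R) : normc (expi t - 1 - (0 +i* t)) <= 2 * t ^+ 2.
Proof.
have Nsin (s : R) : is_derive s 1 (fun s : R => - sin s) (- cos s).
  exact: (is_deriveN (is_derive_sin s)).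
have hc : `|cos t - 1| <= 1 * t ^+ 2.
  have := @taylor2_line R cos (fun s => - sin s) (fun s => - cos s) t 1
    (fun s => is_derive_cos s) Nsin.
  rewrite cos0 sin0 oppr0 mulr0 subr0; apply=> s _.
  by rewrite normrN ler_norml cos_geN1 cos_le1.
have hs : `|sin t - t| <= 1 * t ^+ 2.
  have := @taylor2_line R sin cos (fun s => - sin s) t 1
    (fun s => is_derive_sin s) (fun s => is_derive_cos s).
  rewrite cos0 sin0 mulr1 subr0; apply=> s _.
  by rewrite normrN ler_norml sin_geN1 sin_le1.
rewrite (le_trans (normc_le_ReIm _))// !(CReD, CImD, CReN, CImN) /=.
by rewrite !subr0 mulrDl lerD// -?(mul1r (t ^+ 2)).
Qed.

Lemma normc_expiB1 (t : R) : normc (expi t - 1) <= 2 * `|t|.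
Proof.
have [c [_]] := mvt0 t (fun s => is_derive_cos s).
have [e [_]] := mvt0 t (fun s => is_derive_sin s).
rewrite sin0 cos0 subr0 => se ce.
rewrite (le_trans (normc_le_ReIm _))// !(CReD, CImD, CReN, CImN) /=.
rewrite ce subr0 se !normrM mulrDl mul1r lerD//; rewrite ler_piMr// ?normrN ler_norml.
  by rewrite sin_geN1 sin_le1.
by rewrite cos_geN1 cos_le1.
Qed.

Lemma moderate_expi x : moderate (fun y => expi (- dotv y x)).
Proof.
by rewrite (_ : (fun _ => _) = gexp 0 (- x)); [exact: moderate_gexp|apply/funext => y; exact: expi_gexp].
Qed.

Lemma cdom_expi psi c x : cdom psi c -> cdom (fun y => psi y * expi (- dotv y x)) c.
Proof.
move=> [cp pc]; split=> [|y]; last by rewrite normcM normc_expi mulr1.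
exact: (ccontM cp (smooth_ccont (moderate_expi x).1)).
Qed.

Lemma fourier_le psi c x : cdom psi c -> normc (fourier psi x) <= fconst * (2 * (c * W)).
Proof.
move=> pc; rewrite fourierE normcM normcR gtr0_norm ?fconst_gt0//.
rewrite ler_wpM2l ?(ltW fconst_gt0)//; apply: normc_cintegral_dom; exact: cdom_expi.
Qed.

Lemma fourierZ psi (k : R[i]) : sschwartz psi ->
  fourier (fun y => k * psi y) = fun x => k * fourier psi x.
Proof.
move=> /sschwartz_cdom[c pc]; apply/funext => x; rewrite !fourierE mulrCA; congr (_ * _).
rewrite -(cintegralZ _ (cdom_expi x pc)); congr cintegral.
by apply/funext => y; rewrite mulrA.
Qed.

Lemma fourierD psi f : sschwartz psi -> sschwartz f ->
  fourier (fun y => psi y + f y) = fun x => fourier psi x + fourier f x.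
Proof.
move=> /sschwartz_cdom[c pc] /sschwartz_cdom[e fe]; apply/funext => x.
rewrite !fourierE -mulrDr; congr (_ * _).
rewrite -(cintegralD (cdom_expi x pc) (cdom_expi x fe)); congr cintegral.
by apply/funext => y; rewrite mulrDl.
Qed.

(** The second-order expansion of the character in the increment [h] leaves a remainder of size
    [2 h^2 y_j^2], integrable against [psi]; the integral thus has a quadratic remainder. *)
Lemma fourier_isd psi j x : sschwartz psi ->
  isd j (fourier psi) x (fourier (fun y => (0 +i* -1) * ((y 0 j)%:C * psi y)) x).
Proof.
move=> sp; have mj := @moderate_coord R d j.
have s1 := sschwartzM mj sp; have s2 := sschwartzM mj s1.
have [c pc] := sschwartz_cdom sp; have [c1 pc1] := sschwartz_cdom s1.
have [c2 pc2] := sschwartz_cdom s2.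
have cq := cdomZ (0 +i* -1) pc1.
set K := fconst * (2 * (2 * c2 * W)).
have key (h : R) : normc (fourier psi (h *: delta_mx 0 j + x) - fourier psi x -
    h%:C * fourier (fun y => (0 +i* -1) * ((y 0 j)%:C * psi y)) x) <= K * h ^+ 2.
  set A := fun y => psi y * expi (- dotv y (h *: delta_mx 0 j + x)).
  set B := fun y => psi y * expi (- dotv y x).
  set D := fun y => (0 +i* -1) * ((y 0 j)%:C * psi y) * expi (- dotv y x).
  have dA : cdom A c := cdom_expi _ pc.
  have dB : cdom B c := cdom_expi _ pc.
  have dD : cdom D _ := cdom_expi _ cq.
  have -> : fourier psi (h *: delta_mx 0 j + x) - fourier psi x -
    h%:C * fourier (fun y => (0 +i* -1) * ((y 0 j)%:C * psi y)) x =
    fconst%:C * cintegral (fun y => A y + (- 1) * B y + (- h%:C) * D y).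
    rewrite (cintegralD (cdomD dA (cdomZ _ dB)) (cdomZ _ dD)).
    rewrite (cintegralD dA (cdomZ _ dB)) !(cintegralZ _ dB) (cintegralZ _ dD) !fourierE -/A -/B -/D.
    ring.
  rewrite normcM normcR gtr0_norm ?fconst_gt0// /K -mulrA.
  rewrite ler_wpM2l ?(ltW fconst_gt0)//.
  rewrite [leRHS](_ : _ = 2 * ((2 * c2 * h ^+ 2) * W)); last by ring.
  apply: normc_cintegral_dom; split.
    exact: (cdomD (cdomD dA (cdomZ _ dB)) (cdomZ _ dD)).1.
  move=> y; set t := - (h * y 0 j).
  have -> : A y + -1 * B y + - h%:C * D y =
      psi y * expi (- dotv y x) * (expi t - 1 - (0 +i* t)).
    rewrite /A /B /D.
    have -> : - dotv y (h *: delta_mx 0 j + x) = - dotv y x + t.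
      by rewrite dotvC dotv_shift opprD dotvC.
    have -> : 0 +i* t = (0 +i* -1) * h%:C * (y 0 j)%:C.
      by apply: complex_ext; rewrite !(CReM, CImM) /= /t; ring.
    rewrite expiD; ring.
  rewrite !normcM normc_expi mulr1.
  apply: (le_trans (ler_wpM2l (normc_ge0 _) (expi_taylor t))).
  have := pc2.2 y; rewrite !normcM !normcR mulrA -expr2 real_normK ?num_real//.
  rewrite /t sqrrN exprMn => e.
  have := ler_wpM2l (_ : 0 <= 2 * h ^+ 2) e; rewrite mulr_ge0 ?sqr_ge0// => /(_ isT).
  by congr (_ <= _); ring.
have re3 (h : R) (u v w : R[i]) : CRe (u - v - h%:C * w) = CRe u - CRe v - h * CRe w.
  by rewrite !(CReD, CReN, CReM) /= mul0r subr0.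
have im3 (h : R) (u v w : R[i]) : CIm (u - v - h%:C * w) = CIm u - CIm v - h * CIm w.
  by rewrite !(CImD, CImN, CImM) /= mul0r addr0.
split; apply: (@is_derive_quad _ _ _ _ _ _ K) => h _; apply: le_trans (key h).
  by rewrite /ref -re3; exact: normRe_le.
by rewrite /imf -im3; exact: normIm_le.
Qed.

Lemma normr_dotv_le x y : `|dotv x y| <= d%:R * (`|x| * `|y|).
Proof.
rewrite (le_trans (ler_norm_sum _ _ _))//.
apply: (@le_trans _ _ (\sum_(j < d) `|x| * `|y|)).
  by apply: ler_sum => j _; rewrite normrM ler_pM// normr_coord_le.
by rewrite sumr_const card_ord mulr_natl.
Qed.

Lemma lipschitz_continuous (V : normedModType R) (f : V -> R) (C : R) :
  (forall u v, `|f u - f v| <= C * `|u - v|) -> continuous f.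
Proof.
move=> fC x; apply/cvgrPdist_le => e e0; near=> z.
have C0 : 0 < `|C| + 1 by rewrite ltr_wpDl.
apply: (le_trans (fC x z)); apply: (@le_trans _ _ ((`|C| + 1) * `|x - z|)).
  by rewrite ler_wpM2r// (le_trans (ler_norm _))// lerDl.
rewrite mulrC -ler_pdivlMr//; near: z; apply: cvgr_dist_le => //.
by rewrite divr_gt0.
Unshelve. all: by end_near. Qed.

(** The transform is even Lipschitz, since characters are Lipschitz with constant proportional to
    [|y|] and [|y| psi] is dominated by the weight. *)
Lemma fourier_ccont psi : sschwartz psi -> ccont (fourier psi).
Proof.
move=> sp.
have [c pc] := sschwartz_cdom sp.
have [c1 pc1] : exists c1, forall y, `|y| * normc (psi y) <= c1 * weight y.
  have [sm /(_ 0%N (2 * d).+1)[c1 hc]] := sp; exists c1 => y.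
  have hd x : (1 + `|x|) ^+ (2 * d) * normc ((`|x|)%:C * psi x) <= c1.
    apply: le_trans (snorm_fun x hc); rewrite normcM normcR normr_id exprSr mulrA.
    by rewrite ler_wpM2r ?normc_ge0// ler_wpM2l ?exprn_ge0 ?addr_ge0// lerDr.
  have [_ /(_ y)] := cdom_decay (ccontM (ccont_real (@norm_continuous R 'rV[R]_d)) (smooth_ccont sm)) hd.
  by rewrite normcM normcR normr_id.
set K := fconst * (2 * (2 * d%:R * c1 * W)).
have key x z : normc (fourier psi x - fourier psi z) <= K * `|x - z|.
  set A := fun y => psi y * expi (- dotv y x).
  set B := fun y => psi y * expi (- dotv y z).
  have dA : cdom A c := cdom_expi _ pc.
  have dB : cdom B c := cdom_expi _ pc.
  have -> : fourier psi x - fourier psi z = fconst%:C * cintegral (fun y => A y + (- 1) * B y).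
    rewrite (cintegralD dA (cdomZ _ dB)) (cintegralZ _ dB) !fourierE -/A -/B; ring.
  rewrite normcM normcR gtr0_norm ?fconst_gt0// /K -mulrA.
  rewrite ler_wpM2l ?(ltW fconst_gt0)//.
  rewrite [leRHS](_ : _ = 2 * ((2 * d%:R * c1 * `|x - z|) * W)); last by ring.
  apply: normc_cintegral_dom; split; first exact: (cdomD dA (cdomZ _ dB)).1.
  move=> y.
  have -> : A y + -1 * B y = psi y * expi (- dotv y z) * (expi (- dotv y (x - z)) - 1).
    rewrite /A /B (_ : - dotv y x = - dotv y z + - dotv y (x - z)).
      by rewrite expiD; ring.
    by rewrite ![dotv y _]dotvC -opprD -dotvDl addrC subrK.
  rewrite !normcM normc_expi mulr1.
  apply: (le_trans (ler_wpM2l (normc_ge0 _) (normc_expiB1 _))); rewrite normrN.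
  have h1 := ler_wpM2l (normc_ge0 (psi y)) (normr_dotv_le y (x - z)).
  have h2 := ler_wpM2l (_ : 0 <= d%:R * `|x - z|) (pc1 y).
  rewrite mulr_ge0// in h2; have {}h2 := h2 isT.
  rewrite mulrCA.
  rewrite [leRHS](_ : _ = 2 * (d%:R * `|x - z| * (c1 * weight y))); last by ring.
  rewrite ler_wpM2l//; apply: (le_trans h1); apply: le_trans h2.
  by rewrite [leLHS](_ : _ = d%:R * `|x - z| * (`|y| * normc (psi y)))//; ring.
split; apply: (@lipschitz_continuous 'rV[R]_d _ K) => x z; apply: le_trans (key x z).
  by have := normRe_le (fourier psi x - fourier psi z); rewrite CReD CReN.
by have := normIm_le (fourier psi x - fourier psi z); rewrite CImD CImN.
Qed.

Lemma sschwartz_coordi j psi : sschwartz psi -> sschwartz (fun y => (0 +i* -1) * ((y 0 j)%:C * psi y)).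
Proof. by move=> sp; exact: (sschwartzZ _ (sschwartzM (@moderate_coord R d j) sp)). Qed.

Lemma pderiv_fourier psi j : sschwartz psi ->
  pderiv j (fourier psi) = fourier (fun y => (0 +i* -1) * ((y 0 j)%:C * psi y)).
Proof. by move=> sp; apply/funext => x; apply: isd_val; exact: fourier_isd. Qed.

Lemma smooth_fourier psi : sschwartz psi -> smooth (fourier psi).
Proof.
move=> sp; apply/smoothP => k; elim: k psi sp => [|k IH] psi sp; first exact: fourier_ccont.
apply: (sm_step (fourier_ccont sp) (fun j x => fourier_isd j x sp)) => j.
by apply: IH; exact: sschwartz_coordi.
Qed.

(** The derivative of [expi (- dotv y x) * psi y] in [y] has integral zero; the product rule
    separates the two terms. *)
Lemma fourier_pderiv psi j : sschwartz psi ->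
  fourier (pderiv j psi) = fun x => (0 +i* x 0 j) * fourier psi x.
Proof.
move=> sp; apply/funext => x.
have me := moderate_expi x.
have sq : sschwartz (fun y => expi (- dotv y x) * psi y) := sschwartzM me sp.
have s1 := sschwartz_pderiv j sp.
have [c pc] := sschwartz_cdom sp; have [c1 pc1] := sschwartz_cdom s1.
have := cintegral_pderiv j sq.
rewrite (pderivM j me.1 sp.1).
have -> : (fun y => pderiv j (fun z => expi (- dotv z x)) y * psi y + expi (- dotv y x) * pderiv j psi y) =
   (fun y => (- (0 +i* x 0 j)) * (psi y * expi (- dotv y x)) + pderiv j psi y * expi (- dotv y x)).
  have -> : pderiv j (fun z => expi (- dotv z x)) = pderiv j (gexp 0 (- x)).
    by congr pderiv; apply/funext => y; exact: expi_gexp.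
  apply/funext => y; rewrite pderiv_gexp -expi_gexp.
  have -> : (0 +i* (- x) 0 j) + (- 0)%:C * (y 0 j)%:C = - (0 +i* x 0 j) :> R[i].
    by apply: complex_ext; rewrite !(CReD, CImD, CReM, CImM, CReN, CImN) /= ?mxE; ring.
  by congr (_ + _); [rewrite -mulrA [psi y * _]mulrC|rewrite mulrC].
have dx := cdom_expi x pc; have dx1 := cdom_expi x pc1.
rewrite (cintegralD (cdomZ _ dx) dx1) (cintegralZ _ dx) mulNr addrC => /eqP.
rewrite subr_eq0 => /eqP e; rewrite !fourierE e; ring.
Qed.

End complex_integral.

(** * Continuity of the Fourier transform on the Schwartz space *)

Section fourier_schwartz.
Context (R : realType) (d : nat).
Implicit Types (f g psi phi : 'rV[R]_d -> R[i]) (x y : 'rV[R]_d) (j : 'I_d).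

Lemma sschwartz_Ds s psi : sschwartz psi -> sschwartz (Ds s psi).
Proof. by move=> sp; elim: s => // j s IH; exact: sschwartz_pderiv. Qed.

Lemma fourier_Ds_nseq psi j N : sschwartz psi ->
  fourier (Ds (nseq N j) psi) = fun x => (0 +i* x 0 j) ^+ N * fourier psi x.
Proof.
move=> sp; elim: N => [|N IH].
  by apply/funext => x; rewrite expr0 mul1r.
rewrite /= -/(Ds _ _) (fourier_pderiv j (sschwartz_Ds _ sp)) IH.
by apply/funext => x; rewrite exprS mulrA.
Qed.

(** Reduces decay of order [N] of a transform to the powers [x_j ^+ N], each produced by [N]
    derivatives in the single direction [j]. *)
Lemma expr_one_add_norm_le x N :
  (1 + `|x|) ^+ N <= 2 ^+ N * (1 + \sum_j `|x 0 j| ^+ N).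
Proof.
have S0 : 0 <= \sum_j `|x 0 j| ^+ N by apply: sumr_ge0 => j _; rewrite exprn_ge0.
have [x1|x1] := leP `|x| 1.
  apply: (@le_trans _ _ (2 ^+ N)); last by rewrite ler_peMr// lerDl.
  by rewrite lerXn2r ?nnegrE ?addr_ge0//; move: x1; lra.
have [j xj] : exists j, `|x| <= `|x 0 j|.
  apply: contrapT => nj.
  have : `|x| < `|x|; last by rewrite ltxx.
  rewrite [ltLHS]mx_normrE; apply: bigmax_lt; first by rewrite (lt_trans _ x1).
  move=> [i j] _ /=; rewrite (ord1 i) ltNge; apply/negP => yj; apply: nj.
  by exists j.
apply: (@le_trans _ _ ((2 * `|x 0 j|) ^+ N)).
  by rewrite lerXn2r ?nnegrE ?addr_ge0 ?mulr_ge0//; lra.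
rewrite exprMn ler_wpM2l//; rewrite (bigD1 j)//= addrCA lerDl addr_ge0//.
by apply: sumr_ge0 => k _; rewrite exprn_ge0.
Qed.

Lemma fourier_snorm0 N : exists2 C : R, 0 <= C & forall psi c, sschwartz psi ->
  snorm_le N (2 * d) psi c -> snorm_le 0 N (fourier psi) (C * c).
Proof.
have F0 := fconst_gt0 R d; have W0 := bigW_ge0 R d.
set K := fconst R d * (2 * bigW R d).
have K0 : 0 <= K by rewrite !mulr_ge0// ltW.
exists (2 ^+ N * (1 + d%:R) * K); first by apply: mulr_ge0 K0; apply: mulr_ge0; rewrite ?addr_ge0 ?exprn_ge0.
move=> psi c sp pc; apply: snorm0 => x; have c0 := snorm_ge0 pc.
have ds j : normc (fourier (Ds (nseq N j) psi) x) <= K * c.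
  rewrite (le_trans (@fourier_le _ _ _ c x _))//; last by rewrite /K; lra.
  apply: cdom_decay; first exact: (smooth_ccont (sschwartz_Ds _ sp).1).
  by move=> y; apply: pc; rewrite size_nseq.
have f0 : normc (fourier psi x) <= K * c.
  rewrite (le_trans (@fourier_le _ _ _ c x _))//; last by rewrite /K; lra.
  apply: cdom_decay; first exact: (smooth_ccont sp.1).
  by move=> y; exact: snorm_fun pc.
apply: (le_trans (ler_wpM2r (normc_ge0 _) (expr_one_add_norm_le x N))).
rewrite -[leLHS]mulrA -(mulrA _ K c) -[leRHS]mulrA ler_wpM2l ?exprn_ge0//.
move: (K * c) ds f0 => Kc ds f0; rewrite mulrDl mul1r mulrDl mul1r lerD//.
rewrite mulr_suml -[X in _ <= X%:R * _](card_ord d) mulr_natl -sumr_const.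
apply: ler_sum => j _; apply: le_trans (ds j).
rewrite (fourier_Ds_nseq j N sp) (normcM (_ ^+ N)) normcX.
by rewrite [normc (0 +i* _)](_ : _ = `|x 0 j|)// normc_ReImE /= expr0n add0r sqrtr_sqr.
Qed.

(** A derivative of the transform is the transform of a coordinate multiple, so each of the [M]
    derivatives asks for one more power of decay of [psi]. The constant does not depend on [psi]. *)
Lemma fourier_snorm M N : exists M' N', exists2 C : R, 0 <= C & forall psi c, sschwartz psi ->
  snorm_le M' N' psi c -> snorm_le M N (fourier psi) (C * c).
Proof.
have [C0 C00 F0] := fourier_snorm0 N.
elim: M => [|M [M1 [N1 [C1 C10 F1]]]]; first by exists N, (2 * d)%N, C0.
exists (maxn N M1), (maxn (2 * d) N1.+1), (C0 + C1 * M1.+1%:R).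
  by rewrite addr_ge0// mulr_ge0.
move=> psi c sp pc; have c0 := snorm_ge0 pc.
apply: snormS => [x|j].
  apply: (@le_trans _ _ (C0 * c)).
    apply: (snorm_fun x (F0 _ _ sp _)); apply: snormW pc => //; exact: leq_maxl.
  by rewrite mulrDl lerDl !mulr_ge0.
rewrite (pderiv_fourier j sp).
apply: (@snormW _ _ M N M N _ (C1 * (1 * (M1.+1%:R * c)))) => //.
  by rewrite mul1r mulrDl mulrA lerDr mulr_ge0.
apply: (F1 _ _ (sschwartz_coordi j sp)).
have n1 : normc (0 +i* -1 : R[i]) = 1.
  by rewrite normc_ReImE /= expr0n sqrrN expr1n add0r sqrtr1.
rewrite -[X in snorm_le _ _ _ (X * _)]n1; apply: (snormZ _ (smoothM (smooth_coord R j) sp.1)).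
apply: (snorm_coord j sp.1).
apply: snormW pc => //; exact: leq_maxr.
Qed.

Lemma sschwartz_fourier psi : sschwartz psi -> sschwartz (fourier psi).
Proof.
move=> sp; split=> [|M N]; first exact: smooth_fourier.
have [M' [N' [C C0 FC]]] := fourier_snorm M N.
by have [c pc] := sp.2 M' N'; exists (C * c); exact: FC.
Qed.

(** The word of a multi-index, in the order in which [mpderiv] applies its derivatives, so that none
    has to be commuted. *)
Definition mseq (m : mpoly.multinom d) : seq 'I_d :=
  flatten [seq nseq (mpoly.fun_of_multinom m j) j | j <- enum 'I_d].

Lemma mpderivE m f : mpderiv m f = Ds (mseq m) f.
Proof.
rewrite /mpderiv /mseq; elim: (enum 'I_d) => //= j s ->.
rewrite Ds_cat; elim: (mpoly.fun_of_multinom m j) => //= n ->.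
by [].
Qed.

Lemma size_mseq m : size (mseq m) = mpoly.mdeg m.
Proof.
rewrite /mseq size_flatten /shape -map_comp mpoly.mdegE sumnE big_map big_enum /=.
by apply: eq_bigr => j _; rewrite size_nseq.
Qed.

Lemma enorm_ge0 x : 0 <= enorm x. Proof. exact: sqrtr_ge0. Qed.

Lemma norm_le_enorm x : `|x| <= enorm x.
Proof.
rewrite -[leLHS]ger0_norm// -[leLHS]sqrtr_sqr ler_wsqrtr//.
exact: normr_sqr_le_sqn.
Qed.

Lemma enorm_le x : 1 + enorm x <= (1 + d%:R) * (1 + `|x|).
Proof.
have h : enorm x <= d%:R * `|x|.
  rewrite -[leRHS]ger0_norm ?mulr_ge0// -sqrtr_sqr /enorm ler_wsqrtr//.
  apply: (@le_trans _ _ (\sum_(j < d) `|x| ^+ 2)).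
    apply: ler_sum => j _; rewrite -[leLHS]real_normK ?num_real//.
    by rewrite lerXn2r ?nnegrE// normr_coord_le.
  rewrite sumr_const card_ord exprMn -[`|x| ^+ 2 *+ d]mulr_natl ler_wpM2r ?sqr_ge0//.
  by rewrite -natrX ler_nat; case: (d) => // n; rewrite expnS leq_pmulr// expn_gt0.
rewrite mulrDl mul1r mulrDr mulr1; have : (0 : R) <= d%:R by []. 
have : 0 <= `|x| by []. 
by move: h; set u := enorm x; set v := `|x|; set w := d%:R * v; lra.
Qed.

Lemma schwartz_norm_le N phi c : snorm_le N N phi c ->
  (schwartz_norm N phi <= ((1 + d%:R) ^+ N * c)%:E)%E.
Proof.
move=> pc; apply: ub_ereal_sup => _ [[m x] /= mN <-]; rewrite lee_fin mpderivE.
apply: (@le_trans _ _ ((1 + d%:R) ^+ N * ((1 + `|x|) ^+ N * normc (Ds (mseq m) phi x)))).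
  rewrite mulrA -exprMn ler_wpM2r ?normc_ge0//.
  rewrite lerXn2r ?nnegrE ?mulr_ge0 ?addr_ge0 ?enorm_ge0//; exact: enorm_le.
rewrite ler_wpM2l ?exprn_ge0 ?addr_ge0//; apply: pc; by rewrite size_mseq.
Qed.

Lemma schwartz_norm_ge0 N phi : (0 <= schwartz_norm N phi)%E.
Proof.
have h : (((1 + enorm (0 : 'rV[R]_d)) ^+ N * normc (mpderiv (@mpoly.mnm0 d) phi 0))%:E <= schwartz_norm N phi)%E.
  by apply: ereal_sup_ubound; exists (@mpoly.mnm0 d, 0) => //=; rewrite mpoly.mdeg0.
apply: le_trans h; rewrite lee_fin mulr_ge0 ?normc_ge0// exprn_ge0// addr_ge0//.
exact: enorm_ge0.
Qed.

Lemma sschwartz_schwartz phi : sschwartz phi -> schwartz phi.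
Proof.
move=> [sp pc]; split=> // N; have [c pcc] := pc N N.
exact: le_lt_trans (schwartz_norm_le pcc) (ltry _).
Qed.

End fourier_schwartz.

(** * Tempered distributions and differential operators *)

Section distributions_lemmas.
Context (R : realType) (d : nat).
Implicit Types (f g psi phi : 'rV[R]_d -> R[i]) (x y : 'rV[R]_d) (j : 'I_d).
Variable T : ('rV[R]_d -> R[i]) -> R[i].
Hypothesis tT : tempered T.

Lemma tempered_bound : exists N, exists2 C : R, 0 <= C &
  forall phi c, sschwartz phi -> snorm_le N N phi c -> normc (T phi) <= C * c.
Proof.
(* [C] carries no sign in [tempered], hence the absolute value; the power of [1 + d] is the cost of
   comparing the Euclidean norm with the sup norm. *)
have [_ [N [C TC]]] := tT; exists N, (`|C| * (1 + d%:R) ^+ N).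
  by rewrite mulr_ge0// exprn_ge0// addr_ge0.
move=> phi c sp pc; rewrite -lee_fin.
apply: (le_trans (TC _ (sschwartz_schwartz sp))).
apply: (@le_trans _ _ (`|C|%:E * schwartz_norm N phi)%E).
  by rewrite lee_wpmul2r ?schwartz_norm_ge0// lee_fin ler_norm.
rewrite -mulrA EFinM lee_wpmul2l ?lee_fin//; exact: schwartz_norm_le.
Qed.

Lemma temperedZD (a : R[i]) phi psi : sschwartz phi -> sschwartz psi ->
  T (fun x => a * phi x + psi x) = a * T phi + T psi.
Proof. by move=> sp sq; apply: tT.1; exact: sschwartz_schwartz. Qed.

Lemma sschwartz0 : sschwartz (fun _ : 'rV[R]_d => 0).
Proof.
split; first exact: smooth_cst.
move=> M N; exists 0 => s _ x.
have -> : Ds s (fun _ : 'rV[R]_d => 0) x = 0 by rewrite Ds_cst; case: s.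
by rewrite normc0 mulr0.
Qed.

Lemma tempered0 : T (fun=> 0) = 0.
Proof.
have := temperedZD 1 sschwartz0 sschwartz0.
rewrite (_ : (fun _ => _) = fun=> 0); last by apply/funext => x; rewrite mulr0 addr0.
by rewrite mul1r => /eqP; rewrite -subr_eq subrr eq_sym => /eqP.
Qed.

Lemma temperedD phi psi : sschwartz phi -> sschwartz psi ->
  T (fun x => phi x + psi x) = T phi + T psi.
Proof.
move=> sp sq; rewrite -[T phi]mul1r -temperedZD//; congr T.
by apply/funext => x; rewrite mul1r.
Qed.

Lemma fourier_dist_bound : exists M' N', exists2 C : R, 0 <= C &
  forall phi c, sschwartz phi -> snorm_le M' N' phi c -> normc (T (fourier phi)) <= C * c.
Proof.
have [N [C C0 TC]] := tempered_bound.
have [M' [N' [D D0 FD]]] := @fourier_snorm R d N N.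
exists M', N', (C * D); first by rewrite mulr_ge0.
move=> phi c sp pc; rewrite -mulrA; apply: TC; first exact: sschwartz_fourier.
exact: FD.
Qed.

Lemma fourier_distD phi psi : sschwartz phi -> sschwartz psi ->
  T (fourier (fun x => phi x + psi x)) = T (fourier phi) + T (fourier psi).
Proof.
move=> sp sq; rewrite fourierD// temperedD//; exact: sschwartz_fourier.
Qed.

End distributions_lemmas.

(** * Constant coefficient operators, transposes and symbols *)

Section operators.
Context (R : realType) (d : nat).
Implicit Types (f g psi phi : 'rV[R]_d -> R[i]) (x y : 'rV[R]_d) (j : 'I_d).
Implicit Types (L : seq (R[i] * seq 'I_d)) (A : set 'rV[R]_d).

(* A differential operator is a list of coefficients with words of derivatives;
   [lop_adj] is its formal transpose and [symb] its symbol at [i y]. *)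
Definition lop L f x : R[i] := \sum_(p <- L) p.1 * Ds p.2 f x.

Definition lop_adj L : seq (R[i] * seq 'I_d) :=
  [seq ((-1) ^+ size p.2 * p.1, rev p.2) | p <- L].

Definition symb L y : R[i] := \sum_(p <- L) p.1 * \prod_(j <- p.2) (0 +i* y 0 j).

Definition lop_of_poly (P : mpoly.mpoly d R[i]) : seq (R[i] * seq 'I_d) :=
  [seq (mpoly.mcoeff m P, mseq m) | m <- mpoly.msupp P].

Lemma pdiffopE P f : pdiffop P f = lop (lop_of_poly P) f.
Proof.
apply/funext => x; rewrite /pdiffop /lop [RHS]big_map.
apply: eq_bigr => m _; by rewrite mpderivE.
Qed.

Lemma pevaliE P y : pevali P y = symb (lop_of_poly P) y.
Proof.
rewrite /pevali /symb [RHS]big_map mpoly.mevalE; apply: eq_bigr => m _; congr (_ * _) => /=.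
rewrite /mseq big_flatten big_map big_enum /=; apply: eq_bigr => j _.
by rewrite big_nseq; elim: (mpoly.fun_of_multinom m j) => //= n <-; rewrite exprS.
Qed.

Lemma lop_cons p L f : lop (p :: L) f = fun x => p.1 * Ds p.2 f x + lop L f x.
Proof. by apply/funext => x; rewrite /lop big_cons. Qed.

Lemma lop_nil f : lop [::] f = fun=> 0.
Proof. by apply/funext => x; rewrite /lop big_nil. Qed.

Lemma smooth_lop L f : smooth f -> smooth (lop L f).
Proof.
by move=> sf; apply: smooth_sum => p; exact: (smoothZ _ (smooth_Ds p.2 sf)).
Qed.

Lemma csupp_lop L A f : closed A -> csupp A f -> csupp A (lop L f).
Proof.
move=> cA fA; split; first exact: smooth_lop fA.1.
by move=> x nA; apply: big1 => p _; rewrite (csupp_Ds p.2 cA fA).2 ?mulr0.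
Qed.

Lemma sschwartz_lop L f : sschwartz f -> sschwartz (lop L f).
Proof.
move=> sf; elim: L => [|p L IH]; first by rewrite lop_nil; exact: sschwartz0.
rewrite lop_cons; exact: (sschwartzD (sschwartzZ _ (sschwartz_Ds p.2 sf)) IH).
Qed.

Lemma lopD L f g : smooth f -> smooth g ->
  lop L (fun x => f x + g x) = fun x => lop L f x + lop L g x.
Proof.
move=> sf sg; apply/funext => x; rewrite /lop -big_split /=; apply: eq_bigr => p _.
by rewrite (DsD p.2 sf sg) mulrDr.
Qed.

Lemma smooth_iter_lop L n f : smooth f -> smooth (iter n (lop L) f).
Proof. by move=> sf; elim: n => // n IH; exact: (smooth_lop _ IH). Qed.

Lemma sschwartz_iter_lop L n f : sschwartz f -> sschwartz (iter n (lop L) f).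
Proof. by move=> sf; elim: n => // n IH; exact: (sschwartz_lop _ IH). Qed.

Lemma csupp_iter_lop L n A f : closed A -> csupp A f -> csupp A (iter n (lop L) f).
Proof. by move=> cA sf; elim: n => // n IH; exact: (csupp_lop _ cA IH). Qed.

Lemma iter_lopD L n f g : smooth f -> smooth g ->
  iter n (lop L) (fun x => f x + g x) = fun x => iter n (lop L) f x + iter n (lop L) g x.
Proof.
move=> sf sg; elim: n => // n IH; rewrite !iterS IH.
by rewrite (lopD L (smooth_iter_lop L n sf) (smooth_iter_lop L n sg)).
Qed.

Lemma snorm_Ds M N s f c : snorm_le (M + size s) N f c -> snorm_le M N (Ds s f) c.
Proof.
move=> fc t tM x; rewrite -Ds_cat; apply: fc.
by rewrite size_cat leq_add2r.
Qed.

Lemma snorm_zero M N : snorm_le M N (fun _ : 'rV[R]_d => 0) 0.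
Proof.
move=> s _ x.
have -> : Ds s (fun _ : 'rV[R]_d => 0) x = 0 by rewrite Ds_cst; case: s.
by rewrite normc0 mulr0.
Qed.

Lemma snorm_lop L : exists K, exists2 C : R, 0 <= C & forall M N f c, smooth f ->
  snorm_le (M + K) N f c -> snorm_le M N (lop L f) (C * c).
Proof.
elim: L => [|p L [K [C C0 LC]]].
  by exists 0%N, 0 => // M N f c _ _; rewrite lop_nil mul0r; exact: snorm_zero.
exists (size p.2 + K)%N, (normc p.1 + C); first by rewrite addr_ge0 ?normc_ge0.
move=> M N f c sf fc; rewrite lop_cons mulrDl.
apply: (snormD (smoothZ _ (smooth_Ds p.2 sf)) (smooth_lop L sf)).
  apply: (snormZ _ (smooth_Ds p.2 sf)); apply: snorm_Ds.
  by apply: snormW fc => //; rewrite leq_add2l leq_addr.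
apply: LC => //; apply: snormW fc => //; by rewrite leq_add2l leq_addl.
Qed.

(** [K] and [C] depend on [n] without control: this gives continuity only, for passing to limits at
    fixed [n]. *)
Lemma snorm_iter_lop L n : exists K, exists2 C : R, 0 <= C & forall M N f c, smooth f ->
  snorm_le (M + K) N f c -> snorm_le M N (iter n (lop L) f) (C * c).
Proof.
have [K [C C0 LC]] := snorm_lop L.
elim: n => [|n [K1 [C1 C10 IH]]].
  by exists 0%N, 1 => // M N f c _; rewrite addn0 mul1r.
exists (K + K1)%N, (C * C1); first by rewrite mulr_ge0.
move=> M N f c sf fc; rewrite iterS -mulrA; apply: LC; first exact: smooth_iter_lop.
by apply: IH => //; rewrite -addnA.
Qed.

Lemma Ds_fourier s psi : sschwartz psi -> Ds s (fourier psi) =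
  fourier (fun y => \prod_(j <- s) (0 +i* (- y 0 j)) * psi y).
Proof.
move=> sp; have mP (t : seq 'I_d) : moderate (fun y : 'rV[R]_d => \prod_(j <- t) (0 +i* (- y 0 j))).
  apply: moderate_prod => j.
  have -> : (fun y : 'rV[R]_d => 0 +i* (- y 0 j)) = fun y => (0 +i* -1) * (y 0 j)%:C.
    by apply/funext => y; apply: complex_ext; rewrite ?CReM ?CImM /=; ring.
  exact: (moderateZ _ (@moderate_coord R d j)).
elim: s => [|j s IH].
  by congr fourier; apply/funext => y; rewrite big_nil mul1r.
rewrite /= -/(Ds s _) IH (pderiv_fourier j (sschwartzM (mP s) sp)); congr fourier.
apply/funext => y; rewrite big_cons !mulrA; congr (_ * _ * _).
by apply: complex_ext; rewrite ?CReM ?CImM /=; ring.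
Qed.

Lemma moderate_symb L : moderate (symb L).
Proof.
apply: moderate_sum => p; apply: moderateZ; apply: moderate_prod => j.
have -> : (fun y : 'rV[R]_d => 0 +i* (y 0 j)) = fun y => (0 +i* 1) * (y 0 j)%:C.
  by apply/funext => y; apply: complex_ext; rewrite ?CReM ?CImM /=; ring.
exact: (moderateZ _ (@moderate_coord R d j)).
Qed.

Lemma symb_cons p L : symb (p :: L) = fun y => p.1 * \prod_(j <- p.2) (0 +i* y 0 j) + symb L y.
Proof. by apply/funext => y; rewrite /symb big_cons. Qed.

Lemma fourier0 : fourier (fun _ : 'rV[R]_d => 0) = fun=> 0.
Proof.
have := fourierZ 0 (@sschwartz0 R d); under eq_fun do rewrite mul0r.
by move=> ->; apply/funext => x; rewrite mul0r.
Qed.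

(** A derivative of a transform brings down [- i y_j]; over a word these signs cancel the sign in
    the transpose, so that the transpose acts on transforms exactly as multiplication by the
    symbol. *)
Lemma lop_fourier L psi : sschwartz psi ->
  lop (lop_adj L) (fourier psi) = fourier (fun y => symb L y * psi y).
Proof.
move=> sp; elim: L => [|p L IH].
  rewrite lop_nil -fourier0; congr fourier; apply/funext => y.
  by rewrite /symb big_nil mul0r.
have s1 : sschwartz (fun y => p.1 * \prod_(j <- p.2) (0 +i* y 0 j) * psi y).
  have := sschwartzM (moderate_symb [:: p]) sp.
  by rewrite symb_cons; under eq_fun do rewrite /symb big_nil addr0.
have -> : (fun y => symb (p :: L) y * psi y) =
    (fun y => p.1 * \prod_(j <- p.2) (0 +i* y 0 j) * psi y + symb L y * psi y).
  by apply/funext => y; rewrite symb_cons mulrDl.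
rewrite (fourierD s1 (sschwartzM (moderate_symb L) sp)) [lop_adj _]/= lop_cons IH.
apply/funext => x; congr (_ + _); rewrite (Ds_fourier _ sp) /=.
have [c pc] := sschwartz_cdom sp.
have s2 : sschwartz (fun y => \prod_(j <- rev p.2) (0 +i* (- y 0 j)) * psi y).
  apply: sschwartzM sp; apply: moderate_prod => j.
  have -> : (fun y : 'rV[R]_d => 0 +i* (- y 0 j)) = fun y => (0 +i* -1) * (y 0 j)%:C.
    by apply/funext => y; apply: complex_ext; rewrite ?CReM ?CImM /=; ring.
  exact: (moderateZ _ (@moderate_coord R d j)).
have := fourierZ ((-1) ^+ size p.2 * p.1) s2 => /(congr1 (fun h => h x)) <-.
congr (fourier _ x); apply/funext => y; rewrite mulrA; congr (_ * _).
rewrite mulrAC mulrC; congr (_ * _).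
rewrite (perm_big p.2) /=; last by rewrite perm_rev.
elim: (p.2) => [|j s {}IH]; first by rewrite !big_nil mulr1.
rewrite !big_cons /= exprS -IH.
have -> : 0 +i* y 0 j = (-1) * (0 +i* (- y 0 j)) :> R[i].
  by apply: complex_ext; rewrite ?CReM ?CImM /=; ring.
ring.
Qed.

Lemma iter_lop_fourier L n psi : sschwartz psi ->
  iter n (lop (lop_adj L)) (fourier psi) = fourier (fun y => symb L y ^+ n * psi y).
Proof.
move=> sp; elim: n => [|n IH].
  by congr fourier; apply/funext => y; rewrite expr0 mul1r.
rewrite iterS IH (lop_fourier _ (sschwartzM (moderateX n (moderate_symb L)) sp)).
by congr fourier; apply/funext => y; rewrite exprS mulrA.
Qed.

Lemma csupp_cdom A g : compact A -> csupp A g -> exists c, cdom g c.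
Proof. by move=> cA gA; apply: sschwartz_cdom; exact: csupp_sschwartz gA. Qed.

Lemma cintegral_byparts1 A j g phi : compact A -> smooth g -> csupp A phi ->
  cintegral (fun x => pderiv j g x * phi x) = - cintegral (fun x => g x * pderiv j phi x).
Proof.
move=> cA sg pA; have clA := rV_compact_closed cA.
have := cintegral_pderiv j (csupp_sschwartz cA (csuppM sg pA)).
rewrite (pderivM j sg pA.1).
have [c1 h1] := csupp_cdom cA (csuppM (smooth_pderiv j sg) pA).
have [c2 h2] := csupp_cdom cA (csuppM sg (csupp_pderiv j clA pA)).
by rewrite (cintegralD h1 h2) => /eqP; rewrite addr_eq0 => /eqP.
Qed.

(** Moving the letters over one at a time reverses the word, whence the [rev] in [lop_adj]. *)
Lemma cintegral_byparts A s g phi : compact A -> smooth g -> csupp A phi ->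
  cintegral (fun x => Ds s g x * phi x) =
  (-1) ^+ size s * cintegral (fun x => g x * Ds (rev s) phi x).
Proof.
move=> cA sg; have clA := rV_compact_closed cA.
elim: s phi => [|j s IH] phi pA; first by rewrite expr0 mul1r.
rewrite /= -/(Ds s g) (cintegral_byparts1 j cA (smooth_Ds s sg) pA).
by rewrite (IH _ (csupp_pderiv j clA pA)) rev_cons Ds_rcons exprS mulN1r mulNr.
Qed.

Lemma cintegral_lop A L g phi : compact A -> smooth g -> csupp A phi ->
  cintegral (fun x => lop L g x * phi x) = cintegral (fun x => g x * lop (lop_adj L) phi x).
Proof.
move=> cA sg pA; have clA := rV_compact_closed cA.
elim: L => [|p L IH].
  by congr cintegral; apply/funext => x; rewrite /= !lop_nil mul0r mulr0.
rewrite [lop_adj _]/= !lop_cons.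
have -> : (fun x => (p.1 * Ds p.2 g x + lop L g x) * phi x) =
    (fun x => p.1 * (Ds p.2 g x * phi x) + lop L g x * phi x).
  by apply/funext => x; ring.
have -> : (fun x => g x * (((-1) ^+ size p.2 * p.1, rev p.2).1 *
     Ds ((-1) ^+ size p.2 * p.1, rev p.2).2 phi x + lop (lop_adj L) phi x)) =
    (fun x => ((-1) ^+ size p.2 * p.1) * (g x * Ds (rev p.2) phi x) + g x * lop (lop_adj L) phi x).
  by apply/funext => x /=; ring.
have [c1 h1] := csupp_cdom cA (csuppM (smooth_Ds p.2 sg) pA).
have [c2 h2] := csupp_cdom cA (csuppM (smooth_lop L sg) pA).
have [c3 h3] := csupp_cdom cA (csuppM sg (csupp_Ds (rev p.2) clA pA)).
have [c4 h4] := csupp_cdom cA (csuppM sg (csupp_lop (lop_adj L) clA pA)).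
rewrite (cintegralD (cdomZ _ h1) h2) (cintegralD (cdomZ _ h3) h4) IH; congr (_ + _).
rewrite (cintegralZ _ h1) (cintegralZ _ h3) (cintegral_byparts _ cA sg pA); ring.
Qed.

Lemma cintegral_iter_lop A L n g phi : compact A -> smooth g -> csupp A phi ->
  cintegral (fun x => iter n (lop L) g x * phi x) =
  cintegral (fun x => g x * iter n (lop (lop_adj L)) phi x).
Proof.
move=> cA sg; have clA := rV_compact_closed cA.
elim: n phi => // n IH phi pA.
rewrite iterS (cintegral_lop L cA (smooth_iter_lop L n sg) pA).
by rewrite (IH _ (csupp_lop _ clA pA)) iterSr.
Qed.

End operators.

(** * Dilated cutoffs and passage from test functions to Schwartz functions *)

Section dilated_cutoffs.
Context (R : realType) (d : nat).
Implicit Types (f g psi phi eta : 'rV[R]_d -> R[i]) (x y : 'rV[R]_d) (j : 'I_d).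
Implicit Types (A : set 'rV[R]_d).

Lemma isd_dilate j f (t : R) x a : isd j f (t *: x) a ->
  isd j (fun y => f (t *: y)) x (t%:C * a).
Proof.
have key (u : 'rV[R]_d -> R) (b : R) : is_derive (t *: x) (delta_mx 0 j : 'rV[R]_d) u b ->
    is_derive x (delta_mx 0 j : 'rV[R]_d) (fun y => u (t *: y)) (t * b).
  move=> /is_derive_slice0 ub; apply/is_derive_slice0.
  have -> : (fun h : R => u (t *: (h *: delta_mx 0 j + x))) =
      (fun h : R => u (h *: delta_mx 0 j + t *: x)) \o (fun h => t * h).
    by apply/funext => h /=; rewrite scalerDr scalerA.
  rewrite mulrC; apply: is_derive1_comp; first by rewrite mulr0.
  have := is_deriveZ t (is_derive_id (0 : R) 1); by rewrite [_ *: 1]mulr1.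
move=> [fa fb]; split; rewrite ?CReM ?CImM /= ?mul0r ?subr0 ?addr0; exact: key.
Qed.

Lemma continuous_dilate (u : 'rV[R]_d -> R) (t : R) : continuous u -> continuous (fun y => u (t *: y)).
Proof.
move=> cu y; apply: (@continuous_comp _ _ _ (fun y => t *: y) u); last exact: cu.
exact: (@scaler_continuous _ 'rV[R]_d).
Qed.

Lemma smooth_dilate f (t : R) : smooth f -> smooth (fun y => f (t *: y)).
Proof.
move=> sf; apply/smoothP => k; elim: k f sf => [|k IH] f sf.
  have [c1 c2] := smooth_ccont sf; split; [exact: continuous_dilate c1|exact: continuous_dilate c2].
apply: (@sm_step _ _ _ _ (fun j x => t%:C * pderiv j f (t *: x))).
- have [c1 c2] := smooth_ccont sf; split; [exact: continuous_dilate c1|exact: continuous_dilate c2].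
- by move=> j x; apply: isd_dilate; exact: smooth_isd.
- by move=> j; apply: (smM (sm_cst _ _ _)); apply: IH; exact: smooth_pderiv.
Qed.

Lemma pderiv_dilate f (t : R) j : smooth f ->
  pderiv j (fun y => f (t *: y)) = fun y => t%:C * pderiv j f (t *: y).
Proof.
by move=> sf; apply/funext => x; apply: isd_val; apply: isd_dilate; exact: smooth_isd.
Qed.

Definition bdd_derivs f := smooth f /\ forall s, exists C : R, forall x, normc (Ds s f x) <= C.

Lemma bdd_derivs_pderiv f j : bdd_derivs f -> bdd_derivs (pderiv j f).
Proof.
move=> [sf fb]; split=> [|s]; first exact: smooth_pderiv.
by have [C fC] := fb (rcons s j); exists C => x; rewrite -Ds_rcons.
Qed.

Lemma pderiv_eq0_open f j (U : set 'rV[R]_d) : open U -> (forall x, U x -> f x = 0) ->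
  forall x, U x -> pderiv j f x = 0.
Proof.
move=> oU f0 x Ux; apply: isd_val; apply: (isd_near _ (isd_cst j 0 x)).
have : nbhs x U by apply: open_nbhs_nbhs.
by apply: filterS => y Uy; rewrite f0.
Qed.

(** The dilated [eta] lives where [|x| >= k + 1], and there one extra power of the decay of [psi] is
    worth [1 / (k + 1)]. Derivatives falling on [eta] only bring further factors [1 / (k + 1)]. *)
Lemma snorm_dilated M N eta psi : bdd_derivs eta -> (forall x, `|x| < 1 -> eta x = 0) ->
  sschwartz psi -> exists2 C : R, 0 <= C & forall k : nat,
    snorm_le M N (fun x => eta (k.+1%:R^-1 *: x) * psi x) (C / k.+1%:R).
Proof.
elim: M eta psi => [|M IH] eta psi be e0 sp.
  have [Ce eC] := be.2 [::]; have [c pc] := sp.2 0%N N.+1.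
  have Ce0 : 0 <= Ce by apply: le_trans (eC 0); exact: normc_ge0.
  have c0 := snorm_ge0 pc.
  exists (Ce * c); first by rewrite mulr_ge0.
  move=> k; apply: snorm0 => x; rewrite normcM.
  have k0 : (0 : R) < k.+1%:R by rewrite ltr0n.
  have [x1|x1] := ltP `|k.+1%:R^-1 *: x| 1.
    by rewrite e0// normc0 mul0r mulr0 divr_ge0// mulr_ge0.
  have kx : k.+1%:R <= `|x|.
    by move: x1; rewrite normrZ gtr0_norm ?invr_gt0// ler_pdivlMl// mulr1.
  rewrite ler_pdivlMr//.
  have h1 := eC (k.+1%:R^-1 *: x); rewrite /= in h1.
  have h2 := snorm_fun x pc.
  have x0 : 0 <= 1 + `|x| by rewrite addr_ge0.
  apply: (@le_trans _ _ (Ce * ((1 + `|x|) ^+ N * normc (psi x) * (1 + `|x|)))).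
    rewrite [leLHS](_ : _ = normc (eta (k.+1%:R^-1 *: x)) *
        ((1 + `|x|) ^+ N * normc (psi x) * k.+1%:R)); last by ring.
    have p0 : 0 <= (1 + `|x|) ^+ N * normc (psi x) by rewrite mulr_ge0 ?exprn_ge0 ?normc_ge0.
    apply: ler_pM; [exact: normc_ge0|exact: mulr_ge0|exact: h1|].
    by apply: ler_wpM2l => //; apply: (le_trans kx); rewrite lerDr.
  by rewrite ler_wpM2l// mulrAC -exprSr.
have /choice[C1 C1P] : forall j, exists C : R, 0 <= C /\ forall k : nat,
    snorm_le M N (fun x => eta (k.+1%:R^-1 *: x) * pderiv j psi x) (C / k.+1%:R).
  by move=> j; have [C] := IH eta (pderiv j psi) be e0 (sschwartz_pderiv j sp); exists C.
have /choice[C2 C2P] : forall j, exists C : R, 0 <= C /\ forall k : nat,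
    snorm_le M N (fun x => pderiv j eta (k.+1%:R^-1 *: x) * psi x) (C / k.+1%:R).
  move=> j; have [||C] := IH (pderiv j eta) psi _ _ sp.
  - exact: bdd_derivs_pderiv.
  - move=> x x1; apply: (@pderiv_eq0_open eta j [set x | `|x| < 1]) => //.
    have := @open_obox R d 0 1; congr open; apply/seteqP.
    by split=> y /=; rewrite subr0.
  - by exists C.
have [C0 C00 C0P] : exists2 C : R, 0 <= C & forall k : nat,
    snorm_le 0 N (fun x => eta (k.+1%:R^-1 *: x) * psi x) (C / k.+1%:R).
  have [C C0 CP] := IH eta psi be e0 sp; exists C => // k.
  exact: snormW (CP k).
exists (C0 + \sum_j (C1 j + C2 j)).
  by rewrite addr_ge0// sumr_ge0// => j _; rewrite addr_ge0//; [have [] := C1P j|have [] := C2P j].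
move=> k; have k0 : (0 : R) < k.+1%:R by rewrite ltr0n.
have ik : (0 : R) <= k.+1%:R^-1 by rewrite invr_ge0 ltW.
have S0 : 0 <= \sum_j (C1 j + C2 j).
  by rewrite sumr_ge0// => j _; rewrite addr_ge0//; [have [] := C1P j|have [] := C2P j].
have se := be.1; have sp1 := sp.1.
have sek := smooth_dilate k.+1%:R^-1 se.
apply: snormS => [x|j].
  apply: (le_trans (snorm_fun x (C0P k))).
  by rewrite ler_wpM2r// lerDl.
have [C10 C1k] := C1P j; have [C20 C2k] := C2P j.
apply: (@snormW _ _ M N M N _ (normc (k.+1%:R^-1%:C : R[i]) * (C2 j / k.+1%:R) + C1 j / k.+1%:R)) => //.
  apply: (@le_trans _ _ (C2 j / k.+1%:R + C1 j / k.+1%:R)).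
    rewrite lerD2r normcR ger0_norm//.
    by rewrite ler_piMl ?mulr_ge0// invf_le1// ler1n.
  rewrite -mulrDl ler_wpM2r// (bigD1 j)//= addrCA [C2 j + _]addrC lerDl.
  rewrite addr_ge0// sumr_ge0// => i _; rewrite addr_ge0//; [by have [] := C1P i|by have [] := C2P i].
rewrite (pderivM j sek sp1) (pderiv_dilate _ _ se).
have sde := smooth_dilate k.+1%:R^-1 (smooth_pderiv j se).
have -> : (fun y => k.+1%:R^-1%:C * pderiv j eta (k.+1%:R^-1 *: y) * psi y + eta (k.+1%:R^-1 *: y) * pderiv j psi y) =
   (fun y => k.+1%:R^-1%:C * (pderiv j eta (k.+1%:R^-1 *: y) * psi y) + eta (k.+1%:R^-1 *: y) * pderiv j psi y).
  by apply/funext => y; rewrite mulrA.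
apply: (snormD (smoothZ _ (smoothM sde sp1)) (smoothM sek (smooth_pderiv j sp1))).
  exact: (snormZ _ (smoothM sde sp1) (C2k k)).
exact: C1k.
Qed.

Definition cutoff (k : nat) x : R[i] := (box_bump 0 1 (k.+1%:R^-1 *: x))%:C.

Lemma csupp_cutoff k : csupp (box 0 (2 * k.+1%:R)) (cutoff k).
Proof.
have k0 : (0 : R) < k.+1%:R by rewrite ltr0n.
split; first exact: (smooth_dilate k.+1%:R^-1 (smooth_bump (0 : 'rV[R]_d) 1)).
move=> x /negP; rewrite subr0 -ltNge => xk; rewrite /cutoff bump_eq0//.
by rewrite subr0 normrZ gtr0_norm ?invr_gt0// ltr_pdivlMl// mulr1 mulrC.
Qed.

Lemma normc_cutoff_le1 k x : normc (cutoff k x) <= 1.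
Proof. by rewrite normcR ger0_norm ?bump_ge0// bump_le1. Qed.

Lemma cutoff_approx M N psi : sschwartz psi -> exists2 C : R, 0 <= C & forall k,
  snorm_le M N (fun x => (1 + (-1) * cutoff k x) * psi x) (C / k.+1%:R).
Proof.
move=> sp; apply: (@snorm_dilated M N (fun x => 1 + (-1) * (box_bump 0 1 x)%:C)) => //.
- have sb := csupp_bump (0 : 'rV[R]_d) (@ltr01 R).
  have ss := csupp_sschwartz (@compact_box R d 0 _) sb.
  split; first exact: (smoothD (smooth_cst _) (smoothZ _ sb.1)).
  move=> s; have [c bc] := ss.2 (size s) 0%N.
  exists (1 + c) => x; rewrite (DsD s (smooth_cst 1) (smoothZ (-1) sb.1)) (DsZ s _ sb.1).
  apply: (le_trans (normcD _ _)); apply: lerD.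
    rewrite Ds_cst; case: s {bc} => [|? ?]; rewrite ?normc0//.
    by rewrite normc1.
  by have := bc s (leqnn _) x; rewrite expr0 mul1r mulN1r normcN.
- move=> x x1; rewrite bump_eq1// ?subr0 ?ltW//.
  by rewrite mulN1r subrr.
Qed.

Lemma le_archimedean_limit (r b C : R) : (forall k : nat, r <= b + C / k.+1%:R) -> r <= b.
Proof.
move=> rk; rewrite leNgt; apply/negP => br.
have C0 : 0 < C.
  by have := rk 0%N; rewrite divr1 => h; move: br h; lra.
have rb : 0 < (r - b) / C by rewrite divr_gt0// subr_gt0.
have [k _ /(_ k (leqnn k))] := near_infty_natSinv_lt (PosNum rb).
rewrite /= ltr_pdivlMr// => kr; have := rk k; rewrite mulrC.
move: kr; set u := _ * C; lra.
Qed.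

(* Test functions are dense in the Schwartz space. *)
Lemma seminorm_cutoff_limit (G : ('rV[R]_d -> R[i]) -> R[i]) M N (D b : R) psi :
  (forall f g, sschwartz f -> sschwartz g -> G (fun x => f x + g x) = G f + G g) ->
  0 <= D -> (forall f c, sschwartz f -> snorm_le M N f c -> normc (G f) <= D * c) ->
  sschwartz psi -> (forall k, normc (G (fun x => cutoff k x * psi x)) <= b) ->
  normc (G psi) <= b.
Proof.
move=> GD D0 GDc sp Gb; have [C C0 CP] := cutoff_approx M N sp.
apply: (@le_archimedean_limit _ _ (D * C)) => k.
have ck := csupp_cutoff k.
have s1 : sschwartz (fun x => cutoff k x * psi x).
  exact: (csupp_sschwartz (@compact_box R d 0 (2 * k.+1%:R)) (csuppMr sp.1 ck)).
have s2 : sschwartz (fun x => (1 + (-1) * cutoff k x) * psi x).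
  split; last first.
    move=> M' N'; have [C' _ CP'] := cutoff_approx M' N' sp.
    by exists (C' / k.+1%:R); exact: CP'.
  exact: (smoothM (smoothD (smooth_cst 1) (smoothZ (-1) ck.1)) sp.1).
have -> : psi = fun x => cutoff k x * psi x + (1 + (-1) * cutoff k x) * psi x.
  by apply/funext => x; ring.
rewrite GD//; apply: (le_trans (normcD _ _)); apply: lerD; first exact: Gb.
by rewrite -mulrA; apply: GDc => //; exact: CP.
Qed.

End dilated_cutoffs.

(** * Vanishing away from the support *)

Section support.
Context (R : realType) (d : nat).
Implicit Types (f g psi phi eta : 'rV[R]_d -> R[i]) (x y : 'rV[R]_d) (j : 'I_d).
Implicit Types (A : set 'rV[R]_d).
Variable T : ('rV[R]_d -> R[i]) -> R[i].
Hypothesis tT : tempered T.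
Local Notation S := (dist_supp (fourier_dist T)).

(** [dist_supp] gives vanishing only near each point outside it; a partition of unity over the
    compact [A] makes it global. *)
Lemma fourier_dist_eq0_csupp A phi : compact A -> A `&` S = set0 -> csupp A phi ->
  T (fourier phi) = 0.
Proof.
move=> cA AS pA.
pose Q (B : set 'rV[R]_d) := forall psi, csupp B psi -> T (fourier psi) = 0.
have [|s [r [r0 rQ [V oV [AV Vs]]]]] := @compact_box_cover R d A Q cA.
  move=> a Aa; have : ~ S a by move=> Sa; rewrite -[False]/(set0 a) -AS.
  rewrite /dist_supp /setC /= => /contrapT[U [oU U0] Ua].
  have [r [r0 rU]] := open_box oU Ua; exists r; split=> // psi pB.
  apply: U0; first exact: csupp_test_fun (@compact_box R d _ _) pB.
  by apply: subset_trans rU; exact: csupp_tsupp (@closed_box R d _ _) pB.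
apply: (@csupp_cover R d (fun f => T (fourier f) = 0) s r A phi) => //.
- by rewrite fourier0 tempered0.
- move=> f g fA gA f0 g0; rewrite fourier_distD ?f0 ?g0 ?addr0//.
    exact: csupp_sschwartz fA.
  exact: csupp_sschwartz gA.
- move=> a psi sa pB; apply: (rQ a sa); apply: csuppW pB; exact: subIsetr.
- move=> x px; apply: Vs; apply: AV; apply: contrapT => nA.
  by move/eqP: px; apply; exact: pA.2.
Qed.

(** The cutoffs of [psi] are supported in a compact part of the complement of [V], which misses the
    support; continuity passes to the limit. Vanishing on a whole neighbourhood of the support is
    what keeps that compact set away from it. *)
Lemma fourier_dist_eq0 V psi : open V -> S `<=` V -> sschwartz psi ->
  (forall x, V x -> psi x = 0) -> T (fourier psi) = 0.
Proof.
move=> oV SV sp p0; apply: normc_eq0P; apply/eqP; rewrite eq_le normc_ge0 andbT.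
have [M [N [D D0 DP]]] := fourier_dist_bound tT.
apply: (@seminorm_cutoff_limit R d (fun f => T (fourier f)) M N D) => //.
  by move=> f g sf sg; exact: fourier_distD.
move=> k; rewrite (@fourier_dist_eq0_csupp (box 0 (2 * k.+1%:R) `&` ~` V)) ?normc0//.
- apply: (subclosed_compact _ (@compact_box R d 0 (2 * k.+1%:R))).
    by apply: closedI; [exact: closed_box|exact: open_closedC].
  exact: subIsetl.
- by apply/seteqP; split=> // x [[_ nV] /SV].
- have ck := csuppMr sp.1 (@csupp_cutoff R d k); split; first exact: ck.1.
  move=> x /not_andP[/ck.2 //|/contrapT/p0 ->]; exact: mulr0.
Qed.

End support.

(** * Gaussian regularization *)

Section gaussian_transform.
Context (R : realType) (d : nat).
Implicit Types (f g psi phi eta : 'rV[R]_d -> R[i]) (x y a : 'rV[R]_d) (j : 'I_d).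

Lemma pderiv_eq0_cst g : (forall j x, isd j g x 0) -> forall x y, g x = g y.
Proof.
move=> g0.
have shift j (h : R) x : g (h *: delta_mx 0 j + x) = g x.
  have e (u : 'rV[R]_d -> R) : (forall x, is_derive x (delta_mx 0 j : 'rV[R]_d) u 0) ->
      u (h *: delta_mx 0 j + x) = u x.
    move=> u0.
    have := @is_derive_0_is_cst R (fun t : R => u (t *: delta_mx 0 j + x)) h 0
      (fun t => (is_derive_slice _ _ _ _ _).1 (u0 _)).
    by rewrite scale0r add0r.
  apply: complex_ext.
    exact: (e (ref g) (fun z => (g0 j z).1)).
  exact: (e (imf g) (fun z => (g0 j z).2)).
have sums (s : seq 'I_d) (v : 'rV[R]_d) y : g (\sum_(j <- s) v 0 j *: delta_mx 0 j + y) = g y.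
  elim: s => [|j s IH]; first by rewrite big_nil add0r.
  by rewrite big_cons -addrA shift.
by move=> x y; rewrite -[x](subrK y) [X in g (X + _)]row_sum_delta sums.
Qed.

(** Read off from the total mass of the normal density of mean [m] and variance [q]. *)
Lemma gauss_integral1 (m q : R) : 0 < q ->
  (\int[lebesgue_measure]_t (expR (- (t - m) ^+ 2 / (2 * q)))%:E)%E = (Num.sqrt (2 * pi * q))%:E.
Proof.
move=> q0; set s := Num.sqrt q.
have s0 : s != 0 by rewrite gt_eqF// sqrtr_gt0.
have s2 : s ^+ 2 = q by rewrite sqr_sqrtr// ltW.
have p0 := normal_peak_gt0 s0.
have := integral_normal_pdf m s; rewrite (normal_pdfE m s0).
have -> : (\int[lebesgue_measure]_x (normal_peak s * normal_fun m s x)%:E =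
    (normal_peak s)%:E * \int[lebesgue_measure]_t (expR (- (t - m) ^+ 2 / (2 * q)))%:E)%E.
  rewrite -ge0_integralZl//.
  - apply: eq_integral => t _; rewrite -EFinM /normal_fun s2.
    by rewrite -mulr_natl.
  - apply/measurable_EFinP.
    have := @measurable_normal_fun R m s; rewrite /normal_fun s2.
    by rewrite -mulr_natl.
  - by rewrite lee_fin ltW.
set I := (\int[_]_t _)%E => e.
have -> : I = ((normal_peak s)^-1%:E * ((normal_peak s)%:E * I))%E.
  by rewrite muleA -EFinM mulVf ?gt_eqF// mul1e.
rewrite e mule1 /normal_peak invrK s2; congr (Num.sqrt _)%:E.
by rewrite -mulr_natl; ring.
Qed.

Lemma expR_sqn (c : R) x : expR (c * dotv x x) = \prod_j expR (c * x 0 j ^+ 2).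
Proof.
rewrite /dotv mulr_sumr; elim: (index_enum _) => [|j s IH].
  by rewrite !big_nil expR0.
by rewrite !big_cons expRD IH expr2.
Qed.

Lemma gauss_integral (a : 'rV[R]_d) (q : R) : 0 < q ->
  rintegrable (fun x => expR (- dotv (x - a) (x - a) / (2 * q))) /\
  rint (fun x => expR (- dotv (x - a) (x - a) / (2 * q))) = Num.sqrt (2 * pi * q) ^+ d.
Proof.
move=> q0.
have -> : (fun x => expR (- dotv (x - a) (x - a) / (2 * q))) =
    (fun x => \prod_j (fun j t => expR (- (t - a 0 j) ^+ 2 / (2 * q))) j (x 0 j)).
  apply/funext => x; have -> : - dotv (x - a) (x - a) / (2 * q) = (- (2 * q)^-1) * dotv (x - a) (x - a) by ring.
  rewrite expR_sqn; apply: eq_bigr => j _; rewrite !mxE; congr expR; ring.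
have [|||i e] := @rintegrable_prod R d (fun j t => expR (- (t - a 0 j) ^+ 2 / (2 * q)))
  (fun=> Num.sqrt (2 * pi * q)).
- move=> j t.
  have c1 : {for t, continuous (fun t => - (t - a 0 j) ^+ 2 / (2 * q))}.
    have ch : continuous (horner ((- (('X - (a 0 j)%:P) ^+ 2)) * ((2 * q)^-1)%:P)).
      exact: continuous_horner.
    have -> : (fun t => - (t - a 0 j) ^+ 2 / (2 * q)) = horner ((- (('X - (a 0 j)%:P) ^+ 2)) * ((2 * q)^-1)%:P).
      by apply/funext => u; rewrite !(hornerE, hornerXn).
    exact: ch.
  exact: (continuous_comp c1 (@continuous_expR R _)).
- by move=> j t; exact: expR_ge0.
- by move=> j; exact: gauss_integral1.
- by split=> //; rewrite e prodr_const card_ord.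
Qed.

(** The closed form of the Fourier transform of [gexp q a]. Its integral is [gauss_mass], that is
    [(2 pi)^(d/2)], whatever [q]. *)
Definition gauss_kernel (q : R) a x : R :=
  fconst R d * Num.sqrt (2 * pi / q) ^+ d * expR (- dotv (x - a) (x - a) / (2 * q)).

Definition gauss_mass : R := fconst R d * (2 * pi) ^+ d.

Lemma gauss_mass_gt0 : 0 < gauss_mass.
Proof. by rewrite mulr_gt0 ?fconst_gt0// exprn_gt0// mulr_gt0// pi_gt0. Qed.

Lemma gauss_kernel_ge0 q a x : 0 <= gauss_kernel q a x.
Proof. by rewrite !mulr_ge0 ?expR_ge0 ?exprn_ge0 ?sqrtr_ge0// ltW// fconst_gt0. Qed.

Lemma rint_gauss_kernel q a : 0 < q ->
  rintegrable (gauss_kernel q a) /\ rint (gauss_kernel q a) = gauss_mass.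
Proof.
move=> q0; have [ig eg] := gauss_integral a q0.
split; first exact: rintegrableZ.
rewrite (rintZ _ ig) eg /gauss_mass -mulrA -exprMn -sqrtrM.
  have -> : 2 * pi / q * (2 * pi * q) = (2 * pi) ^+ 2 by field; rewrite gt_eqF.
  by rewrite sqrtr_sqr ger0_norm// mulr_ge0// pi_ge0.
by rewrite divr_ge0 ?ltW// mulr_gt0// pi_gt0.
Qed.

(** At [a] the two characters cancel and a real Gaussian integral with parameter [q^-1] remains.
    This value fixes the constant in the solution of the differential equations. *)
Lemma fourier_gexp_center q a : 0 < q ->
  fourier (gexp q a) a = (fconst R d * Num.sqrt (2 * pi / q) ^+ d)%:C.
Proof.
move=> q0; rewrite fourierE [RHS]realcM; congr (_ * _).
have -> : (fun y => gexp q a y * expi (- dotv y a)) =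
    (fun y => (expR (- dotv (y - 0) (y - 0) / (2 * q^-1)))%:C).
  apply/funext => y; rewrite /gexp mulrAC -expiD subrr subr0.
  rewrite (_ : expi 0 = 1) ?mul1r; last by rewrite /expi cos0 sin0.
  by congr ((expR _)%:C); field; rewrite gt_eqF.
have q'0 : 0 < q^-1 by rewrite invr_gt0.
have [_ e] := gauss_integral 0 q'0.
rewrite cintegralE; apply: complex_ext => /=; first exact: e.
have := rintZ 0 (rintegrable_weight R d); rewrite mul0r => <-.
by congr rint; apply/funext => x; rewrite mul0r.
Qed.

(* Both sides solve the same first-order equations [h_j = - (x_j - a_j) / q * h],
   so their quotient is constant. *)
Lemma fourier_gexp q a : 0 < q ->
  fourier (gexp q a) = fun x => (gauss_kernel q a x)%:C.
Proof.
move=> q0; have sE := sschwartz_gexp a q0.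
set h := fourier (gexp q a).
have qn0 : q != 0 by rewrite gt_eqF.
have qCn0 : q%:C != 0 :> R[i].
  by apply/negP => /eqP/(congr1 (@complex.Re R)) /= /eqP; rewrite (negbTE qn0).
have dh j x : isd j h x ((- ((x 0 j - a 0 j) / q))%:C * h x).
  apply: (isd_eq (fourier_isd j x sE)).
  have sl := sschwartzM (@moderate_coord R d j) sE.
  (* The transform of [pderiv j (gexp q a)] is computed in two ways, which expresses the transform
     of [y_j * gexp q a] through [h]. *)
  have := fourier_pderiv j sE => /(congr1 (fun u => u x)).
  have -> : pderiv j (gexp q a) = fun y => (0 +i* a 0 j) * gexp q a y +
      (- q)%:C * ((y 0 j)%:C * gexp q a y).
    by rewrite pderiv_gexp; apply/funext => y; rewrite mulrDl mulrA.
  rewrite (fourierD (sschwartzZ _ sE) (sschwartzZ _ sl)) !(fourierZ _ sE) !(fourierZ _ sl) -/h.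
  set u := fourier (fun y => (y 0 j)%:C * gexp q a y) x => e.
  apply: (mulfI qCn0).
  have qu : q%:C * u = (0 +i* a 0 j) * h x - (0 +i* x 0 j) * h x.
    rewrite -e; have -> : (- q)%:C = - q%:C :> R[i] by apply: complex_ext => /=; ring.
    ring.
  rewrite mulrCA qu !mulrA -realcM.
  have -> : q * - ((x 0 j - a 0 j) / q) = a 0 j - x 0 j by field.
  rewrite -mulrBl mulrA; congr (_ * _).
  by apply: complex_ext; rewrite !(CReM, CImM, CReD, CImD, CReN, CImN) /=; ring.
(* The reciprocal of the expected Gaussian, so that the quotient to be proved constant is a
   product. *)
pose w x : R := expR (dotv (x - a) (x - a) / (2 * q)).
have dw j x : isd j (fun y => (w y)%:C) x (((x 0 j - a 0 j) / q) * w x)%:C.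
  apply: isd_real; rewrite /w.
  have dq : is_derive x (delta_mx 0 j : 'rV[R]_d) (fun y => dotv (y - a) (y - a) / (2 * q)) ((x 0 j - a 0 j) / q).
    apply: (@is_derive_quad _ _ _ _ _ _ (2 * q)^-1) => t _.
    have -> : t *: delta_mx 0 j + x - a = t *: delta_mx 0 j + (x - a) by rewrite addrA.
    rewrite dotv_shift [dotv (x - a) _]dotvC dotv_shift !mxE !eqxx mulr1.
    rewrite [X in `|X|](_ : _ = (2 * q)^-1 * t ^+ 2); last by field.
    by rewrite ger0_norm// mulr_ge0 ?sqr_ge0// invr_ge0 mulr_ge0// ltW.
  by apply: (is_derive_eq (is_derive_chain (is_derive_expR _) dq)); rewrite mulrC.
have hw x : h x * (w x)%:C = h a * (w a)%:C.
  apply: (@pderiv_eq0_cst (fun x => h x * (w x)%:C)) => j y.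
  apply: (isd_eq (isdM (dh j y) (dw j y))).
  rewrite realcM; have -> : (- ((y 0 j - a 0 j) / q))%:C = - ((y 0 j - a 0 j) / q)%:C :> R[i].
    by apply: complex_ext => /=; ring.
  ring.
apply/funext => x.
have w1 : w a = 1 by rewrite /w subrr /dotv big1 ?mul0r ?expR0// => j _; rewrite mxE mul0r.
have -> : h x = h x * (w x)%:C * (expR (- dotv (x - a) (x - a) / (2 * q)))%:C.
  rewrite -mulrA -realcM /w -expRD (_ : _ + _ = 0) ?expR0 ?mulr1//.
  by rewrite mulNr subrr.
by rewrite hw w1 mulr1 /h (fourier_gexp_center a q0) -realcM.
Qed.

Lemma sschwartz_gauss_kernel q a : 0 < q -> sschwartz (fun x => (gauss_kernel q a x)%:C).
Proof. by move=> q0; rewrite -fourier_gexp//; exact: sschwartz_fourier (sschwartz_gexp a q0). Qed.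

Lemma pderiv_gauss_kernel q a j : 0 < q -> pderiv j (fun x => (gauss_kernel q a x)%:C) =
  fun x => (q^-1)%:C * (((a 0 j)%:C + (-1)%:C * (x 0 j)%:C) * (gauss_kernel q a x)%:C).
Proof.
move=> q0; have sE := sschwartz_gexp a q0.
have sl := sschwartzM (@moderate_coord R d j) sE.
have qn0 : q != 0 by rewrite gt_eqF.
apply/funext => x; rewrite -(fourier_gexp a q0) (pderiv_fourier j sE) (fourierZ _ sl).
have := fourier_pderiv j sE => /(congr1 (fun u => u x)).
have -> : pderiv j (gexp q a) = fun y => (0 +i* a 0 j) * gexp q a y +
    (- q)%:C * ((y 0 j)%:C * gexp q a y).
  by rewrite pderiv_gexp; apply/funext => y; rewrite mulrDl mulrA.
rewrite (fourierD (sschwartzZ _ sE) (sschwartzZ _ sl)) !(fourierZ _ sE) !(fourierZ _ sl).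
set u := fourier (fun y => (y 0 j)%:C * gexp q a y) x.
rewrite (fourier_gexp a q0); set H := (gauss_kernel q a x)%:C => e.
have qu : q%:C * u = (0 +i* a 0 j) * H - (0 +i* x 0 j) * H.
  rewrite -e; have -> : (- q)%:C = - q%:C :> R[i] by apply: complex_ext => /=; ring.
  ring.
have -> : u = (q^-1)%:C * (q%:C * u) by rewrite mulrA -realcM mulVf// mul1r.
rewrite qu -mulrBl mulrCA; congr (_ * _); rewrite mulrA; congr (_ * _).
by apply: complex_ext; rewrite !(CReM, CImM, CReD, CImD, CReN, CImN) /=; ring.
Qed.

Lemma gauss_kernel_tail a (e : R) K L : 0 < e -> exists2 C : R, 0 <= C & forall q x,
  0 < q <= 1 -> e <= `|x - a| -> (1 + `|x|) ^+ K * gauss_kernel q a x <= C * q ^+ L.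
Proof.
(* Decay of order [2 m] in [|x - a|] is extracted from the exponential: it absorbs the [K] powers of
   [1 + |x|], and the [q ^+ m] coming with it pays for the normalization, at most [q ^- d] up to a
   constant, and leaves at least [L] powers of [q]. *)
move=> e0; set m := (K + L + d)%N.
set C0 := fconst R d * Num.sqrt (2 * pi) ^+ d.
have C00 : 0 <= C0 by rewrite mulr_ge0 ?exprn_ge0 ?sqrtr_ge0// ltW// fconst_gt0.
(* The ratio of [1 + |x|] to [|x - a|] is at most [C1] as soon as [|x - a| >= e]. *)
set C1 := (1 + `|a|) / e + 1.
have C10 : 0 <= C1 by rewrite addr_ge0// divr_ge0 ?addr_ge0// ltW.
have c1 : 0 <= e ^- (2 * m - K) by rewrite invr_ge0 exprn_ge0// ltW.
have c2 : 0 <= m`!%:R * 2 ^+ m :> R by rewrite mulr_ge0// exprn_ge0.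
exists (C0 * (m`!%:R * 2 ^+ m) * C1 ^+ K * (e ^- (2 * m - K))).
  exact: (mulr_ge0 (mulr_ge0 (mulr_ge0 C00 c2) (exprn_ge0 K C10)) c1).
move=> q x /andP[q0 q1] ex; set rho := `|x - a|.
have r0 : 0 < rho by apply: lt_le_trans ex.
have sq : Num.sqrt (2 * pi / q) ^+ d <= Num.sqrt (2 * pi) ^+ d * q ^- d.
  rewrite -exprVn -exprMn lerXn2r ?nnegrE ?mulr_ge0 ?sqrtr_ge0 ?invr_ge0 ?(ltW q0)//.
  rewrite sqrtrM ?mulr_ge0 ?pi_ge0// ler_wpM2l ?sqrtr_ge0//.
  rewrite -[leRHS]ger0_norm ?invr_ge0 ?(ltW q0)// -[leRHS]sqrtr_sqr ler_wsqrtr//.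
  by rewrite expr2 ler_peMl ?invr_ge0 ?(ltW q0)// invf_ge1.
have hx : 1 + `|x| <= C1 * rho.
  have : `|x| <= `|a| + rho by rewrite -[x](subrK a) addrC; exact: ler_normD.
  have : 1 + `|a| <= (1 + `|a|) / e * rho.
    rewrite -mulrA mulrC -[leLHS]mul1r ler_wpM2r ?addr_ge0//.
    by rewrite mulrC ler_pdivlMr// mul1r.
  move=> h1 h2; rewrite /C1 [leRHS]mulrDl mul1r.
  by apply: (le_trans (lerD (lexx 1) h2)); rewrite addrA lerD2r.
have he : expR (- dotv (x - a) (x - a) / (2 * q)) <= m`!%:R * 2 ^+ m * q ^+ m / rho ^+ (2 * m).
  set z := rho ^+ 2 / (2 * q).
  have z0 : 0 < z by rewrite divr_gt0 ?exprn_gt0// mulr_gt0.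
  apply: (@le_trans _ _ (expR (- z))).
    rewrite ler_expR mulNr lerN2 ler_wpM2r ?invr_ge0 ?mulr_ge0 ?(ltW q0)//.
    exact: normr_sqr_le_sqn.
  have -> : m`!%:R * 2 ^+ m * q ^+ m / rho ^+ (2 * m) = m`!%:R / z ^+ m.
    by rewrite /z expr_div_n invf_div (exprMn _ 2 q) (exprM rho 2 m) !mulrA.
  rewrite expRN -[leLHS]mul1r ler_pdivrMr ?expR_gt0// mulrAC ler_pdivlMr ?exprn_gt0// mul1r.
  exact: expr_le_fact_expR (ltW z0).
have Km : (K <= 2 * m)%N by rewrite /m mul2n -addnn -!addnA leq_addr.
have h1 : (1 + `|x|) ^+ K <= C1 ^+ K * rho ^+ K.
  rewrite -exprMn lerXn2r ?nnegrE ?addr_ge0//.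
  by apply: le_trans hx; rewrite addr_ge0.
have h2 : gauss_kernel q a x <= C0 * q ^- d * (m`!%:R * 2 ^+ m * q ^+ m / rho ^+ (2 * m)).
  have F0 := ltW (fconst_gt0 R d).
  apply: ler_pM; [|exact: expR_ge0| |exact: he].
    by rewrite mulr_ge0// exprn_ge0// sqrtr_ge0.
  by rewrite /C0 -[leRHS]mulrA; exact: ler_wpM2l.
apply: (@le_trans _ _ (C1 ^+ K * rho ^+ K * (C0 * q ^- d * (m`!%:R * 2 ^+ m * q ^+ m / rho ^+ (2 * m))))).
  by rewrite ler_pM ?exprn_ge0 ?addr_ge0// gauss_kernel_ge0.
have qm : q ^- d * q ^+ m = q ^+ (K + L).
  by rewrite /m exprD mulrC mulfK// expf_neq0// gt_eqF.
have rm : rho ^+ K / rho ^+ (2 * m) = rho ^- (2 * m - K).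
  rewrite -{1}(subnK Km) exprD; field.
  by rewrite !expf_neq0 ?gt_eqF.
rewrite [leLHS](_ : _ = C0 * (m`!%:R * 2 ^+ m) * C1 ^+ K * ((rho ^+ K / rho ^+ (2 * m)) * (q ^- d * q ^+ m))); last by ring.
rewrite qm rm -[leRHS]mulrA.
apply: ler_wpM2l; first exact: (mulr_ge0 (mulr_ge0 C00 c2) (exprn_ge0 K C10)).
apply: ler_pM; rewrite ?invr_ge0 ?exprn_ge0 ?(ltW r0) ?(ltW q0)//.
  rewrite lef_pV2 ?posrE ?exprn_gt0// lerXn2r ?nnegrE ?(ltW e0) ?(ltW r0)//.
by rewrite ler_wiXn2l ?(ltW q0)// leq_addl.
Qed.

(** A derivative of the kernel costs a factor [q^-1]. The exponent [L] is therefore general in the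
    induction on [M]: the term with [q^-1] uses the hypothesis at [L.+1]. *)
Lemma snorm_gauss_kernel M N L eta a (e : R) : 0 < e -> moderate eta ->
  (forall x, `|x - a| < e -> eta x = 0) -> exists2 C : R, 0 <= C & forall q, 0 < q <= 1 ->
  snorm_le M N (fun x => eta x * (gauss_kernel q a x)%:C) (C * q ^+ L).
Proof.
move=> e0; elim: M L eta => [|M IH] L eta me eta0.
  have [K [C1 eC]] := me.2 0%N; have C10 := growth_ge0 eC.
  have [C C0 CP] := @gauss_kernel_tail a e (N + K) L e0.
  exists (C1 * C); first exact: mulr_ge0.
  move=> q /andP[q0 q1]; apply: snorm0 => x.
  rewrite normcM normcR ger0_norm ?gauss_kernel_ge0//.
  have [xe|xe] := ltP `|x - a| e.
    by rewrite eta0// normc0 mul0r mulr0 !mulr_ge0// exprn_ge0// ltW.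
  have h := eC [::] isT x; rewrite /= in h.
  have h2 := CP q x; rewrite q0 q1 exprD in h2; have {}h2 := h2 isT xe.
  apply: (@le_trans _ _ (C1 * ((1 + `|x|) ^+ N * (1 + `|x|) ^+ K * gauss_kernel q a x))).
    rewrite [leRHS](_ : _ = (1 + `|x|) ^+ N * (C1 * (1 + `|x|) ^+ K * gauss_kernel q a x)); last by ring.
    by rewrite ler_wpM2l ?exprn_ge0 ?addr_ge0// ler_wpM2r// gauss_kernel_ge0.
  by rewrite -[leRHS]mulrA; exact: ler_wpM2l.
have oe : open [set x | `|x - a| < e] by exact: open_obox.
have mj j : moderate (fun x => eta x * ((a 0 j)%:C + (-1)%:C * (x 0 j)%:C)).
  exact: (moderateM me (moderateD (@moderate_cst R d _) (moderateZ _ (@moderate_coord R d j)))).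
have [C0 C00 C0P] := IH L eta me eta0.
have /choice[C1 C1P] : forall j, exists C : R, 0 <= C /\ forall q, 0 < q <= 1 ->
    snorm_le M N (fun x => pderiv j eta x * (gauss_kernel q a x)%:C) (C * q ^+ L).
  move=> j; have [|C] := IH L (pderiv j eta) (moderate_pderiv j me).
    exact: pderiv_eq0_open oe eta0.
  by exists C.
have /choice[C2 C2P] : forall j, exists C : R, 0 <= C /\ forall q, 0 < q <= 1 ->
    snorm_le M N (fun x => eta x * ((a 0 j)%:C + (-1)%:C * (x 0 j)%:C) * (gauss_kernel q a x)%:C) (C * q ^+ L.+1).
  move=> j; have [|C] := IH L.+1 _ (mj j).
    by move=> x /eta0 ->; rewrite mul0r.
  by exists C.
have S0 : 0 <= \sum_j (C1 j + C2 j).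
  by rewrite sumr_ge0// => j _; rewrite addr_ge0//; [have [] := C1P j|have [] := C2P j].
exists (C0 + \sum_j (C1 j + C2 j)); first by rewrite addr_ge0.
move=> q q01; have [q0 q1] := andP q01.
have qL : 0 <= q ^+ L by rewrite exprn_ge0// ltW.
have sg := (sschwartz_gauss_kernel a q0).1.
apply: snormS => [x|j].
  apply: (le_trans (snorm_fun x (C0P q q01))).
  by rewrite ler_wpM2r// lerDl.
have [C10 C1k] := C1P j; have [C20 C2k] := C2P j.
apply: (@snormW _ _ M N M N _ (C1 j * q ^+ L + normc ((q^-1)%:C : R[i]) * (C2 j * q ^+ L.+1))) => //.
  have iq : 0 <= q^-1 by rewrite invr_ge0 ltW.
  have -> : C1 j * q ^+ L + normc ((q^-1)%:C : R[i]) * (C2 j * q ^+ L.+1) = (C1 j + C2 j) * q ^+ L.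
    by rewrite normcR (ger0_norm iq) exprS; field; rewrite gt_eqF.
  apply: ler_wpM2r => //; rewrite (bigD1 j)//= addrCA lerDl.
  rewrite addr_ge0// sumr_ge0// => i _; rewrite addr_ge0//; [by have [] := C1P i|by have [] := C2P i].
rewrite (pderivM j me.1 sg) (pderiv_gauss_kernel a j q0).
have -> : (fun y => pderiv j eta y * (gauss_kernel q a y)%:C + eta y *
     (q^-1%:C * (((a 0 j)%:C + (-1)%:C * (y 0 j)%:C) * (gauss_kernel q a y)%:C))) =
   (fun y => pderiv j eta y * (gauss_kernel q a y)%:C + q^-1%:C *
     (eta y * ((a 0 j)%:C + (-1)%:C * (y 0 j)%:C) * (gauss_kernel q a y)%:C)).
  by apply/funext => y; rewrite [eta y * (_ * _)]mulrCA !mulrA.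
have s1 := smoothM (smooth_pderiv j me.1) sg.
have s2 := smoothM (mj j).1 sg.
apply: (snormD s1 (smoothZ _ s2)); first exact: C1k.
exact: (snormZ _ s2 (C2k q q01)).
Qed.

End gaussian_transform.

(** * Recovering values of [P(D)^n f] from pairings with Gaussians *)

Section reconstruction.
Context (R : realType) (d : nat).
Implicit Types (phi psi : 'rV[R]_d -> R[i]) (x y a : 'rV[R]_d) (j : 'I_d).
Variables (f : 'rV[R]_d -> R[i]) (T : ('rV[R]_d -> R[i]) -> R[i]).
Hypotheses (sf : smooth f) (tT : tempered T) (Tf : extends_fun T f).
Variable L : seq (R[i] * seq 'I_d).

(** Integration by parts against a test function, the only kind of function on which [Tf] gives
    information. *)
Lemma tempered_iter_lop n A phi : compact A -> csupp A phi ->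
  T (iter n (lop (lop_adj L)) phi) = cintegral (fun x => iter n (lop L) f x * phi x).
Proof.
move=> cA pA; rewrite (cintegral_iter_lop L n cA sf pA); apply: Tf.
apply: (csupp_test_fun cA); exact: (csupp_iter_lop _ n (rV_compact_closed cA) pA).
Qed.

Lemma tempered_iter_lopD n phi psi : sschwartz phi -> sschwartz psi ->
  T (iter n (lop (lop_adj L)) (fun x => phi x + psi x)) =
  T (iter n (lop (lop_adj L)) phi) + T (iter n (lop (lop_adj L)) psi).
Proof.
move=> sp sq; rewrite (iter_lopD _ n sp.1 sq.1) temperedD//; exact: sschwartz_iter_lop.
Qed.

Lemma tempered_iter_lop_bound n : exists M N, exists2 C : R, 0 <= C &
  forall phi c, sschwartz phi -> snorm_le M N phi c ->
    normc (T (iter n (lop (lop_adj L)) phi)) <= C * c.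
Proof.
have [N [C C0 TC]] := tempered_bound tT.
have [K [C1 C10 LC]] := snorm_iter_lop (lop_adj L) n.
exists (N + K)%N, N, (C * C1); first exact: mulr_ge0.
move=> phi c sp pc; rewrite -mulrA; apply: TC; first exact: sschwartz_iter_lop.
exact: LC sp.1 pc.
Qed.

Lemma cintegral_gauss_kernel q a : 0 < q ->
  cintegral (fun x => (gauss_kernel q a x)%:C) = (gauss_mass R d)%:C.
Proof.
move=> q0; have [_ e] := rint_gauss_kernel a q0.
rewrite cintegralE; apply: complex_ext => /=; first exact: e.
have := rintZ 0 (rintegrable_weight R d); rewrite mul0r => <-.
by congr rint; apply/funext => x; rewrite mul0r.
Qed.

(** The integral of [(g - g a)] times the kernel is split at a distance where [g] varies little: the
    near part is small by the mass of the kernel, the far part is [O(q)] by its tail. *)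
Lemma gauss_kernel_approx g a (eps : R) : sschwartz g -> 0 < eps ->
  exists2 C : R, 0 <= C & forall q, 0 < q <= 1 ->
  gauss_mass R d * normc (g a) <=
    normc (cintegral (fun x => g x * (gauss_kernel q a x)%:C)) + eps * gauss_mass R d + C * q.
Proof.
move=> sg eps0; have e20 : 0 < eps / 2 by rewrite divr_gt0.
have cg := smooth_ccont sg.1.
have cga : ccont (fun x => g x + - g a) := ccontD cg (@ccont_cst R d _).
(* Half of [eps], because the bound on complex integrals loses a factor 2. *)
have [e e0 ge] : exists2 e : R, 0 < e & forall x, `|x - a| < e -> normc (g x - g a) <= eps / 2.
  have := @ccont_normc R d _ cga a.
  move=> /cvgrPdist_le /(_ _ e20) /nbhs_ballP[e /= e0 ee]; exists e => // x xa.
  have := ee x; rewrite -ball_normE /ball_ /= distrC => /(_ xa).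
  by rewrite subrr normc0 sub0r normrN ger0_norm// normc_ge0.
have [B gB] := sg.2 0%N 0%N.
have gB' x : normc (g x - g a) <= 2 * B.
  have := snorm_fun x gB; have := snorm_fun a gB; rewrite !expr0 !mul1r => h1 h2.
  by rewrite (le_trans (normcB _ _))// mulrDl mul1r lerD.
have B0 := snorm_ge0 gB.
have [C C0 CP] := @gauss_kernel_tail R d a e (2 * d) 1 e0.
exists (2 * (2 * B * C * bigW R d)).
  by rewrite !mulr_ge0// bigW_ge0.
move=> q q01; have [q0 q1] := andP q01.
have sk := sschwartz_gauss_kernel a q0.
have [ik ek] := rint_gauss_kernel a q0.
have iw := rintegrable_weight R d.
have [c1 h1] := sschwartz_cdom sk.
have [c2 h2] : exists c2 : R, cdom (fun x => (g x + - g a) * (gauss_kernel q a x)%:C) c2.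
  exists (2 * B * c1); split; first exact: (ccontM cga h1.1).
  move=> x; rewrite normcM -mulrA; apply: ler_pM; rewrite ?normc_ge0//.
  exact: h1.2.
have ec : cintegral (fun x => g x * (gauss_kernel q a x)%:C) =
    cintegral (fun x => (g x + - g a) * (gauss_kernel q a x)%:C) + g a * (gauss_mass R d)%:C.
  rewrite -(cintegral_gauss_kernel a q0) -(cintegralZ _ h1) -(cintegralD h2 (cdomZ _ h1)).
  by congr cintegral; apply/funext => x; ring.
have small : normc (cintegral (fun x => (g x + - g a) * (gauss_kernel q a x)%:C)) <=
    2 * rint (fun x => eps / 2 * gauss_kernel q a x + 2 * B * C * q * weight x).
  apply: (normc_cintegral_le h2.1 (rintegrableD (rintegrableZ _ ik) (rintegrableZ _ iw))) => x.
  rewrite normcM normcR ger0_norm ?gauss_kernel_ge0//.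
  have k0 := gauss_kernel_ge0 q a x.
  have w0 := ltW (weight_gt0 x).
  have [xe|xe] := ltP `|x - a| e.
    apply: (@le_trans _ _ (eps / 2 * gauss_kernel q a x)); first by rewrite ler_wpM2r// ge.
    by rewrite lerDl !mulr_ge0// ltW.
  apply: (@le_trans _ _ (2 * B * C * q * weight x)); last by rewrite lerDr mulr_ge0// ltW.
  rewrite -!mulrA (mulrA 2 B); apply: ler_pM; rewrite ?normc_ge0//.
  have := CP q x q01 xe; rewrite expr1 => h.
  apply: (@le_trans _ _ ((1 + `|x|) ^+ (2 * d) * gauss_kernel q a x * weight x)).
    by rewrite mulrAC ler_peMl// weight_ge.
  by rewrite mulrA ler_wpM2r.
move: small; rewrite (rintD (rintegrableZ _ ik) (rintegrableZ _ iw)) !(rintZ _ ik) !(rintZ _ iw) ek -/(bigW R d) => small.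
have : normc (g a * (gauss_mass R d)%:C) <= normc (cintegral (fun x => g x * (gauss_kernel q a x)%:C))
    + normc (cintegral (fun x => (g x + - g a) * (gauss_kernel q a x)%:C)).
  by rewrite (_ : g a * _ = cintegral (fun x => g x * (gauss_kernel q a x)%:C) -
     cintegral (fun x => (g x + - g a) * (gauss_kernel q a x)%:C)) ?normcB// ec; ring.
rewrite normcM normcR gtr0_norm ?gauss_mass_gt0// mulrC => h.
apply: (le_trans h); rewrite -addrA lerD2l; apply: (le_trans small).
by rewrite le_eqVlt; apply/orP; left; apply/eqP; field.
Qed.

(* As [q] tends to 0 the left member of the hypothesis converges to that of the
   conclusion, the Gaussian being an approximate identity of mass [gauss_mass]. *)
Lemma reconstruction_bound n a (b : R) :
  (forall q, 0 < q <= 1 -> normc (T (fourier (fun y => symb L y ^+ n * gexp q a y))) <= b) ->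
  gauss_mass R d * normc (iter n (lop L) f a) <= b.
Proof.
move=> Tb; set h := iter n (lop L) f.
have sh : smooth h := smooth_iter_lop L n sf.
have cb := @csupp_bump R d a 1 ltr01; rewrite mulr1 in cb.
(* [f] can be integrated against test functions only, so the kernel is cut off near [a]; by [CP]
   below, the discarded part has seminorms [O(q)]. *)
set chi := fun y => (box_bump a 1 y)%:C in cb *.
have cbox : compact (box a (2 : R)) := @compact_box R d a 2.
have sg : sschwartz (fun x => h x * chi x) := csupp_sschwartz cbox (csuppM sh cb).
have me : moderate (fun y => 1 + (-1) * chi y).
  apply: (moderateD (@moderate_cst R d 1)); apply: moderateZ.
  have [sc cc] := csupp_sschwartz cbox cb; split=> // M.
  have [c ccM] := cc M 0%N; exists 0%N, c => s sM x.
  by have := ccM s sM x; rewrite !expr0 mul1r mulr1.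
have eta0 x : `|x - a| < 1 -> 1 + (-1) * chi x = 0.
  by move=> xa; rewrite /chi bump_eq1 ?ltW// mulN1r subrr.
have [M [N [D D0 DP]]] := tempered_iter_lop_bound n.
have [C C0 CP] := @snorm_gauss_kernel R d M N 1 _ a 1 ltr01 me eta0.
(* Two nested limits: [eps = 1 / (k + 1)] and, for fixed [k], [q = 1 / (l + 1)]. They cannot be
   merged, since [C1] depends on [eps]. *)
apply: (@le_archimedean_limit _ _ _ (gauss_mass R d)) => k.
have eps0 : (0 : R) < k.+1%:R^-1 by rewrite invr_gt0 ltr0n.
have [C1 C10 C1P] := gauss_kernel_approx a sg eps0.
rewrite [b + _]/(b + _ * _) [gauss_mass R d * _^-1]mulrC.
apply: (@le_archimedean_limit _ _ _ (D * C + C1)) => l.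
set q : R := l.+1%:R^-1.
have q0 : 0 < q by rewrite invr_gt0 ltr0n.
have q1 : q <= 1 by rewrite invf_le1 ?ltr0n// ler1n.
have q01 : 0 < q <= 1 by rewrite q0 q1.
have sk := sschwartz_gauss_kernel a q0.
have := C1P q q01; rewrite {1}/chi bump_eq1 ?subrr ?normr0 ?ler01 ?ltr01// mulr1 => h1.
apply: (le_trans h1).
have -> : (fun x => h x * chi x * (gauss_kernel q a x)%:C) =
    (fun x => h x * (chi x * (gauss_kernel q a x)%:C)) by apply/funext => x; rewrite mulrA.
have c1 := csuppMr sk.1 cb.
have s1 := csupp_sschwartz cbox c1; have s2 := sschwartzM me sk.
rewrite -(tempered_iter_lop n cbox c1).
have e1 : T (iter n (lop (lop_adj L)) (fun x => (gauss_kernel q a x)%:C)) =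
   T (iter n (lop (lop_adj L)) (fun y => chi y * (gauss_kernel q a y)%:C)) +
   T (iter n (lop (lop_adj L)) (fun x => (1 + (-1) * chi x) * (gauss_kernel q a x)%:C)).
  rewrite -(tempered_iter_lopD n s1 s2); congr (T (iter n _ _)).
  by apply/funext => x; ring.
have e2 := Tb q q01; rewrite -(iter_lop_fourier L n (sschwartz_gexp a q0)) (fourier_gexp a q0) in e2.
have e3 := DP _ _ s2 (CP q q01); rewrite expr1 in e3.
rewrite addrAC mulrDl -[X in _ <= X]addrA [_ * gauss_mass R d + _]addrC addrA lerD2r.
rewrite (addrA b) lerD2r.
have -> : T (iter n (lop (lop_adj L)) (fun y => chi y * (gauss_kernel q a y)%:C)) =
   T (iter n (lop (lop_adj L)) (fun x => (gauss_kernel q a x)%:C)) -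
   T (iter n (lop (lop_adj L)) (fun x => (1 + (-1) * chi x) * (gauss_kernel q a x)%:C)).
  by rewrite e1 addrK.
apply: (le_trans (normcB _ _)); apply: lerD; first exact: e2.
by rewrite -mulrA.
Qed.

End reconstruction.

Lemma choice_ge0 (R : realType) (I : Type) (P : I -> R -> Prop) :
  (forall i, exists2 C : R, 0 <= C & P i C) ->
  exists C : I -> R, forall i, 0 <= C i /\ P i (C i).
Proof.
move=> iP; have /choice[C CP] : forall i, exists C, 0 <= C /\ P i C.
  by move=> i; have [C C0 PC] := iP i; exists C.
by exists C.
Qed.

(** * Seminorms of powers times Gaussians *)

Section power_estimate.
Context (R : realType) (d : nat).
Implicit Types (phi psi W : 'rV[R]_d -> R[i]) (x y a : 'rV[R]_d) (j : 'I_d).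

(* The [M] derivatives cost only a power of [n] and of [|a|] next to [r^n]. *)
Lemma snorm_pow_gexp A W (r : R) M N phi : compact A -> smooth W -> 0 < r ->
  (forall y, A y -> normc (W y) <= r) -> csupp A phi ->
  exists2 C : R, 0 <= C & forall n q a, 0 <= q <= 1 ->
    snorm_le M N (fun y => W y ^+ n * phi y * gexp q a y)
      (C * (1 + n%:R) ^+ M * (1 + `|a|) ^+ M * r ^+ n).
Proof.
move=> cA sW r0 Wr; have clA := rV_compact_closed cA.
have base phi' : csupp A phi' -> exists2 C : R, 0 <= C & forall n q a, 0 <= q <= 1 ->
    forall y, (1 + `|y|) ^+ N * normc (W y ^+ n * phi' y * gexp q a y) <= C * r ^+ n.
  move=> pA; have [c pc] := (csupp_sschwartz cA pA).2 0%N N.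
  exists c; first exact: snorm_ge0 pc.
  move=> n q a /andP[q0 _] y; rewrite (normcM (_ * _) (gexp q a y)).
  rewrite (normcM (W y ^+ n)) normcX.
  have [Ay|nA] := pselect (A y); last first.
    rewrite pA.2// normc0 mulr0 mul0r mulr0 mulr_ge0//.
      exact: snorm_ge0 pc.
    by rewrite exprn_ge0// ltW.
  have h1 : normc (W y) ^+ n <= r ^+ n.
    by rewrite lerXn2r ?nnegrE ?normc_ge0 ?(ltW r0)// Wr.
  have h2 := snorm_fun y pc; have h3 := normc_gexp_le1 a y q0.
  have p0 : 0 <= (1 + `|y|) ^+ N * normc (phi' y).
    by rewrite mulr_ge0 ?exprn_ge0 ?normc_ge0// addr_ge0.
  rewrite [leLHS](_ : _ = ((1 + `|y|) ^+ N * normc (phi' y)) * normc (W y) ^+ n * normc (gexp q a y)); last by ring.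
  apply: (@le_trans _ _ (((1 + `|y|) ^+ N * normc (phi' y)) * normc (W y) ^+ n)).
    by rewrite ler_piMr// mulr_ge0// exprn_ge0// normc_ge0.
  by apply: ler_pM => //; rewrite exprn_ge0// normc_ge0.
elim: M phi => [|M IH] phi pA.
  have [C C0 CP] := base phi pA; exists C => // n q a q01.
  by apply: snorm0 => y; rewrite !expr0 !mulr1; exact: CP.
have [C0 C00 C0P] := base phi pA.
have [C3 C30 C3P] := IH phi pA.
have [C1 C1P] := choice_ge0 (fun j => IH _ (csupp_pderiv j clA pA)).
have [C2 C2P] := choice_ge0 (fun j => IH _ (csuppM (smooth_pderiv j sW) pA)).
have [C4 C4P] := choice_ge0 (fun j => IH _ (csuppM (smooth_coord R j) pA)).
(* The summands account for the derivative falling on [phi], on [W ^+ n], on the character and on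
   the Gaussian. In the second case one factor [W] is consumed, hence the division by [r]. *)
pose Cj j := C1 j + C2 j / r + C3 + C4 j.
have Cj0 j : 0 <= Cj j.
  have [? _] := C1P j; have [? _] := C2P j; have [? _] := C4P j.
  by rewrite !addr_ge0// divr_ge0// ltW.
have S0 : 0 <= \sum_j Cj j by rewrite sumr_ge0.
exists (C0 + \sum_j Cj j); first by rewrite addr_ge0.
move=> n q a q01; have [q0 q1] := andP q01.
have rn0 m : 0 <= r ^+ m by rewrite exprn_ge0// ltW.
have n1 : (1 : R) <= 1 + n%:R by rewrite lerDl.
have a1 : 1 <= 1 + `|a| by rewrite lerDl.
have nM0 m : (0 : R) <= (1 + n%:R) ^+ m by rewrite exprn_ge0// addr_ge0.
have aM0 m : 0 <= (1 + `|a|) ^+ m by rewrite exprn_ge0// addr_ge0.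
apply: snormS => [y|j].
  apply: (le_trans (C0P n q a q01 y)); rewrite ler_wpM2r// -mulrA.
  rewrite -[leLHS]mulr1; apply: ler_pM => //; first by rewrite lerDl.
  by rewrite mulr_ege1// exprn_ege1.
set X := (1 + n%:R) ^+ M.+1 * (1 + `|a|) ^+ M.+1 * r ^+ n.
have X0 : 0 <= X by rewrite !mulr_ge0.
have [C10 C1j] := C1P j; have [C20 C2j] := C2P j; have [C40 C4j] := C4P j.
have sp := pA.1; have sg := smooth_gexp q a.
have sWn m := smoothX m sW.
have sdW := smooth_pderiv j sW; have sdp := smooth_pderiv j sp.
have sy := smooth_coord R j.
apply: (@snormW _ _ M N M N _ (Cj j * X)) => //.
  rewrite -!mulrA (mulrA ((1 + n%:R) ^+ M.+1)) -/X; apply: ler_wpM2r => //.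
  by rewrite (bigD1 j)//= addrCA lerDl addr_ge0// sumr_ge0.
have XM : (1 + n%:R) ^+ M * (1 + `|a|) ^+ M * r ^+ n <= X.
  rewrite /X !exprS; apply: ler_wpM2r => //; apply: ler_pM => //; by rewrite ler_peMl.
have t1 : snorm_le M N (fun y => W y ^+ n * pderiv j phi y * gexp q a y) (C1 j * X).
  apply: snormW (C1j n q a q01) => //.
  by rewrite -!mulrA; apply: ler_wpM2l => //; rewrite mulrA.
have t3 : snorm_le M N (fun y => (0 +i* a 0 j) * (W y ^+ n * phi y * gexp q a y)) (C3 * X).
  apply: snormW (snormZ _ (smoothM (smoothM (sWn n) sp) sg) (C3P n q a q01)) => //.
  rewrite [normc (0 +i* _)](_ : _ = `|a 0 j|); last first.
    by rewrite normc_ReImE /= expr0n add0r sqrtr_sqr.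
  rewrite -!mulrA mulrCA; apply: ler_wpM2l => //.
  rewrite /X mulrCA -mulrA; apply: ler_pM; rewrite ?mulr_ge0//.
    by rewrite exprS ler_peMl.
  rewrite mulrA; apply: ler_wpM2r => //; rewrite exprS; apply: ler_wpM2r => //.
  by rewrite (le_trans (normr_coord_le a j))// lerDr.
have t4 : snorm_le M N (fun y => (- q)%:C * (W y ^+ n * ((y 0 j)%:C * phi y) * gexp q a y)) (C4 j * X).
  apply: snormW (snormZ _ (smoothM (smoothM (sWn n) (smoothM sy sp)) sg) (C4j n q a q01)) => //.
  rewrite normcR normrN ger0_norm// -!mulrA mulrCA; apply: ler_wpM2l => //.
  by apply: le_trans XM; rewrite mulrA ler_piMl// !mulr_ge0.
have t2 : snorm_le M N (fun y => pderiv j (fun z => W z ^+ n) y * phi y * gexp q a y) (C2 j / r * X).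
  case: n {XM t1 t3 t4} @X X0 n1 nM0 => [|n] X X0 n1 nM0.
    have -> : (fun y => pderiv j (fun z => W z ^+ 0) y * phi y * gexp q a y) = fun=> 0.
      by rewrite pderiv_cst; apply/funext => y; rewrite !mul0r.
    by apply: snormW (@snorm_zero R d M N) => //; rewrite mulr_ge0// divr_ge0// ltW.
  rewrite (pderivX j n sW).
  have -> : (fun y => n.+1%:R * W y ^+ n * pderiv j W y * phi y * gexp q a y) =
      (fun y => (n.+1%:R : R)%:C * (W y ^+ n * (pderiv j W y * phi y) * gexp q a y)).
    apply/funext => y; have -> : (n.+1%:R : R)%:C = n.+1%:R :> R[i] by rewrite raddfMn.
    ring.
  apply: snormW (snormZ _ (smoothM (smoothM (sWn n) (smoothM sdW sp)) sg) (C2j n q a q01)) => //.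
  rewrite normcR ger0_norm ?ler0n//.
  have -> : C2 j / r * X = C2 j * ((1 + n.+1%:R) ^+ M.+1 * (1 + `|a|) ^+ M.+1 * r ^+ n).
    by rewrite /X [r ^+ n.+1]exprS; field; rewrite gt_eqF.
  rewrite -!mulrA mulrCA; apply: ler_wpM2l => //.
  rewrite [leLHS]mulrA; apply: ler_pM.
  - by rewrite mulr_ge0 ?ler0n// exprn_ge0// addr_ge0.
  - exact: mulr_ge0.
  - rewrite [leRHS]exprS; apply: ler_pM; rewrite ?ler0n// ?exprn_ge0 ?addr_ge0//.
      by rewrite lerDr.
    by rewrite lerXn2r ?nnegrE ?addr_ge0// lerD2l ler_nat.
  - by apply: ler_wpM2r => //; rewrite exprS ler_peMl.
have -> : pderiv j (fun y => W y ^+ n * phi y * gexp q a y) = (fun y =>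
    W y ^+ n * pderiv j phi y * gexp q a y + pderiv j (fun z => W z ^+ n) y * phi y * gexp q a y +
    (0 +i* a 0 j) * (W y ^+ n * phi y * gexp q a y) +
    (- q)%:C * (W y ^+ n * ((y 0 j)%:C * phi y) * gexp q a y)).
  rewrite (pderivM j (smoothM (sWn n) sp) sg) (pderivM j (sWn n) sp) pderiv_gexp.
  by apply/funext => y; ring.
have -> : Cj j * X = C1 j * X + C2 j / r * X + C3 * X + C4 j * X by rewrite /Cj; ring.
have s1 := smoothM (smoothM (sWn n) sdp) sg.
have s2 := smoothM (smoothM (smooth_pderiv j (sWn n)) sp) sg.
have s3 := smoothZ (0 +i* a 0 j) (smoothM (smoothM (sWn n) sp) sg).
have s4 := smoothZ (- q)%:C (smoothM (smoothM (sWn n) (smoothM sy sp)) sg).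
exact: (snormD (smoothD (smoothD s1 s2) s3) s4 (snormD (smoothD s1 s2) s3 (snormD s1 s2 t1 t2) t3) t4).
Qed.

End power_estimate.

(** * The two estimates of the local spectral radius *)

Section main_estimates.
Context (R : realType) (d : nat).
Implicit Types (phi psi : 'rV[R]_d -> R[i]) (x y a : 'rV[R]_d) (j : 'I_d).
Implicit Types (P : mpoly.mpoly d R[i]).

Lemma smooth_ref g : smooth g -> smooth (fun y : 'rV[R]_d => (ref g y)%:C).
Proof.
move=> sg; apply/smoothP => k; elim: k g sg => [|k IH] g sg.
  exact: (ccont_real (smooth_ccont sg).1).
apply: (@sm_step _ _ _ _ (fun j y => (ref (pderiv j g) y)%:C)).
- exact: (ccont_real (smooth_ccont sg).1).
- by move=> j x; apply: isd_real; have [] := smooth_isd j x sg.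
- by move=> j; apply: IH; exact: smooth_pderiv.
Qed.

Lemma smooth_imf g : smooth g -> smooth (fun y : 'rV[R]_d => (imf g y)%:C).
Proof.
move=> sg; apply/smoothP => k; elim: k g sg => [|k IH] g sg.
  exact: (ccont_real (smooth_ccont sg).2).
apply: (@sm_step _ _ _ _ (fun j y => (imf (pderiv j g) y)%:C)).
- exact: (ccont_real (smooth_ccont sg).2).
- by move=> j x; apply: isd_real; have [] := smooth_isd j x sg.
- by move=> j; apply: IH; exact: smooth_pderiv.
Qed.

(** [W] is the conjugate of [g] divided by [|g|^2 + 1 - b], with [b] the bump at [x]. The term
    [1 - b] vanishes on the box of radius [e] and is 1 outside the doubled box, where [g] may
    vanish; so [W] is smooth everywhere. *)
Lemma smooth_local_inverse g x (e : R) : smooth g -> 0 < e ->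
  (forall y, box x (2 * e) y -> g y != 0) ->
  exists2 W, smooth W & forall y, box x e y -> W y * g y = 1.
Proof.
move=> sg e0 g0; have sb := smooth_bump x e.
set q := fun y => ref g y ^+ 2 + imf g y ^+ 2 + (1 - box_bump x e y).
have sqr_gt0 y : g y != 0 -> 0 < ref g y ^+ 2 + imf g y ^+ 2.
  move=> gy; rewrite lt_def addr_ge0 ?sqr_ge0// andbT.
  apply: contra gy => /eqP h; apply/eqP/normc_eq0P.
  by rewrite normc_ReImE -/(ref g y) -/(imf g y) h sqrtr0.
have q0 y : 0 < q y.
  rewrite /q; have [yb|yb] := leP `|y - x| (2 * e).
    by rewrite ltr_pwDl ?sqr_gt0 ?g0// subr_ge0 bump_le1.
  by rewrite bump_eq0// subr0 ltr_wpDl// addr_ge0// sqr_ge0.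
have sq : smooth (fun y => (q y)%:C).
  have -> : (fun y => (q y)%:C) = (fun y => (ref g y)%:C ^+ 2 + (imf g y)%:C ^+ 2 +
      (1 + (-1) * (box_bump x e y)%:C)).
    apply/funext => y; rewrite /q !realcD; congr (_ + _ + (_ + _)).
    - by rewrite expr2 realcM.
    - by rewrite expr2 realcM.
    - by apply: complex_ext => /=; rewrite ?CReM ?CImM /=; ring.
  apply: (smoothD (smoothD (smoothX 2 (smooth_ref sg)) (smoothX 2 (smooth_imf sg)))).
  exact: (smoothD (smooth_cst 1) (smoothZ _ sb)).
exists (fun y => ((ref g y)%:C + (0 +i* -1) * (imf g y)%:C) * (q y)^-1%:C).
  apply: smoothM; first exact: (smoothD (smooth_ref sg) (smoothZ _ (smooth_imf sg))).
  by apply: smooth_inv => // y; rewrite gt_eqF.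
move=> y yb; have qy : q y = ref g y ^+ 2 + imf g y ^+ 2.
  by rewrite /q bump_eq1// subrr addr0.
rewrite mulrAC.
have -> : ((ref g y)%:C + (0 +i* -1) * (imf g y)%:C) * g y = (q y)%:C.
  by rewrite qy; apply: complex_ext; rewrite !(CReM, CImM, CReD, CImD) /= /ref /imf; ring.
by rewrite -realcM divff// gt_eqF.
Qed.

Lemma pow_geometric_limit (u K theta : R) (p : nat) : 0 <= K -> 0 <= theta < 1 ->
  (forall n, (0 < n)%N -> u <= K * (1 + n%:R) ^+ p * theta ^+ n) -> u <= 0.
Proof.
move=> K0 /andP[t0 t1] uK; move: t0; rewrite le_eqVlt => /predU1P[t0|t0].
  by have := uK 1%N isT; rewrite -t0 expr1 mulr0.
(* Half of the decay of [theta ^+ n = exp (- 2 s n)] absorbs the polynomial factor, the other half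
   provides [1 / n]. *)
set s := - ln theta / 2.
have s0 : 0 < s by rewrite divr_gt0// oppr_gt0 ln_lt0// t0.
have te : theta = expR (- (2 * s)).
  by rewrite /s mulrC divfK// opprK lnK// posrE.
apply: (@le_archimedean_limit _ _ _ (K * (p`!%:R * s ^- p * expR s) / s)) => k.
rewrite add0r; apply: (le_trans (uK k.+1 isT)); set n := k.+1.
have n0 : (0 : R) < n%:R by rewrite ltr0n.
have h1 : (1 + n%:R) ^+ p <= p`!%:R * s ^- p * expR (s * (1 + n%:R)).
  have sn0 : 0 <= s * (1 + n%:R) by apply: mulr_ge0; [exact: ltW | exact: addr_ge0].
  have h := expr_le_fact_expR p sn0; rewrite exprMn in h.
  by rewrite mulrAC ler_pdivlMr ?exprn_gt0// mulrC.
have h2 : theta ^+ n = expR (- (s * n%:R)) * expR (- (s * n%:R)).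
  by rewrite te -expRM_natl -expRD; congr expR; ring.
have h3 : expR (- (s * n%:R)) <= (s * n%:R)^-1.
  have sn : 0 < s * n%:R by rewrite mulr_gt0.
  rewrite expRN lef_pV2 ?posrE ?expR_gt0//.
  by apply: le_trans (expR_ge1Dx _); rewrite lerDr.
have F0 : 0 <= p`!%:R * s ^- p by rewrite mulr_ge0// invr_ge0 exprn_ge0// ltW.
rewrite -!mulrA; apply: ler_wpM2l => //.
apply: (@le_trans _ _ (p`!%:R * s ^- p * expR (s * (1 + n%:R)) * (expR (- (s * n%:R)) * (s * n%:R)^-1))).
  apply: ler_pM => //; first by apply: exprn_ge0; rewrite te expR_ge0.
  by rewrite h2 ler_wpM2l// expR_ge0.
rewrite mulrDr mulr1 expRD expRN invfM.
rewrite le_eqVlt; apply/orP; left; apply/eqP; field.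
by rewrite !gt_eqF// ?expR_gt0// exprn_gt0.
Qed.

Variables (f : 'rV[R]_d -> R[i]) (T : ('rV[R]_d -> R[i]) -> R[i]).
Hypotheses (sf : smooth f) (tT : tempered T) (Tf : extends_fun T f).
Local Notation S := (dist_supp (fourier_dist T)).

Lemma continuous_pevali P : continuous (fun y : 'rV[R]_d => normc (pevali P y)).
Proof.
apply: ccont_normc; have -> : pevali P = symb (lop_of_poly P).
  by apply/funext => y; exact: pevaliE.
exact: (smooth_ccont (moderate_symb _).1).
Qed.

Lemma le_maxmod P (K : set 'rV[R]_d) x : compact K -> K x -> normc (pevali P x) <= maxmod P K.
Proof.
move=> cK Kx; have [c [_ uc]] := compact_bound cK (@continuous_pevali P).
apply: ub_le_sup; last by exists x.
by exists c => _ [y Ky <-]; exact: uc.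
Qed.

(** The empty set, where [sup] is 0, is included because the support is not known to be
    non-empty. *)
Lemma maxmod_ge0 P (K : set 'rV[R]_d) : compact K -> 0 <= maxmod P K.
Proof.
move=> cK; have [[x Kx]|K0] := pselect (K !=set0).
  exact: le_trans (normc_ge0 _) (le_maxmod P cK Kx).
have -> : K = set0 by apply/seteqP; split=> // x Kx; apply: K0; exists x.
by rewrite /maxmod image_set0 sup0.
Qed.

Lemma iter_pdiffopE P n : iter n (pdiffop P) f = iter n (lop (lop_of_poly P)) f.
Proof. by elim: n => //= n ->; rewrite pdiffopE. Qed.

Lemma Rtilde_le_maxmod P : compact S -> (Rtilde P f <= (maxmod P S)%:E)%E.
Proof.
(* The maximum itself need not be admissible; every larger number is. *)
move=> cS; apply/lee_addgt0Pr => e e0; rewrite -EFinD.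
set r := maxmod P S + e.
have r0 : 0 < r by rewrite ltr_wpDl// maxmod_ge0.
apply: ereal_inf_lbound; exists r => //; split; first exact: ltW.
set L := lop_of_poly P.
set U := [set y | normc (pevali P y) < r].
have oU : open U.
  have /continuousP oP := @continuous_pevali P.
  exact: (oP [set t | t < r] (@open_lt _ r)).
have SU : S `<=` U by move=> x Sx; rewrite /U /= /r ltr_pwDr// le_maxmod.
have [chi [A [V [cA AU pA oV [SV V1]]]]] := cutoff_exists cS oU SU.
have [M [N [D D0 DP]]] := fourier_dist_bound tT.
have ms := moderate_symb L.
have [|C C0 CP] := @snorm_pow_gexp R d A (symb L) r M N chi cA ms.1 r0 _ pA.
  by move=> y /AU; rewrite /U /= pevaliE => /ltW.
have G0 := gauss_mass_gt0 R d.
(* [2 ^+ M] replaces [1 + n] by [2 n], which is legitimate because [n >= 1]. The same [M], the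
   number of derivatives in the seminorm, is the exponent of both [n] and [1 + |a|]. *)
exists M, ((gauss_mass R d)^-1 * (D * C) * 2 ^+ M); split.
  by rewrite !mulr_ge0 ?exprn_ge0// invr_ge0 ltW.
move=> n a n0; rewrite iter_pdiffopE -/L.
have key : gauss_mass R d * normc (iter n (lop L) f a) <=
    D * (C * (1 + n%:R) ^+ M * (1 + `|a|) ^+ M * r ^+ n).
  apply: (@reconstruction_bound _ _ f T sf tT Tf) => q /andP[q0 q1].
  have sE := sschwartz_gexp a q0.
  have msn := moderateX n ms.
  have mc : moderate (fun y => 1 + (-1) * chi y).
    apply: (moderateD (@moderate_cst R d 1)); apply: moderateZ.
    have [sc cc] := csupp_sschwartz cA pA; split=> // M'.
    have [c ccM] := cc M' 0%N; exists 0%N, c => s sM x.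
    by have := ccM s sM x; rewrite !expr0 mul1r mulr1.
  have pE := csuppMr sE.1 (csuppM msn.1 pA).
  have s1 := csupp_sschwartz cA pE.
  have s2 : sschwartz (fun y => (1 + (-1) * chi y) * (symb L y ^+ n * gexp q a y)).
    exact: (sschwartzM mc (sschwartzM msn sE)).
  have -> : (fun y => symb L y ^+ n * gexp q a y) = (fun y => symb L y ^+ n * chi y * gexp q a y +
      (1 + (-1) * chi y) * (symb L y ^+ n * gexp q a y)).
    by apply/funext => y; ring.
  rewrite (fourier_distD tT s1 s2) [X in _ + X](fourier_dist_eq0 tT oV SV s2) ?addr0.
    by apply: DP => //; apply: CP; rewrite (ltW q0).
  by move=> y /V1 ->; rewrite mulN1r subrr mul0r.
rewrite -(ler_pM2l G0) (le_trans key)//.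
rewrite [leRHS](_ : _ = D * (C * (2 * n%:R) ^+ M * (1 + enorm a) ^+ M * r ^+ n)); last first.
  by rewrite exprMn; field; rewrite gt_eqF.
have n1 : (1 : R) <= n%:R by rewrite ler1n.
have ea := norm_le_enorm a.
apply: ler_wpM2l => //; apply: ler_wpM2r; first by rewrite exprn_ge0// ltW.
apply: ler_pM; rewrite ?mulr_ge0 ?exprn_ge0 ?addr_ge0//.
  by apply: ler_wpM2l => //; rewrite lerXn2r ?nnegrE ?addr_ge0 ?mulr_ge0//; lra.
by rewrite lerXn2r ?nnegrE ?addr_ge0 ?enorm_ge0// lerD2l.
Qed.

(** For the cutoffs of [psi] the pairing is an integral, bounded uniformly in [k] by the growth of
    the iterated operator on [f]. The uncontrolled constant [D] serves only to pass to the limit and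
    does not enter the bound. *)
Lemma tempered_iter_lop_growth L n psi (C c : R) N : 0 <= C -> sschwartz psi ->
  (forall x, normc (iter n (lop L) f x) <= C * (1 + enorm x) ^+ N) ->
  snorm_le 0 (N + 2 * d) psi c ->
  normc (T (iter n (lop (lop_adj L)) psi)) <= 2 * (C * (1 + d%:R) ^+ N * c * bigW R d).
Proof.
move=> C0 sp fC pc; have c0 := snorm_ge0 pc.
have [M' [N' [D D0 DP]]] := tempered_iter_lop_bound tT L n.
apply: (@seminorm_cutoff_limit R d (fun psi => T (iter n (lop (lop_adj L)) psi)) M' N' D) => //.
  by move=> g h sg sh; exact: tempered_iter_lopD.
move=> k; have ck := csuppMr sp.1 (@csupp_cutoff R d k).
have cb := @compact_box R d 0 (2 * k.+1%:R).
rewrite (tempered_iter_lop sf Tf L n cb ck).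
apply: normc_cintegral_dom; split.
  exact: (smooth_ccont (smoothM (smooth_iter_lop L n sf) ck.1)).
move=> x; rewrite (normcM _ (_ * _)) (normcM (cutoff k x)).
have w0 := ltW (weight_gt0 x).
have h1 : normc (cutoff k x) * normc (psi x) <= normc (psi x).
  by rewrite ler_piMl ?normc_ge0// normc_cutoff_le1.
have h2 : (1 + `|x|) ^+ N * normc (psi x) <= c * weight x.
  have := snorm_fun x pc; rewrite exprD => h.
  apply: (@le_trans _ _ ((1 + `|x|) ^+ N * (1 + `|x|) ^+ (2 * d) * normc (psi x) * weight x)).
    rewrite [leRHS](_ : _ = (1 + `|x|) ^+ N * normc (psi x) * ((1 + `|x|) ^+ (2 * d) * weight x)); last by ring.
    by rewrite ler_peMr ?weight_ge// mulr_ge0 ?exprn_ge0 ?normc_ge0// addr_ge0.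
  by rewrite ler_wpM2r.
apply: (@le_trans _ _ (C * ((1 + d%:R) * (1 + `|x|)) ^+ N * normc (psi x))).
  apply: ler_pM; rewrite ?normc_ge0 ?mulr_ge0 ?normc_ge0//.
  apply: (le_trans (fC x)); apply: ler_wpM2l => //.
  by rewrite lerXn2r ?nnegrE ?mulr_ge0 ?addr_ge0 ?enorm_ge0// enorm_le.
rewrite exprMn.
rewrite [leLHS](_ : _ = C * (1 + d%:R) ^+ N * ((1 + `|x|) ^+ N * normc (psi x))); last by ring.
rewrite -[leRHS]mulrA; apply: ler_wpM2l => //.
by rewrite mulr_ge0// exprn_ge0// addr_ge0.
Qed.

(* If [r < |P(ix)|], then near [x] a test function [phi] is [P(i.)^n] times
   [W^n phi] with [W] an inverse of [P(i.)]; moving [P(i.)^n] onto [f] bounds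
   [T (F phi)] by a power of [n] times [(r / r1)^n]. *)
Lemma supp_le_Rtilde P x : S x -> ((normc (pevali P x))%:E <= Rtilde P f)%E.
Proof.
move=> Sx; apply: le_ereal_inf_tmp => _ [r [r0 [N [C [C0 rC]]]] <-]; rewrite lee_fin leNgt.
apply/negP => rP; apply: Sx.
set r1 := (r + normc (pevali P x)) / 2.
have r10 : 0 < r1 by rewrite divr_gt0// ltr_wpDl// (le_lt_trans r0).
have rr1 : r < r1 by rewrite /r1; move: rP; set u := normc _; lra.
have r1P : r1 < normc (pevali P x) by rewrite /r1; move: rP; set u := normc _; lra.
set L := lop_of_poly P.
set U := [set y | r1 < normc (pevali P y)].
have oU : open U.
  have /continuousP oP := @continuous_pevali P.
  exact: (oP [set t | r1 < t] (@open_gt _ r1)).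
have [e [e0 eU]] := open_box oU r1P.
have sL := (moderate_symb L).1.
have g0 y : box x (2 * e) y -> symb L y != 0.
  move=> /eU; rewrite /U /= pevaliE => h; apply/eqP => h0.
  by move: h; rewrite h0 normc0 ltNge (ltW r10).
have [W sW W1] := smooth_local_inverse sL e0 g0.
exists [set y | `|y - x| < e]; last by rewrite /= subrr normr0.
split; first exact: open_obox.
move=> phi tp pV; have pA := test_fun_csupp tp; have cA := tp.2.
have Wr y : tsupp phi y -> normc (W y) <= r1^-1.
  move=> /pV /= /ltW ye; have /(congr1 (fun z => normc z)) := W1 y ye.
  rewrite normcM normc1 => h.
  have : r1 < normc (symb L y).
    rewrite -pevaliE; apply: eU; apply: (le_trans ye).
    by lra.
  move=> h1; rewrite -[leRHS]mul1r -h ler_pdivlMr// ler_wpM2l ?normc_ge0//.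
  exact: ltW.
have r1i : 0 < r1^-1 by rewrite invr_gt0.
(* [N] powers of decay for the growth of [P(D)^n f], and [2 * d] for integrability. *)
have [M' [N' [D D0 DP]]] := @fourier_snorm R d 0 (N + 2 * d).
have [B B0 BP] := snorm_pow_gexp M' N' cA sW r1i Wr pA.
(* The power estimate at [q = 0] and [a = 0] thus applies to [W ^+ n * phi] alone. *)
have g1 : gexp 0 (0 : 'rV[R]_d) = fun=> 1.
  by apply/funext => y; rewrite /gexp dotvC /dotv big1 ?oppr0 ?mul0r ?expR0 ?mulr1 /expi ?cos0 ?sin0// => j _; rewrite mxE mul0r.
have sWn n : sschwartz (fun y => W y ^+ n * phi y).
  exact: (csupp_sschwartz cA (csuppM (smoothX n sW) pA)).
have BW n : snorm_le M' N' (fun y => W y ^+ n * phi y) (B * (1 + n%:R) ^+ M' * r1^-1 ^+ n).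
  have := BP n 0 0; rewrite lexx ler01 g1 normr0 addr0 expr1n mulr1 => /(_ isT).
  by under eq_fun do rewrite mulr1.
have Tn n : T (fourier phi) = T (iter n (lop (lop_adj L)) (fourier (fun y => W y ^+ n * phi y))).
  rewrite (iter_lop_fourier L n (sWn n)); congr (T (fourier _)); apply/funext => y.
  have [py|/eqP py] := pselect (phi y = 0); first by rewrite py !mulr0.
  have ye : box x e y.
    by apply: ltW; apply: pV; apply: subset_closure.
  by rewrite mulrA -exprMn mulrC [symb L y * _]mulrC (W1 y ye) expr1n mulr1.
rewrite /fourier_dist; apply: normc_eq0P; apply/eqP; rewrite eq_le normc_ge0 andbT.
set Q := 2 * (C * (1 + d%:R) ^+ N * (D * B) * bigW R d).
have Q0 : 0 <= Q by rewrite !mulr_ge0 ?exprn_ge0 ?addr_ge0// bigW_ge0.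
apply: (@pow_geometric_limit _ Q (r / r1) (N + M')) => //.
  by rewrite divr_ge0 ?(ltW r10)// ltr_pdivrMr// mul1r.
move=> n n0; rewrite (Tn n).
have C'0 : 0 <= C * n%:R ^+ N * r ^+ n by rewrite !mulr_ge0 ?exprn_ge0.
have hg z : normc (iter n (lop L) f z) <= C * n%:R ^+ N * r ^+ n * (1 + enorm z) ^+ N.
  by rewrite -iter_pdiffopE; exact: rC.
apply: (le_trans (tempered_iter_lop_growth C'0 (sschwartz_fourier (sWn n)) hg (DP _ _ (sWn n) (BW n)))).
rewrite [leLHS](_ : _ = Q * (n%:R ^+ N * (1 + n%:R) ^+ M') * (r / r1) ^+ n); last first.
  by rewrite /Q exprMn; ring.
apply: ler_wpM2r; first by rewrite exprn_ge0// divr_ge0// ltW.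
apply: ler_wpM2l => //; rewrite exprD; apply: ler_wpM2r.
  by rewrite exprn_ge0// addr_ge0.
by rewrite lerXn2r ?nnegrE ?addr_ge0// lerDr.
Qed.

End main_estimates.

(** * Polynomial hulls *)

Section determining_polynomials.
(* The notations of [mpoly] clash with those of the analysis library. *)
Import (canonicals) mpoly.
Context (R : realType) (d : nat).

(** The sum enters with a plus sign because evaluation is at [i y], where
    [(i y_j - i x_j)^2 = - (y_j - x_j)^2]. *)
Definition sqdist_poly (c : R) (x : 'rV[R]_d) : mpoly.mpoly d R[i] :=
  (mpoly.mpolyC d c%:C + \sum_j (mpoly.mpolyX R[i] (mpoly.mnm1 j) - mpoly.mpolyC d (0 +i* x 0 j)) ^+ 2)%R.

Lemma pevali_sqdist c x y : pevali (sqdist_poly c x) y = (c - dotv (y - x) (y - x))%:C.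
Proof.
rewrite /pevali /sqdist_poly mpoly.mevalD mpoly.mevalC raddf_sum /= realcD; congr (_ + _).
rewrite /dotv; elim/big_rec2: _ => [|j u v _ ->]; first by rewrite oppr0.
rewrite expr2 mpoly.mevalM mpoly.mevalB mpoly.mevalXU mpoly.mevalC !mxE.
by apply: complex_ext; rewrite ?(CReM, CImM, CReD, CImD, CReN, CImN) /=; ring.
Qed.

End determining_polynomials.

Section polynomial_hull.
Context (R : realType) (d : nat).

Lemma mem_polynomial_hull (K : set 'rV[R]_d) x : compact K ->
  (forall P : mpoly.mpoly d R[i], normc (pevali P x) <= maxmod P K) -> K x.
Proof.
move=> cK PK; apply: contrapT => nKx.
have oK : open (~` K) by apply: closed_openC; exact: rV_compact_closed.
have [e [e0 eK]] := open_box oK nKx.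
(* The case [c = 0] of the polynomial is, in modulus, the squared distance to [x]; so the same
   family yields the bound [c] on [K]. *)
have [c [c0 cP]] := compact_bound cK (@continuous_pevali R d (sqdist_poly 0 x)).
have dE y : normc (pevali (sqdist_poly 0 x) y) = dotv (y - x) (y - x).
  rewrite pevali_sqdist sub0r normcR normrN ger0_norm//.
  by apply: sumr_ge0 => j _; rewrite -expr2 sqr_ge0.
have d0 : dotv (x - x) (x - x) = 0 by rewrite /dotv big1// => j _; rewrite subrr mxE mul0r.
have := PK (sqdist_poly (c + 1) x); rewrite pevali_sqdist d0 subr0 normcR ger0_norm ?addr_ge0//.
apply/negP; rewrite -ltNge.
(* Points of [K] are at distance at least [e] from [x]. Capping [e] at 1 keeps this bound
   nonnegative, which settles the empty [K], whose [maxmod] is 0. *)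
apply: (@le_lt_trans _ _ (c + 1 - Num.min e 1 ^+ 2)); last first.
  by rewrite ltrBlDr ltrDl exprn_gt0// lt_min e0 ltr01.
have m0 : 0 <= Num.min e 1 by rewrite le_min (ltW e0) ler01.
have m1 : Num.min e 1 ^+ 2 <= 1 by rewrite exprn_ile1// ge_min lexx orbT.
have [K0|/set0P [z Kz]] := eqVneq K set0.
  by rewrite /maxmod K0 image_set0 sup0 -addrA addr_ge0// subr_ge0.
apply: ge_sup; first by exists (normc (pevali (sqdist_poly (c + 1) x) z)), z.
move=> _ [y Ky <-]; have := cP y Ky; rewrite dE => yc.
rewrite pevali_sqdist normcR ger0_norm; last by rewrite subr_ge0; lra.
rewrite lerD2l lerN2; apply: (le_trans _ (normr_sqr_le_sqn _)).
rewrite lerXn2r ?nnegrE// ge_min; apply/orP; left.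
rewrite leNgt; apply/negP => ye; apply: (eK y) => //; rewrite /box /=.
by rewrite (le_trans (ltW ye))// ler_peMl ?ler1n// ltW.
Qed.
End polynomial_hull.

Theorem theorem2p15 (R : realType) (d : nat) (f : 'rV[R]_d -> R[i])
    (T : ('rV[R]_d -> R[i]) -> R[i])
    (smooth_f : smooth f)
    (tempered_T : tempered T) (T_extends_f : extends_fun T f)
    (compact_supp : compact (dist_supp (fourier_dist T)))
    (K : set 'rV[R]_d) (K_neq0 : K !=set0) (compact_K : compact K) :
  [/\ (forall PK : set (mpoly.mpoly d R[i]), determines PK K ->
         (dist_supp (fourier_dist T) `<=` K <->
          forall P, PK P -> (Rtilde P f <= (maxmod P K)%:E)%E)),
      (f <> cst 0 ->
       forall PS : set (mpoly.mpoly d R[i]),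
         determines PS (dist_supp (fourier_dist T)) ->
         forall lambda : 'rV[R]_d,
           dist_supp (fourier_dist T) lambda <->
           forall P, PS P ->
             ((ComplexField.Normc.normc (pevali P lambda))%:E <= Rtilde P f)%E)
    & dist_supp (fourier_dist T) =
        [set lambda | forall P : mpoly.mpoly d R[i],
           ((ComplexField.Normc.normc (pevali P lambda))%:E <= Rtilde P f)%E] ].
Proof.
set S := dist_supp (fourier_dist T).
have lower P x : S x -> ((normc (pevali P x))%:E <= Rtilde P f)%E.
  exact: (@supp_le_Rtilde R d f T smooth_f tempered_T T_extends_f P x).
have upper P : (Rtilde P f <= (maxmod P S)%:E)%E.
  exact: (@Rtilde_le_maxmod R d f T smooth_f tempered_T T_extends_f P compact_supp).
split.
- move=> PK detK; split=> [SK P _|RK x Sx].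
    apply: (le_trans (upper P)); rewrite lee_fin.
    (* Monotonicity of [sup] requires a non-empty set; for an empty support [maxmod P S] is 0. *)
    have [S0|/set0P [x Sx]] := eqVneq S set0.
      by rewrite {1}/maxmod S0 image_set0 sup0; exact: maxmod_ge0.
    apply: ge_sup; first by exists (normc (pevali P x)), x.
    by move=> _ [y Sy <-]; apply: le_maxmod => //; exact: SK.
  rewrite detK => P PP; rewrite /= -lee_fin.
  exact: le_trans (lower P x Sx) (RK P PP).
- move=> _ PS detS x; split=> [Sx P _|Px]; first exact: lower.
  rewrite detS => P PP; rewrite /= -lee_fin.
  exact: le_trans (Px P PP) (upper P).
- apply/seteqP; split=> [x Sx P|x Px]; first exact: lower.
  apply: mem_polynomial_hull => // P; rewrite -lee_fin.
  exact: le_trans (Px P) (upper P).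
Qed.
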